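(* Let $(M^{2m},\varphi,g)$ be a para-Kähler–Norden manifold, let its tangent bundle $TM$ be endowed with the $\varphi$-Sasaki metric $g^{\varphi}$, and let $\xi$ be a vector field on $M$. Then the map $\xi:(M^{2m},\varphi,g)\to(TM,g^{\varphi})$ is a biharmonic map if and only if the following two conditions hold: $$\bar{\Delta}S(\xi)+R(\varphi\xi,\bar{\Delta}\xi)S(\xi)-\mathrm{Tr}_{g}\big(R(S(\xi),\ast)\ast+(\nabla_{S(\xi)}R)(\varphi\xi,\nabla_{\ast}\xi)\ast+R(\varphi\xi,\nabla_{\ast}\xi)\nabla_{\ast}S(\xi)-R(\varphi\xi,R(\ast,S(\xi))\xi)\ast-R(\varphi\xi,\nabla_{\ast}\bar{\Delta}\xi)\ast-R(\varphi\bar{\Delta}\xi,\nabla_{\ast}\xi)\ast\big)=0,$$ and $$\bar{\Delta}^{2}\xi-\mathrm{Tr}_{g}\big((\nabla_{\ast}R)(\ast,S(\xi))\xi+R(\ast,\nabla_{\ast}S(\xi))\xi+2R(\ast,S(\xi))\nabla_{\ast}\xi\big)=0.$$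
   Context: All manifolds, maps and tensor fields are smooth. A para-Kähler–Norden manifold $(M^{2m},\varphi,g)$ is a $2m$-dimensional manifold $M$ with a Riemannian metric $g$ and a $(1,1)$-tensor field $\varphi$ such that $\varphi^2=I$, $\varphi\neq\pm I$, the $+1$ and $-1$ eigenbundles of $\varphi$ have the same rank, $g(\varphi V,W)=g(V,\varphi W)$ for all vector fields $V,W$, and $\nabla\varphi=0$, where $\nabla$ is the Levi-Civita connection of $g$. $R(X,Y)Z=\nabla_X\nabla_YZ-\nabla_Y\nabla_XZ-\nabla_{[X,Y]}Z$ is the curvature tensor of $g$. $\mathrm{Tr}_g$ of an expression containing two asterisks means $\sum_i$ of the expression with both asterisks replaced by $e_i$, for a local $g$-orthonormal frame $\{e_i\}$. For a vector field $W$ on $M$, ${}^{H}W$ and ${}^{V}W$ are its horizontal (with respect to $\nabla$) and vertical lifts to $TM$. The $\varphi$-Sasaki metric $g^{\varphi}$ is the pseudo-Riemannian metric on $TM$ with $g^{\varphi}({}^{H}W,{}^{H}Z)=g(W,Z)$, $g^{\varphi}({}^{H}W,{}^{V}Z)=0$, $g^{\varphi}({}^{V}W,{}^{V}Z)=g(W,\varphi Z)$ (the right-hand sides being composed with the projection $TM\to M$). A vector field $\xi$ on $M$ is regarded as a map $\xi:M\to TM$. For a vector field $X$ on $M$, $\bar{\Delta}X=-\mathrm{Tr}_g(\nabla_{\ast}\nabla_{\ast}-\nabla_{\nabla_{\ast}\ast})X$ is the rough Laplacian, $\bar{\Delta}^2X=\bar{\Delta}\bar{\Delta}X$, and $S(\xi)=\mathrm{Tr}_gR(\varphi\xi,\nabla_{\ast}\xi)\ast$.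 For a smooth map $\psi:(M,g)\to(N,h)$ into a (pseudo-)Riemannian manifold, the tension field is $\tau(\psi)=\mathrm{Tr}_g\nabla d\psi$, and the bitension field is $\tau_2(\psi)=\Delta^{\psi}\tau(\psi)-\mathrm{Tr}_gR^{N}(\tau(\psi),d\psi)d\psi$, where $\Delta^{\psi}=-\mathrm{Tr}_g(\nabla^{\psi}_{\ast}\nabla^{\psi}_{\ast}-\nabla^{\psi}_{\nabla_{\ast}\ast})$ is the rough Laplacian on sections of $\psi^{-1}TN$ and $R^N$ is the curvature tensor of $N$ (same sign convention as $R$). The map $\psi$ is biharmonic if it is a critical point of the bienergy $E_2(\psi)=\frac12\int_K|\tau(\psi)|^2v_g$ (for every compact domain $K$, with $|\cdot|^2$ taken with respect to $h$), equivalently if $\tau_2(\psi)=0$. *)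

(* Defs.v *)
From HB Require Import structures.
From mathcomp Require Import all_boot all_order all_algebra.
From mathcomp Require Import all_classical all_reals.
From mathcomp Require Import topology normedtype derive.
From mathcomp Require Import lra.

Set Implicit Arguments.
Unset Strict Implicit.
Unset Printing Implicit Defensive.

Import Order.TTheory GRing.Theory Num.Theory.
Import numFieldNormedType.Exports.

Local Open Scope classical_set_scope.
Local Open Scope ring_scope.

(* All the iterated directional derivatives of f are Frechet differentiable at
   the points of A; for A open this says that f is C^oo on A. *)
Definition smooth_on (R : realType) (V W : normedModType R) (A : set V)
    (f : V -> W) : Prop :=
  forall (s : seq V) (x : V), A x ->
    differentiable (foldr (fun v (h : V -> W) => fun y => 'D_v h y) f s) x.

(* Riemannian geometry in one chart: functions of the coordinates x : 'rV_n.
   A tangent vector is the row of its components, a metric is its Gram matrix,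
   an endomorphism field acts on rows from the right.  The metrics may be
   indefinite. *)
Section LocalGeometry.
Variables (R : realType) (n : nat).
Local Notation V := 'rV[R]_n.

Definition basis_vec (i : 'I_n) : V := delta_mx 0 i.

Definition inner (G : 'M[R]_n) (u v : V) : R := (u *m G *m v^T) 0 0.

Definition endo (phi : V -> 'M[R]_n) (X : V -> V) : V -> V :=
  fun x => X x *m phi x.

Variable g : V -> 'M[R]_n.

Definition christoffel (k i j : 'I_n) (x : V) : R :=
  2^-1 * \sum_l invmx (g x) k l *
    ('D_(basis_vec i) (fun y => g y j l) x
     + 'D_(basis_vec j) (fun y => g y i l) x
     - 'D_(basis_vec l) (fun y => g y i j) x).

Definition gamma (x u v : V) : V :=
  \row_k \sum_i \sum_j christoffel k i j x * u 0 i * v 0 j.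

(* cov X Y is nabla_X Y for the Levi-Civita connection nabla *)
Definition cov (X Y : V -> V) : V -> V :=
  fun x => 'D_(X x) Y x + gamma x (X x) (Y x).

Definition lie (X Y : V -> V) : V -> V :=
  fun x => 'D_(X x) Y x - 'D_(Y x) X x.

Definition curv (X Y Z : V -> V) : V -> V :=
  cov X (cov Y Z) - cov Y (cov X Z) - cov (lie X Y) Z.

(* (nabla_W R)(X, Y) Z *)
Definition cov_curv (W X Y Z : V -> V) : V -> V :=
  cov W (curv X Y Z) - curv (cov W X) Y Z - curv X (cov W Y) Z
  - curv X Y (cov W Z).

(* The value of the curvature tensor on tangent vectors at x: as it is a
   tensor, the vectors may be extended by constant components. *)
Definition curv_at (x u v w : V) : V :=
  curv (fun=> u) (fun=> v) (fun=> w) x.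

(* Tr_g of an expression B in two asterisks, g^{ij} B(d_i, d_j); for B
   tensorial in both asterisks this is the sum of the B(e_i, e_i) over any
   g-orthonormal frame, see trace_frame below. *)
Definition Tr (W : normedModType R) (B : (V -> V) -> (V -> V) -> V -> W) :
    V -> W :=
  fun x => \sum_i \sum_j
    invmx (g x) i j *: B (fun=> basis_vec i) (fun=> basis_vec j) x.

Definition rough_laplacian (X : V -> V) : V -> V :=
  - Tr (fun E F => cov E (cov F X) - cov (cov E F) X).

End LocalGeometry.

(* A map psi read in charts of the source (metric g) and of the target
   (metric h); sections of the pulled back tangent bundle are functions
   'rV_n -> 'rV_k. *)
Section LocalMaps.
Variables (R : realType) (n k : nat).
Variables (g : 'rV[R]_n -> 'M[R]_n) (h : 'rV[R]_k -> 'M[R]_k).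
Variable psi : 'rV[R]_n -> 'rV[R]_k.
Local Notation V := 'rV[R]_n.
Local Notation W := 'rV[R]_k.

Definition dmap (X : V -> V) : V -> W := fun x => 'D_(X x) psi x.

Definition pull_cov (X : V -> V) (Y : V -> W) : V -> W :=
  fun x => 'D_(X x) Y x + gamma h (psi x) (dmap X x) (Y x).

Definition tension : V -> W :=
  Tr g (fun E F => pull_cov E (dmap F) - dmap (cov g E F)).

Definition pull_rough_laplacian (Y : V -> W) : V -> W :=
  - Tr g (fun E F => pull_cov E (pull_cov F Y) - pull_cov (cov g E F) Y).

Definition bitension : V -> W :=
  pull_rough_laplacian tension
  - Tr g (fun E F x => curv_at h (psi x) (tension x) (dmap E x) (dmap F x)).

End LocalMaps.

(* A set with an atlas; the topology is the one induced by the charts. *)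
Record charted (R : realType) (n : nat) := Charted {
  point :> Type;
  chart : Type;
  dom : chart -> set point;
  coord : chart -> point -> 'rV[R]_n }.

Arguments dom {R n c}.
Arguments coord {R n c}.

Section Manifolds.
Variables (R : realType) (n : nat) (M : charted R n).

(* f \o (coord a)^-1, extended by 0 outside the image of the chart a *)
Definition in_chart (W : zmodType) (a : chart M) (f : M -> W) :
    'rV[R]_n -> W :=
  fun x => match pselect (exists p, dom a p /\ coord a p = x) with
           | left e => f (projT1 (cid e))
           | right _ => 0
           end.

Definition transition (a b : chart M) : 'rV[R]_n -> 'rV[R]_n :=
  in_chart a (coord b).

Definition chart_open (A : set M) : Prop :=
  forall a, open (coord a @` (A `&` dom a)).

Record is_manifold : Prop := IsManifold {
  charts_cover : forall p : M, exists a, dom a p;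
  coord_inj : forall a (p q : M),
    dom a p -> dom a q -> coord a p = coord a q -> p = q;
  overlap_open : forall a b : chart M, open (coord a @` (dom a `&` dom b));
  transition_smooth : forall a b : chart M,
    smooth_on (coord a @` (dom a `&` dom b)) (transition a b);
  manifold_hausdorff : forall p q : M, p <> q ->
    exists A B : set M,
      [/\ chart_open A, chart_open B, A p, B q & A `&` B = set0];
  manifold_second_countable : exists B : nat -> set M,
    (forall k, chart_open (B k)) /\
    (forall A, chart_open A ->
       forall p, A p -> exists k, B k p /\ B k `<=` A) }.

Definition jac (a b : chart M) (p : M) : 'M[R]_n :=
  jacobian (transition a b) (coord a p).

(* A tangent vector at p is the family of its components in the charts around
   p; the value 0 at the other charts makes the family unique. *)
Definition is_tangent (p : M) (v : chart M -> 'rV[R]_n) : Prop :=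
  (forall a b, dom a p -> dom b p -> v b = v a *m jac a b p) /\
  (forall a, ~ dom a p -> v a = 0).

Definition tangent (p : M) : Type := {v | is_tangent p v}.

(* The tangent bundle with its induced atlas (x^1, .., x^n, y^1, .., y^n). *)
Definition tangent_bundle : charted R (n + n) :=
  @Charted R (n + n) {p : M & tangent p} (chart M)
    (fun a q => dom a (projT1 q))
    (fun a q => row_mx (coord a (projT1 q)) (sval (projT2 q) a)).

Definition vector_field : Type := forall p : M, tangent p.

Definition section_map (X : vector_field) : M -> tangent_bundle :=
  fun p => existT tangent p (X p).

Definition local_vf (X : vector_field) (a : chart M) : 'rV[R]_n -> 'rV[R]_n :=
  in_chart a (fun p => sval (X p) a).

Definition smooth_vf (X : vector_field) : Prop :=
  forall a, smooth_on (coord a @` dom a) (local_vf X a).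

(* Tensor fields of rank 2, by their components t p a at the point p in the
   chart a, which are meaningful if p is in the domain of a. *)
Definition mx_field : Type := M -> chart M -> 'M[R]_n.

Definition local_mx (t : mx_field) (a : chart M) : 'rV[R]_n -> 'M[R]_n :=
  in_chart a (fun p => t p a).

Definition smooth_mx (t : mx_field) : Prop :=
  forall a, smooth_on (coord a @` dom a) (local_mx t a).

Definition is_bilinear_field (t : mx_field) : Prop :=
  forall p a b, dom a p -> dom b p ->
    t p a = jac a b p *m t p b *m (jac a b p)^T.

Definition is_endo_field (t : mx_field) : Prop :=
  forall p a b, dom a p -> dom b p -> t p a *m jac a b p = jac a b p *m t p b.

Record riemannian (g : mx_field) : Prop := Riemannian {
  metric_tensor : is_bilinear_field g;
  metric_smooth : smooth_mx g;
  metric_sym : forall p a, dom a p -> (g p a)^T = g p a;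
  metric_pos : forall p a, dom a p -> forall u, u != 0 ->
    0 < inner (g p a) u u }.

End Manifolds.

(* The +1 and -1 eigenspaces of the row action of phi p a are those of phi_p. *)
Record para_kahler_norden (R : realType) (m : nat) (M : charted R (2 * m))
    (phi g : mx_field M) : Prop := ParaKahlerNorden {
  pkn_metric : riemannian g;
  pkn_tensor : is_endo_field phi;
  pkn_smooth : smooth_mx phi;
  pkn_involutive : forall p a, dom a p -> phi p a *m phi p a = 1%:M;
  pkn_neq_id : ~ (forall p a, dom a p -> phi p a = 1%:M);
  pkn_neq_opp_id : ~ (forall p a, dom a p -> phi p a = - 1%:M);
  pkn_rank : forall p a, dom a p ->
    \rank (eigenspace (phi p a) 1) = \rank (eigenspace (phi p a) (- 1));
  pkn_sym : forall p a, dom a p -> forall v w,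
    inner (g p a) (v *m phi p a) w = inner (g p a) v (w *m phi p a);
  pkn_parallel : forall a X Y,
    smooth_on (coord a @` dom a) X -> smooth_on (coord a @` dom a) Y ->
    forall x, (coord a @` dom a) x ->
      cov (local_mx g a) X (endo (local_mx phi a) Y) x =
      endo (local_mx phi a) (cov (local_mx g a) X Y) x }.

Section Sasaki.
Variables (R : realType) (n : nat) (M : charted R n) (phi g : mx_field M).
Local Notation TM := (tangent_bundle M).

(* Lifts to T_(p,u)M of the tangent vector with components w in the chart a,
   in the induced chart: d_(x^i) |-> d_(x^i) - Gamma^k_(ij) y^j d_(y^k) and
   d_(x^i) |-> d_(y^i). *)
Definition hlift (q : TM) (a : chart M) (w : 'rV[R]_n) : 'rV[R]_(n + n) :=
  row_mx w (- gamma (local_mx g a) (coord a (projT1 q)) w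
              (sval (projT2 q) a)).

Definition vlift (w : 'rV[R]_n) : 'rV[R]_(n + n) := row_mx 0 w.

(* These equations determine G; that it is a smooth nondegenerate tensor field
   follows from them. *)
Record is_phi_sasaki (G : mx_field TM) : Prop := IsPhiSasaki {
  phi_sasaki_sym : forall (q : TM) (a : chart TM), dom a q ->
    (G q a)^T = G q a;
  phi_sasaki_hh : forall (q : TM) (a : chart TM), dom a q -> forall w z,
    inner (G q a) (hlift q a w) (hlift q a z) = inner (g (projT1 q) a) w z;
  phi_sasaki_hv : forall (q : TM) (a : chart TM), dom a q -> forall w z,
    inner (G q a) (hlift q a w) (vlift z) = 0;
  phi_sasaki_vv : forall (q : TM) (a : chart TM), dom a q -> forall w z,
    inner (G q a) (vlift w) (vlift z) =
    inner (g (projT1 q) a) w (z *m phi (projT1 q) a) }.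

End Sasaki.

(* tau_2(psi) = 0, in all the charts of the source and of the target *)
Definition biharmonic (R : realType) (n k : nat)
    (M : charted R n) (N : charted R k) (g : mx_field M) (h : mx_field N)
    (psi : M -> N) : Prop :=
  forall (a : chart M) (b : chart N) (p : M), dom a p -> dom b (psi p) ->
    bitension (local_mx g a) (local_mx h b)
      (in_chart a (fun q => coord b (psi q))) (coord a p) = 0.

Section Conditions.
Variables (R : realType) (n : nat).
Local Notation V := 'rV[R]_n.
Variables (phi g : V -> 'M[R]_n) (xi : V -> V).
Local Notation D := (cov g).
Local Notation Rm := (curv g).
Local Notation Delta := (rough_laplacian g).
Local Notation P := (endo phi).

Definition Sfield : V -> V := Tr g (fun E F => Rm (P xi) (D E xi) F).
Local Notation S := Sfield.

Definition first_expr : V -> V :=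
  Delta S + Rm (P xi) (Delta xi) S
  - Tr g (fun E F =>
      Rm S E F
      + cov_curv g S (P xi) (D E xi) F
      + Rm (P xi) (D E xi) (D F S)
      - Rm (P xi) (Rm E S xi) F
      - Rm (P xi) (D E (Delta xi)) F
      - Rm (P (Delta xi)) (D E xi) F).

Definition second_expr : V -> V :=
  Delta (Delta xi)
  - Tr g (fun E F =>
      cov_curv g E F S xi
      + Rm E (D F S) xi
      + Rm E S (D F xi) *+ 2).

End Conditions.

(* The vanishing on M of a vector field given by its expressions in charts *)
Definition vanishes (R : realType) (n : nat) (M : charted R n)
    (X : chart M -> 'rV[R]_n -> 'rV[R]_n) : Prop :=
  forall (a : chart M) (p : M), dom a p -> X a (coord a p) = 0.

Section Facts.
Variables (R : realType) (n : nat).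
Local Notation V := 'rV[R]_n.

Lemma trace_frame (W : normedModType R) (G : 'M[R]_n) (b : V -> V -> W)
    (E : 'M[R]_n) :
  (forall c u v w, b (c *: u + v) w = c *: b u w + b v w) ->
  (forall c u v w, b u (c *: v + w) = c *: b u v + b u w) ->
  (forall i j, inner G (row i E) (row j E) = (i == j)%:R) ->
  \sum_i \sum_j invmx G i j *: b (basis_vec R i) (basis_vec R j)
  = \sum_i b (row i E) (row i E).
Proof.
move=> bl br Eon.
have EGE : E *m G *m E^T = 1%:M.
  apply/matrixP => i j; rewrite [RHS]mxE -Eon /inner -row_mul mxE [RHS]mxE.
  by apply: eq_bigr => k _; rewrite !mxE.
have GEE : G *m (E^T *m E) = 1%:M.
  have := EGE; rewrite -mulmxA => /mulmx1C; rewrite -mulmxA => /[dup] H.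
  by rewrite mulmxA.
have -> : invmx G = E^T *m E.
  have [Gu _] := mulmx1_unit GEE.
  by rewrite -[RHS](mulKmx Gu) GEE mulmx1.
have b0l w : b 0 w = 0.
  have := bl (-1) 0 0 w; rewrite scaler0 addr0 scaleN1r addNr => ->//.
have b0r u : b u 0 = 0.
  have := br (-1) u 0 0; rewrite scaler0 addr0 scaleN1r addNr => ->//.
have bsuml (c : 'I_n -> R) (u : 'I_n -> V) w :
    b (\sum_i c i *: u i) w = \sum_i c i *: b (u i) w.
  by elim/big_rec2 : _ => [|i x y _ <-]; rewrite ?b0l ?bl.
have bsumr (c : 'I_n -> R) (v : 'I_n -> V) u :
    b u (\sum_i c i *: v i) = \sum_i c i *: b u (v i).
  by elim/big_rec2 : _ => [|i x y _ <-]; rewrite ?b0r ?br.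
transitivity (\sum_a \sum_i \sum_j
    (E a i * E a j) *: b (basis_vec R i) (basis_vec R j)); last first.
  apply: eq_bigr => a _; rewrite [in RHS](row_sum_delta (row a E)) bsuml.
  apply: eq_bigr => i _; rewrite bsumr scaler_sumr.
  by apply: eq_bigr => j _; rewrite scalerA !mxE.
rewrite [RHS]exchange_big /=; apply: eq_bigr => i _.
rewrite [RHS]exchange_big /=; apply: eq_bigr => j _.
rewrite mxE scaler_suml; apply: eq_bigr => a _.
by rewrite !mxE.
Qed.

Variable g : V -> 'M[R]_n.
Hypothesis g_sym : forall x, (g x)^T = g x.

Lemma christoffel_sym k i j x : christoffel g k i j x = christoffel g k j i x.
Proof.
congr (_ * _); apply: eq_bigr => l _; congr (_ * (_ - _)); first exact: addrC.
by congr (derive _ _ _); apply/funext => y; rewrite -[in LHS]g_sym mxE.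
Qed.

Lemma christoffel_metric i j k x : g x \in unitmx ->
  'D_(basis_vec R k) (fun y => g y i j) x =
  \sum_l (christoffel g l k i x * g x l j + christoffel g l k j x * g x i l).
Proof.
move=> gu.
have first p q r : \sum_l christoffel g l p q x * g x l r =
    2^-1 * ('D_(basis_vec R p) (fun y => g y q r) x
     + 'D_(basis_vec R q) (fun y => g y p r) x
     - 'D_(basis_vec R r) (fun y => g y p q) x).
  transitivity (2^-1 * \sum_l \sum_s invmx (g x) l s *
      ('D_(basis_vec R p) (fun y => g y q s) x
       + 'D_(basis_vec R q) (fun y => g y p s) x
       - 'D_(basis_vec R s) (fun y => g y p q) x) * g x l r).
    by rewrite mulr_sumr; apply: eq_bigr => l _; rewrite -mulrA mulr_suml.
  congr (_ * _); rewrite exchange_big /=.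
  have ginv s : \sum_l invmx (g x) l s * g x l r = (s == r)%:R.
    have /matrixP/(_ s r) : invmx (g x) *m g x = 1%:M by rewrite mulVmx.
    rewrite !mxE => <-; apply: eq_bigr => l _; congr (_ * _).
    by rewrite -[in LHS](g_sym x) -trmx_inv mxE.
  rewrite (bigD1 r) //= [X in _ + X]big1 ?addr0 => [|s sr].
    under eq_bigr => l _ do rewrite mulrAC.
    by rewrite -mulr_suml ginv eqxx mul1r.
  under eq_bigr => l _ do rewrite mulrAC.
  by rewrite -mulr_suml ginv (negbTE sr) mul0r.
have gs p q y : g y p q = g y q p by rewrite -[in LHS]g_sym mxE.
have gsD v p q : 'D_v (fun y => g y p q) x = 'D_v (fun y => g y q p) x.
  by congr (derive _ _ _); apply/funext => y; exact: gs.
rewrite big_split /= first.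
under [X in _ + X]eq_bigr => l _ do rewrite gs.
rewrite first (gsD (basis_vec R k) j i); lra.
Qed.

End Facts.

Lemma phi_sasaki_exists (R : realType) (n : nat) (M : charted R n)
    (phi g : mx_field M) :
  (forall p a, dom a p -> (g p a)^T = g p a) ->
  (forall p a, dom a p -> forall v w,
    inner (g p a) (v *m phi p a) w = inner (g p a) v (w *m phi p a)) ->
  exists G, is_phi_sasaki phi g G.
Proof.
move=> gs gphi.
have inner_tr (A : 'M[R]_n) u v : inner A u v = inner A^T v u.
  transitivity ((u *m A *m v^T)^T 0 0); first by rewrite [RHS]mxE.
  by rewrite !trmx_mul trmxK mulmxA.
pose K (q : tangent_bundle M) (a : chart M) : 'M[R]_n := \matrix_(i, k)
  \sum_j christoffel (local_mx g a) k i j (coord a (projT1 q))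
    * sval (projT2 q) a 0 j.
have gammaE q a w : gamma (local_mx g a) (coord a (projT1 q)) w
    (sval (projT2 q) a) = w *m K q a.
  apply/rowP => k; rewrite !mxE; apply: eq_bigr => i _.
  by rewrite mxE mulr_sumr; apply: eq_bigr => j _; rewrite mulrCA mulrA.
pose H (q : tangent_bundle M) (a : chart M) :=
  g (projT1 q) a *m (phi (projT1 q) a)^T.
have HE q a v w : inner (H q a) v w =
    inner (g (projT1 q) a) v (w *m phi (projT1 q) a).
  by rewrite /inner /H trmx_mul !mulmxA.
have Hs (q : tangent_bundle M) a : dom a (projT1 q) -> (H q a)^T = H q a.
  move=> aq; apply/matrixP => i j.
  have entry (A : 'M[R]_n) k l : A k l = inner A (delta_mx 0 k) (delta_mx 0 l).
    by rewrite /inner -rowE trmx_delta -colE !mxE.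
  rewrite [LHS]entry [RHS]entry -inner_tr !HE inner_tr gs//.
  by rewrite gphi.
clearbody H.
exists (fun q a =>
  block_mx (g (projT1 q) a + K q a *m H q a *m (K q a)^T) (K q a *m H q a)
           (H q a *m (K q a)^T) (H q a)).
have hG q a w : hlift g q a w *m
    block_mx (g (projT1 q) a + K q a *m H q a *m (K q a)^T) (K q a *m H q a)
           (H q a *m (K q a)^T) (H q a) = row_mx (w *m g (projT1 q) a) 0.
  rewrite /hlift gammaE mul_row_block mulmxDr !mulNmx !mulmxA.
  by rewrite addrK subrr.
split => q a aq.
- rewrite tr_block_mx linearD /= !trmx_mul !trmxK Hs// gs//.
  by rewrite mulmxA.
- move=> w z; rewrite /inner hG /hlift tr_row_mx mul_row_col mul0mx.
  by rewrite addr0.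
- move=> w z; rewrite /inner hG tr_row_mx mul_row_col mul0mx.
  by rewrite trmx0 mulmx0 addr0 mxE.
- move=> w z; rewrite -HE /inner mul_row_block !mul0mx !add0r.
  by rewrite tr_row_mx mul_row_col trmx0 mulmx0 add0r.
Qed.

(* Main.v *)
(** Let Psi = (f, u) be a map from any parameter space T to TM, and write a field Z
along Psi as Z = H A + V B, with A = lsubmx Z and B the connector of Z.  As phi is
parallel and commutes with the curvature, Koszul's formula for the phi-Sasaki metric
gives
  nabla_v Z = H (nabla_v A + 1/2 R(phi u, B) f_v + 1/2 R(phi u, nabla_v u) A)
            + V (nabla_v B - 1/2 R(f_v, A) u).
In particular tau(xi) = H S(xi) - V (Delta xi).

The curvature of TM is never computed: with Psi(x, t) = xi(x) + t tau(x) on M x R, the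
symmetry nabla_t Psi_i = nabla_i Psi_t and the commutation rule for nabla_t nabla_i
show that tau_2(xi) = - nabla_t tau(Psi(., t)) at t = 0.  The formula above then
expresses both components of tau_2(xi) through covariant derivatives on M, and they
are the first expression of the statement and the opposite of the second one.

The chart of the source and that of the target of xi need not agree; a change of the
chart of the source is an isometry, under which tau_2 is natural. *)

Require Import Defs.
From mathcomp Require Import all_boot all_order all_algebra.
From mathcomp Require Import all_classical all_reals.
From mathcomp Require Import topology normedtype derive.
From mathcomp Require Import landau ring lra.

Set Implicit Arguments.
Unset Strict Implicit.
Unset Printing Implicit Defensive.

Import Order.TTheory GRing.Theory Num.Theory.
Import numFieldNormedType.Exports.

Local Open Scope classical_set_scope.
Local Open Scope ring_scope.

(** * Smooth functions *)

(** Where the formula for nabla_v Z comes from: the connector is a one-form on TM whose covariant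
    exterior derivative is the curvature of M. Koszul's formula makes the vertical part of the
    connection the symmetrised derivative of this form. The antisymmetric parts left over move to
    the horizontal component by the pair symmetry of R and its commutation with phi, as terms R(phi
    u, B) A. The metric on TM may be indefinite; phi^2 = 1 makes it nondegenerate, so that Koszul's
    formula determines the connection.

    The straight line xi + t tau has no invariant meaning, but nabla_t tau at t = 0 depends only on
    the velocity there. With velocity tau itself, the two terms with factor 1/2 in the horizontal
    component coincide and add up to one R(phi xi, Delta xi) S up to sign, and the vertical one is
    R(S, S) xi = 0.

    All functions are total, with default values outside the chart. Linearity and symmetry of the
    Christoffel maps hold at every point, smoothness and invertibility only on an open set; this is
    why open sets follow every statement, including the set of (x, t) for which the variation stays
    in the chart. *)

Section Smooth.
Variables (R : realType) (T : normedModType R).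
Implicit Types (W : normedModType R) (A : set T).

(** Differentiability is a property of the germ: [h - f] vanishes near x, so its expansion at x
    holds with the zero linear map, and h is f plus this difference. *)
Lemma near_differentiable W (f h : T -> W) (x : T) :
  (\near x, f x = h x) -> differentiable f x -> differentiable h x.
Proof.
move=> fh df; have -> : h = f + (h - f) by rewrite addrC subrK.
apply: (differentiableD df).
pose k := h - f; rewrite -/k.
have k0 : \forall y \near x, k y = 0.
  by near=> y; rewrite /k !fctE (near fh)// subrr.
have kx : k x = 0 by exact: (nbhs_singleton k0).
pose z : {linear T -> W} := \0.
have dk : k \o shift x = cst (k x) + z +o_ 0 id.
  apply/eqaddoP => e e0; near=> y.
  rewrite !fctE kx /= add0r subr0.
  suff -> : k (y + x) = 0 by rewrite normr0 mulr_ge0// ltW.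
  near: y; move: k0; rewrite (near_shift 0 x) /=.
  by apply: filterS => y; rewrite /= subr0.
have cz : continuous z by move=> ?; exact: cvg_cst.
apply/diff_locallyP; rewrite (diff_unique cz dk); split => //.
Unshelve. all: by end_near. Qed.

Lemma open_near A (P : T -> Prop) x : open A -> A x ->
  (forall y, A y -> P y) -> \forall y \near x, P y.
Proof. by move=> oA Ax AP; apply: filterS AP _; exact: open_nbhs_nbhs. Qed.

Lemma derive_ext W A (f h : T -> W) v x : open A ->
  (forall y, A y -> f y = h y) -> A x -> 'D_v f x = 'D_v h x.
Proof. by move=> oA fh Ax; apply: near_eq_derive; exact: open_near fh. Qed.

(** A form of [smooth_on] suited to induction: it peels off the innermost derivative, the one on
    which the product, quotient and chain rules act, and k bounds the number of derivatives still to
    be taken. *)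
Fixpoint Cn W (k : nat) A (f : T -> W) : Prop :=
  (forall x, A x -> differentiable f x) /\
  (if k is k'.+1 then forall v, Cn k' A (fun y => 'D_v f y) else True).

Lemma smooth_onP W A (f : T -> W) :
  smooth_on A f <-> forall k, Cn k A f.
Proof.
split.
  move=> sf k; elim: k f sf => [|k IH] f sf; split=> //.
  - by move=> x /(sf [::]).
  - by move=> x /(sf [::]).
  move=> v; apply: IH => s x Ax; have := sf (rcons s v) x Ax.
  by rewrite foldr_rcons.
move=> Cf s; elim/last_ind: s f Cf => [|s v IH] f Cf x Ax.
  by have [/(_ x Ax)] := Cf 0%N.
rewrite foldr_rcons; apply: IH => // k.
by have [_] := Cf k.+1; exact.
Qed.

Lemma Cn_diff W A k (f : T -> W) x : Cn k A f -> A x -> differentiable f x.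
Proof. by case: k => [|k] [df _]; exact: df. Qed.

Lemma CnW W A k (f : T -> W) : Cn k.+1 A f -> Cn k A f.
Proof.
elim: k f => [|k IH] f [df Df]; split=> // v.
by apply: IH; exact: Df.
Qed.

Lemma Cn_ext W A k (f h : T -> W) : open A ->
  (forall y, A y -> f y = h y) -> Cn k A f -> Cn k A h.
Proof.
move=> oA; elim: k f h => [|k IH] f h fh [df Df]; split => //.
- by move=> x Ax; apply: near_differentiable (df x Ax); exact: open_near fh.
- by move=> x Ax; apply: near_differentiable (df x Ax); exact: open_near fh.
move=> v; apply: IH (Df v) => y Ay; exact: derive_ext Ay.
Qed.

Lemma Cn_cst W A k (c : W) : Cn k A (fun=> c).
Proof.
elim: k c => [|k IH] c; split => // v.
have -> : (fun y => 'D_v (fun=> c) y) = (fun=> 0) :> (T -> W); last exact: IH.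
by apply/funext => y; exact: derive_cst.
Qed.

Lemma Cn_D W A k (f h : T -> W) : open A ->
  Cn k A f -> Cn k A h -> Cn k A (fun y => f y + h y).
Proof.
move=> oA; elim: k f h => [|k IH] f h [df Df] [dh Dh]; split => //.
- by move=> x Ax; apply: differentiableD; [exact: df|exact: dh].
- by move=> x Ax; apply: differentiableD; [exact: df|exact: dh].
move=> v; apply: Cn_ext (IH _ _ (Df v) (Dh v)) => // y Ay.
by symmetry; apply: deriveD; apply: diff_derivable; [exact: df|exact: dh].
Qed.


(** Reduces matrix-valued functions to scalar ones, on which products and inverses are
    differentiated. The converse direction writes f as a sum of its entries times the elementary
    matrices. *)
Lemma Cn_mx m n A k (f : T -> 'M[R]_(m, n)) : open A ->
  Cn k A f <-> forall i j, Cn k A (fun y => f y i j).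
Proof.
move=> oA; elim: k f => [|k IH] f; split.
- move=> [df _] i j; split => // x Ax.
  exact: (differentiable_comp (df x Ax) (differentiable_coord _ i j)).
- move=> Cf; split => // x Ax.
  have -> : f = \sum_i \sum_j (fun y => f y i j *: delta_mx i j).
    apply/funext => y; rewrite [LHS]matrix_sum_delta fct_sumE.
    by apply: eq_bigr => i _; rewrite fct_sumE.
  apply: differentiable_sum => i; apply: differentiable_sum => j.
  by apply: differentiableZl; exact: Cn_diff (Cf i j) Ax.
- move=> [df Df] i j; split => [x Ax|v].
    exact: (differentiable_comp (df x Ax) (differentiable_coord _ i j)).
  have /IH/(_ i j) := Df v; apply: Cn_ext => // y Ay.
  by rewrite derive_mx ?mxE//; apply: diff_derivable; exact: df.
- move=> Cf.
  have df x : A x -> differentiable f x.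
    move=> Ax; have -> : f = \sum_i \sum_j (fun y => f y i j *: delta_mx i j).
      apply/funext => y; rewrite [LHS]matrix_sum_delta fct_sumE.
      by apply: eq_bigr => i _; rewrite fct_sumE.
    apply: differentiable_sum => i; apply: differentiable_sum => j.
    by apply: differentiableZl; exact: Cn_diff (Cf i j) Ax.
  split => // v; apply/IH => i j; have [_ /(_ v)] := Cf i j.
  apply: Cn_ext => // y Ay.
  by rewrite derive_mx ?mxE//; apply: diff_derivable; exact: df.
Qed.

Lemma Cn_M A k (f h : T -> R) : open A ->
  Cn k A f -> Cn k A h -> Cn k A (fun y => f y * h y).
Proof.
move=> oA; elim: k f h => [|k IH] f h Cf Ch; split => //.
- by move=> x Ax; apply: differentiableM; [exact: Cn_diff Cf Ax|exact: Cn_diff Ch Ax].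
- by move=> x Ax; apply: differentiableM; [exact: Cn_diff Cf Ax|exact: Cn_diff Ch Ax].
move=> v; have [_ /(_ v) Df] := Cf; have [_ /(_ v) Dh] := Ch.
apply: (@Cn_ext _ _ _ (fun y => f y * 'D_v h y + h y * 'D_v f y)) => //.
  move=> y Ay; symmetry; apply: deriveM; apply: diff_derivable.
    exact: Cn_diff Cf Ay.
  exact: Cn_diff Ch Ay.
by apply: Cn_D => //; apply: IH => //; exact: CnW.
Qed.

Lemma Cn_V A k (f : T -> R) : open A -> (forall x, A x -> f x != 0) ->
  Cn k A f -> Cn k A (fun y => (f y)^-1).
Proof.
move=> oA f0; elim: k => [|k IH] Cf; split => //.
- by move=> x Ax; apply: differentiableV; [exact: Cn_diff Cf Ax|exact: f0].
- by move=> x Ax; apply: differentiableV; [exact: Cn_diff Cf Ax|exact: f0].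
move=> v; have [_ /(_ v) Df] := Cf.
(* The derivative of 1/f written as a product whose factors are all known to be of class [Cn k], so
   that [Cn_M] and the induction hypothesis close the step. *)
apply: (@Cn_ext _ _ _ (fun y => -1 * ((f y)^-1 * ((f y)^-1 * 'D_v f y)))) => //.
  move=> y Ay; symmetry; rewrite deriveV ?f0//; last first.
    by apply: diff_derivable; exact: Cn_diff Cf Ay.
  rewrite mulN1r scaleNr -exprVn expr2 mulrA; by [].
have CV : Cn k A (fun y => (f y)^-1) by apply: IH; exact: CnW.
apply: Cn_M => //; first exact: Cn_cst.
by apply: Cn_M => //; apply: Cn_M.
Qed.

End Smooth.

Section SmoothOn.
Variables (R : realType) (T : normedModType R).
Implicit Types (W : normedModType R) (A : set T).

Lemma smooth_on_diff W A (f : T -> W) x :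
  smooth_on A f -> A x -> differentiable f x.
Proof. by move=> sf Ax; have := sf [::] x Ax. Qed.

Lemma smooth_on_derivable W A (f : T -> W) v x :
  smooth_on A f -> A x -> derivable f x v.
Proof. by move=> sf Ax; apply: diff_derivable; exact: smooth_on_diff sf Ax. Qed.

Lemma smooth_on_derive W A (f : T -> W) v :
  smooth_on A f -> smooth_on A (fun y => 'D_v f y).
Proof.
by move=> /smooth_onP Cf; apply/smooth_onP => k; have [_] := Cf k.+1; exact.
Qed.

Lemma smooth_on_sub W A (B : set T) (f : T -> W) :
  B `<=` A -> smooth_on A f -> smooth_on B f.
Proof. by move=> BA sf s x /BA Ax; exact: sf. Qed.

Lemma smooth_on_ext W A (f h : T -> W) : open A ->
  (forall y, A y -> f y = h y) -> smooth_on A f -> smooth_on A h.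
Proof.
move=> oA fh /smooth_onP Cf; apply/smooth_onP => k; exact: Cn_ext (Cf k).
Qed.

Lemma smooth_on_cst W A (c : W) : smooth_on A (fun=> c).
Proof. by apply/smooth_onP => k; exact: Cn_cst. Qed.

Lemma smooth_on_mx m n A (f : T -> 'M[R]_(m, n)) : open A ->
  (forall i j, smooth_on A (fun y => f y i j)) -> smooth_on A f.
Proof.
move=> oA sf; apply/smooth_onP => k; apply/Cn_mx => // i j.
by move: (sf i j) => /smooth_onP.
Qed.

Lemma smooth_on_entry m n A (f : T -> 'M[R]_(m, n)) i j : open A ->
  smooth_on A f -> smooth_on A (fun y => f y i j).
Proof.
move=> oA /smooth_onP sf; apply/smooth_onP => k.
by move: (sf k) => /Cn_mx; exact.
Qed.

Lemma smooth_onD W A (f h : T -> W) : open A ->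
  smooth_on A f -> smooth_on A h -> smooth_on A (fun y => f y + h y).
Proof.
move=> oA /smooth_onP Cf /smooth_onP Ch; apply/smooth_onP => k.
exact: Cn_D.
Qed.

Lemma smooth_onM A (f h : T -> R) : open A ->
  smooth_on A f -> smooth_on A h -> smooth_on A (fun y => f y * h y).
Proof.
move=> oA /smooth_onP Cf /smooth_onP Ch; apply/smooth_onP => k.
exact: Cn_M.
Qed.

Lemma smooth_onV A (f : T -> R) : open A -> (forall x, A x -> f x != 0) ->
  smooth_on A f -> smooth_on A (fun y => (f y)^-1).
Proof.
by move=> oA f0 /smooth_onP Cf; apply/smooth_onP => k; exact: Cn_V.
Qed.

Lemma smooth_on_sum (I : Type) (r : seq I) (P : pred I) W A (f : I -> T -> W) :
  open A -> (forall i, P i -> smooth_on A (f i)) ->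
  smooth_on A (fun y => \sum_(i <- r | P i) f i y).
Proof.
move=> oA sf; elim: r => [|i r IH].
  apply: (smooth_on_ext oA (f := (fun=> 0) : T -> W)); last exact: smooth_on_cst.
  by move=> y _; rewrite big_nil.
case Pi : (P i).
  apply: (smooth_on_ext oA (f := fun y => f i y + \sum_(j <- r | P j) f j y)).
    by move=> y _; rewrite big_cons Pi.
  by apply: smooth_onD => //; exact: sf.
by apply: smooth_on_ext IH => // y _; rewrite big_cons Pi.
Qed.

Lemma smooth_on_prod (I : Type) (r : seq I) (P : pred I) A (f : I -> T -> R) :
  open A -> (forall i, P i -> smooth_on A (f i)) ->
  smooth_on A (fun y => \prod_(i <- r | P i) f i y).
Proof.
move=> oA sf; elim: r => [|i r IH].
  apply: (smooth_on_ext oA (f := (fun=> 1) : T -> R)); last exact: smooth_on_cst.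
  by move=> y _; rewrite big_nil.
case Pi : (P i).
  apply: (smooth_on_ext oA (f := fun y => f i y * \prod_(j <- r | P j) f j y)).
    by move=> y _; rewrite big_cons Pi.
  by apply: smooth_onM => //; exact: sf.
by apply: smooth_on_ext IH => // y _; rewrite big_cons Pi.
Qed.

Lemma smooth_on_mulmx m n p A (f : T -> 'M[R]_(m, n)) (h : T -> 'M[R]_(n, p)) :
  open A -> smooth_on A f -> smooth_on A h ->
  smooth_on A (fun y => f y *m h y).
Proof.
move=> oA sf sh; apply: smooth_on_mx => // i j.
apply: (smooth_on_ext oA (f := fun y => \sum_k f y i k * h y k j)).
  by move=> y _; rewrite mxE.
by apply: smooth_on_sum => // k _; apply: smooth_onM => //; exact: smooth_on_entry.
Qed.

Lemma smooth_onZ m n A (a : T -> R) (f : T -> 'M[R]_(m, n)) :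
  open A -> smooth_on A a -> smooth_on A f ->
  smooth_on A (fun y => a y *: f y).
Proof.
move=> oA sa sf; apply: smooth_on_mx => // i j.
apply: (smooth_on_ext oA (f := fun y => a y * f y i j)).
  by move=> y _; rewrite mxE.
by apply: smooth_onM => //; exact: smooth_on_entry.
Qed.

Lemma smooth_onN m n A (f : T -> 'M[R]_(m, n)) :
  open A -> smooth_on A f -> smooth_on A (fun y => - f y).
Proof.
move=> oA sf; apply: (smooth_on_ext oA (f := fun y => -1 *: f y)).
  by move=> y _; rewrite scaleN1r.
by apply: smooth_onZ => //; exact: smooth_on_cst.
Qed.

Lemma smooth_on_trmx m n A (f : T -> 'M[R]_(m, n)) :
  open A -> smooth_on A f -> smooth_on A (fun y => (f y)^T).
Proof.
move=> oA sf; apply: smooth_on_mx => // i j.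
apply: (smooth_on_ext oA (f := fun y => f y j i)); last exact: smooth_on_entry.
by move=> y _; rewrite mxE.
Qed.

Lemma smooth_on_row_mx m n p A (f : T -> 'M[R]_(m, n)) (h : T -> 'M[R]_(m, p)) :
  open A -> smooth_on A f -> smooth_on A h ->
  smooth_on A (fun y => row_mx (f y) (h y)).
Proof.
move=> oA sf sh; apply: smooth_on_mx => // i j.
case: (split_ordP j) => k ->.
  apply: (smooth_on_ext oA (f := fun y => f y i k)); last exact: smooth_on_entry.
  by move=> y _; rewrite row_mxEl.
apply: (smooth_on_ext oA (f := fun y => h y i k)); last exact: smooth_on_entry.
by move=> y _; rewrite row_mxEr.
Qed.

Lemma smooth_on_lsubmx m n p A (f : T -> 'M[R]_(m, n + p)) :
  open A -> smooth_on A f -> smooth_on A (fun y => lsubmx (f y)).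
Proof.
move=> oA sf; apply: smooth_on_mx => // i j.
apply: (smooth_on_ext oA (f := fun y => f y i (lshift p j))).
  by move=> y _; rewrite mxE.
exact: smooth_on_entry.
Qed.

Lemma smooth_on_rsubmx m n p A (f : T -> 'M[R]_(m, n + p)) :
  open A -> smooth_on A f -> smooth_on A (fun y => rsubmx (f y)).
Proof.
move=> oA sf; apply: smooth_on_mx => // i j.
apply: (smooth_on_ext oA (f := fun y => f y i (rshift n j))).
  by move=> y _; rewrite mxE.
exact: smooth_on_entry.
Qed.

Lemma smooth_on_det n A (f : T -> 'M[R]_n) :
  open A -> smooth_on A f -> smooth_on A (fun y => \det (f y)).
Proof.
move=> oA sf; apply: smooth_on_sum => // s _.
apply: smooth_onM => //; first exact: smooth_on_cst.
by apply: smooth_on_prod => // i _; exact: smooth_on_entry.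
Qed.

(** Cramer's rule: the adjugate and the determinant are polynomial in the entries, and the
    determinant does not vanish on A. *)
Lemma smooth_on_invmx n A (f : T -> 'M[R]_n) :
  open A -> (forall x, A x -> f x \in unitmx) ->
  smooth_on A f -> smooth_on A (fun y => invmx (f y)).
Proof.
move=> oA fu sf.
apply: (smooth_on_ext oA (f := fun y => (\det (f y))^-1 *: \adj (f y))).
  by move=> y Ay; rewrite /invmx fu.
apply: smooth_onZ => //.
  apply: smooth_onV => //; last exact: smooth_on_det.
  by move=> x Ax; rewrite -unitfE -unitmxE fu.
apply: smooth_on_mx => // i j.
apply: (smooth_on_ext oA
  (f := fun y => (-1) ^+ (j + i) * \det (row' j (col' i (f y))))).
  by move=> y _; rewrite mxE.
apply: smooth_onM => //; first exact: smooth_on_cst.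
apply: smooth_on_det => //; apply: smooth_on_mx => // k l.
apply: (smooth_on_ext oA (f := fun y => f y (lift j k) (lift i l))).
  by move=> y _; rewrite !mxE.
exact: smooth_on_entry.
Qed.

End SmoothOn.

(** * Unbundled linear maps and rules of differentiation *)

Section LinearFun.
Variables (R : realType) (V W : lmodType R) (f : V -> W).
Hypothesis lf : linear f.

Lemma lin0 : f 0 = 0.
Proof. by have := lf (-1) 0 0; rewrite scaler0 addr0 scaleN1r addNr. Qed.

Lemma linD u v : f (u + v) = f u + f v.
Proof. by have := lf 1 u v; rewrite !scale1r. Qed.

Lemma linZ c u : f (c *: u) = c *: f u.
Proof. by have := lf c u 0; rewrite !addr0 lin0 addr0. Qed.

Lemma linN u : f (- u) = - f u.
Proof. by rewrite -scaleN1r linZ scaleN1r. Qed.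

Lemma linB u v : f (u - v) = f u - f v.
Proof. by rewrite linD linN. Qed.

Lemma lin_sum (I : Type) (r : seq I) (P : pred I) (u : I -> V) :
  f (\sum_(i <- r | P i) u i) = \sum_(i <- r | P i) f (u i).
Proof.
elim/big_rec2 : _ => [|i x y _ <-]; first exact: lin0.
exact: linD.
Qed.
End LinearFun.

Lemma row_basis (R : realType) n (u : 'rV[R]_n) :
  u = \sum_i u 0 i *: basis_vec R i.
Proof. exact: row_sum_delta. Qed.

Lemma lin_basis (R : realType) n (W : lmodType R) (f : 'rV[R]_n -> W) u :
  linear f -> f u = \sum_i u 0 i *: f (basis_vec R i).
Proof.
move=> lf; rewrite {1}(row_basis u) lin_sum//.
by apply: eq_bigr => i _; rewrite linZ.
Qed.

Section Rules.
Variable R : realType.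
Implicit Types T W : normedModType R.

Lemma derive_lin T W (f : T -> W) x : differentiable f x ->
  linear (fun v => 'D_v f x).
Proof. by move=> df c u v; rewrite /= !deriveE// linearP. Qed.

Section FixedSource.
Variable T : normedModType R.
Implicit Type A : set T.

Lemma derive_entry m n (f : T -> 'M[R]_(m, n)) v x i j : derivable f x v ->
  'D_v (fun y => f y i j) x = 'D_v f x i j.
Proof. by move=> df; rewrite derive_mx// mxE. Qed.

Lemma derive_scale m n (c : T -> R) (f : T -> 'M[R]_(m, n)) v x :
  derivable c x v -> derivable f x v ->
  'D_v (fun y => c y *: f y) x = 'D_v c x *: f x + c x *: 'D_v f x.
Proof.
move=> dc df.
have dfe i j : derivable (fun y => f y i j) x v.
  move/derivable_mxP : df => dmx; apply: dmx.
have dcfe i j : derivable (fun y => (c y *: f y) i j) x v.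
  have -> : (fun y => (c y *: f y) i j) = c * (fun y => f y i j).
    by apply/funext => y; rewrite mxE.
  exact: (derivableM dc (dfe i j)).
rewrite derive_mx; last by apply/derivable_mxP.
apply/matrixP => i j; rewrite mxE.
have -> : (fun y => (c y *: f y) i j) = c * (fun y => f y i j).
  by apply/funext => y; rewrite mxE.
rewrite (deriveM dc (dfe i j)) (derive_entry _ _ df) 3!mxE addrC; congr (_ + _).
exact: mulrC.
Qed.

Lemma derive_sumf W (I : Type) (r : seq I) (P : pred I) (f : I -> T -> W) v x :
  (forall i, P i -> derivable (f i) x v) ->
  'D_v (fun y => \sum_(i <- r | P i) f i y) x =
  \sum_(i <- r | P i) 'D_v (f i) x.
Proof.
move=> df.
suff : derivable (fun y => \sum_(i <- r | P i) f i y) x v /\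
  'D_v (fun y => \sum_(i <- r | P i) f i y) x =
  \sum_(i <- r | P i) 'D_v (f i) x by case.
elim: r => [|i r [dr IH]].
  have -> : (fun y => \sum_(i <- [::] | P i) f i y) = cst 0.
    by apply/funext => y; rewrite big_nil.
  by rewrite derive_cst big_nil; split; [exact: derivable_cst|].
rewrite big_cons; case Pi : (P i).
  have -> : (fun y => \sum_(j <- i :: r | P j) f j y) =
      f i + (fun y => \sum_(j <- r | P j) f j y).
    by apply/funext => y; rewrite big_cons Pi.
  have di := df i Pi.
  by split; [exact: (derivableD di dr)|rewrite (deriveD di dr) IH].
have -> : (fun y => \sum_(j <- i :: r | P j) f j y) =
    (fun y => \sum_(j <- r | P j) f j y).
  by apply/funext => y; rewrite big_cons Pi.
by [].
Qed.

Lemma derive_chain n W (f : 'rV[R]_n -> W) (u : T -> 'rV[R]_n) v p :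
  differentiable u p -> differentiable f (u p) ->
  'D_v (fun x => f (u x)) p = 'D_('D_v u p) f (u p).
Proof.
move=> du df; rewrite !deriveE//; last exact: differentiable_comp.
by rewrite (diff_comp du df).
Qed.

(** A Leibniz rule for a family of linear maps applied to a moving vector: expanding [a x] in the
    fixed basis reduces it to the product rule for scalar coefficients. Only the values of F at
    fixed vectors have to be derivable. *)
Lemma derive_app n m k A (F : T -> 'rV[R]_n -> 'M[R]_(m, k)) (a : T -> 'rV[R]_n)
    v p : open A -> A p -> (forall x, A x -> linear (F x)) ->
  (forall c, derivable (F ^~ c) p v) -> derivable a p v ->
  'D_v (fun x => F x (a x)) p = 'D_v (fun x => F x (a p)) p + F p ('D_v a p).
Proof.
move=> oA Ap lF dF da.
have dai i : derivable (fun x => a x 0 i) p v.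
  move/derivable_mxP : da => dmx; apply: dmx.
have D1 : 'D_v (fun x => F x (a x)) p =
    'D_v (fun x => \sum_i a x 0 i *: F x (basis_vec R i)) p.
  by apply: (derive_ext _ oA) => // x Ax; rewrite -lin_basis//; exact: lF.
have D2 : 'D_v (fun x => F x (a p)) p =
    'D_v (fun x => \sum_i a p 0 i *: F x (basis_vec R i)) p.
  by apply: (derive_ext _ oA) => // x Ax; rewrite -lin_basis//; exact: lF.
have dsc (c : T -> R) i : derivable c p v ->
    derivable (fun x => c x *: F x (basis_vec R i)) p v.
  move=> dc; apply/derivable_mxP => k1 k2.
  have -> : (fun y => (c y *: F y (basis_vec R i)) k1 k2) =
      c * (fun y => F y (basis_vec R i) k1 k2).
    by apply/funext => y; rewrite mxE.
  apply: (derivableM dc).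
  move/derivable_mxP : (dF (basis_vec R i)) => dmx; apply: dmx.
rewrite D1 D2 !derive_sumf; first last.
- by move=> i _; exact: dsc.
- by move=> i _; apply: dsc; exact: derivable_cst.
rewrite (@lin_basis _ _ _ (F p) ('D_v a p)); last exact: lF.
rewrite -big_split /=; apply: eq_bigr => i _.
rewrite (derive_scale (dai i) (dF _)) (derive_scale (derivable_cst _ _ _) (dF _)).
by rewrite derive_entry// (derive_cst (a p 0 i)) scale0r add0r addrC.
Qed.

(** Induction on the order with f general: the chain rule expresses a derivative of [f (u x)] by
    products of entries of a derivative of u with the partial derivatives of f composed with u, to
    which the induction hypothesis applies. *)
Lemma smooth_on_comp1 n A (B : set 'rV[R]_n) (f : 'rV[R]_n -> R)
    (u : T -> 'rV[R]_n) :
  open A -> (forall x, A x -> B (u x)) -> smooth_on B f -> smooth_on A u ->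
  smooth_on A (fun x => f (u x)).
Proof.
move=> oA AB sf su; apply/smooth_onP => k.
elim: k f sf => [|k IH] f sf; split => //.
- move=> x Ax; apply: (differentiable_comp (smooth_on_diff su Ax)).
  by apply: (smooth_on_diff sf); exact: AB.
- move=> x Ax; apply: (differentiable_comp (smooth_on_diff su Ax)).
  by apply: (smooth_on_diff sf); exact: AB.
move=> v.
apply: (@Cn_ext _ _ _ _ _ (fun x => \sum_i 'D_v u x 0 i *
    'D_(basis_vec R i) f (u x))) => //.
  move=> x Ax; rewrite derive_chain; first last.
  - by apply: (smooth_on_diff sf); exact: AB.
  - exact: (smooth_on_diff su Ax).
  rewrite (@lin_basis _ _ _ (fun w => 'D_w f (u x)) ('D_v u x))//.
  have dfx : differentiable f (u x) by apply: (smooth_on_diff sf); exact: AB.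
  exact: (@derive_lin 'rV[R]_n R f (u x) dfx).
(* The induction hypothesis concerns the fixed order k, so the sum is treated for [Cn k] and not
   through [smooth_on_sum]. *)
elim: (index_enum _) => [|i r IHr].
  apply: (@Cn_ext _ _ _ _ _ ((fun=> 0) : T -> R)) => //; last exact: Cn_cst.
  by move=> x _; rewrite big_nil.
apply: (@Cn_ext _ _ _ _ _ (fun x => 'D_v u x 0 i *
    'D_(basis_vec R i) f (u x) + \sum_(j <- r) 'D_v u x 0 j *
    'D_(basis_vec R j) f (u x))) => //.
  by move=> x _; rewrite big_cons.
apply: Cn_D => //; apply: Cn_M => //; last first.
  exact: (IH (fun y => 'D_(basis_vec R i) f y) (smooth_on_derive _ sf)).
move: k {IH IHr}; apply/smooth_onP.
exact: (smooth_on_entry _ _ oA (smooth_on_derive v su)).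
Qed.

Lemma smooth_on_comp n m k A (B : set 'rV[R]_n) (f : 'rV[R]_n -> 'M[R]_(m, k))
    (u : T -> 'rV[R]_n) : open B ->
  open A -> (forall x, A x -> B (u x)) -> smooth_on B f -> smooth_on A u ->
  smooth_on A (fun x => f (u x)).
Proof.
move=> oB oA AB sf su; apply: smooth_on_mx => // i j.
by apply: (@smooth_on_comp1 _ _ B (fun y => f y i j)) => //; exact: smooth_on_entry.
Qed.

Lemma smooth_on_app n m k A (F : T -> 'rV[R]_n -> 'M[R]_(m, k))
    (a : T -> 'rV[R]_n) : open A -> (forall x, A x -> linear (F x)) ->
  (forall c, smooth_on A (F ^~ c)) -> smooth_on A a ->
  smooth_on A (fun x => F x (a x)).
Proof.
move=> oA lF sF sa.
apply: (smooth_on_ext oA (f := fun x => \sum_i a x 0 i *: F x (basis_vec R i))).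
  by move=> x Ax; rewrite -lin_basis//; exact: lF.
apply: smooth_on_sum => // i _; apply: smooth_onZ => //.
exact: smooth_on_entry.
Qed.

(* Neither f nor L is assumed differentiable: both difference quotients agree. *)
Lemma derive_along (S : normedModType R) W (f : T -> W) (L : S -> T) v w s :
  (forall h : R, L (h *: v + s) = h *: w + L s) ->
  'D_v (fun y => f (L y)) s = 'D_w f (L s).
Proof.
move=> Lv; rewrite /derive.
have -> // : (fun h : R => h^-1 *: (((fun y => f (L y)) \o shift s) (h *: v)
     - f (L s))) =
  (fun h => h^-1 *: ((f \o shift (L s)) (h *: w) - f (L s))).
by apply/funext => h /=; rewrite Lv.
Qed.

End FixedSource.
End Rules.

(** * Symmetry of second derivatives *)

Section Schwarz.
Variables (R : realType) (T : normedModType R).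
Implicit Types (W : normedModType R) (A : set T).

Lemma derivable_along (S W : normedModType R) (f : T -> W) (L : S -> T) v w s :
  (forall h : R, L (h *: v + s) = h *: w + L s) ->
  derivable f (L s) w -> derivable (fun y => f (L y)) s v.
Proof.
move=> Lv; rewrite /derivable.
have -> // : (fun h : R => h^-1 *: (((fun y => f (L y)) \o shift s) (h *: v)
     - f (L s))) =
  (fun h => h^-1 *: ((f \o shift (L s)) (h *: w) - f (L s))).
by apply/funext => h /=; rewrite Lv.
Qed.

Lemma MVT_along A (f : T -> R) (y w : T) (h : R) : 0 < h ->
  smooth_on A f -> (forall t, 0 <= t <= h -> A (y + t *: w)) ->
  exists2 t, 0 <= t <= h &
    f (y + h *: w) - f y = h * 'D_w f (y + t *: w).
Proof.
move=> h0 sf Ay.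
pose L (t : R) := y + t *: w.
have Lw (t k : R) : L (k *: 1 + t) = k *: w + L t.
  by rewrite /L scalerDl addrCA; congr (_ *: _ + _); exact: mulr1.
have dL t : 0 <= t <= h -> derivable (fun t => f (L t)) t 1.
  move=> th; apply: (derivable_along (Lw t)).
  have := smooth_on_derivable sf (Ay t th).
  by [].
have [t tI E] : exists2 c, c \in `]0, h[%R &
    f (L h) - f (L 0) = 'D_w f (L c) * (h - 0).
  apply: (@MVT R (fun t => f (L t)) (fun t => 'D_w f (L t)) 0 h h0).
    move=> t; rewrite in_itv /= => /andP[t0 th].
    split; first by apply: dL; rewrite !ltW.
    exact: derive_along (Lw t).
  apply: derivable_within_continuous => t; rewrite in_itv /= => th.
  exact: dL.
exists t; first by move: tI; rewrite in_itv /= => /andP[t0 th]; rewrite !ltW.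
by move: E; rewrite /L scale0r addr0 subr0 mulrC.
Qed.

(** The mean value theorem is used twice: along v for the increment [k y = f (y + h *: w) - f y],
    then along w for the derivative of f in the direction v. *)
Lemma mixed_increment A (f : T -> R) (x v w : T) (h : R) : open A -> 0 < h ->
  smooth_on A f ->
  (forall s t, 0 <= s <= h -> 0 <= t <= h -> A (x + s *: v + t *: w)) ->
  exists s t, [/\ 0 <= s <= h, 0 <= t <= h &
    f (x + h *: v + h *: w) - f (x + h *: v) - (f (x + h *: w) - f x) =
    h * (h * 'D_w (fun y => 'D_v f y) (x + s *: v + t *: w))].
Proof.
move=> oA h0 sf Ax.
pose k y := f (y + h *: w) - f y.
have hh : 0 <= h <= h by rewrite ltW//= lexx.
have h00 : 0 <= (0 : R) <= h by rewrite lexx ltW.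
have Lv (y z : T) (u : R) : (u *: z + y) + h *: w = u *: z + (y + h *: w).
  by rewrite addrA.
have dk z y : A (y + h *: w) -> A y -> is_derive y z k
    ('D_z f (y + h *: w) - 'D_z f y).
  move=> A1 A2.
  have d1 : derivable (fun y => f (y + h *: w)) y z.
    apply: (derivable_along (Lv y z)); exact: (smooth_on_derivable sf A1).
  have d2 : derivable f y z by exact: (smooth_on_derivable sf A2).
  split; first exact: (derivableB d1 d2).
  have E : 'D_z (fun y => f (y + h *: w)) y = 'D_z f (y + h *: w).
    exact: (derive_along f (Lv y z)).
  rewrite -E; exact: (deriveB d1 d2).
pose L (t : R) := x + t *: v.
have Lvv (t u : R) : L (u *: 1 + t) = u *: v + L t.
  by rewrite /L scalerDl addrCA; congr (_ *: _ + _); exact: mulr1.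
have AL t : 0 <= t <= h -> A (L t + h *: w) /\ A (L t).
  move=> th; split; first exact: Ax.
  by have := Ax t 0 th h00; rewrite scale0r addr0.
have [s sI E] : exists2 c, c \in `]0, h[%R &
    k (L h) - k (L 0) = ('D_v f (L c + h *: w) - 'D_v f (L c)) * (h - 0).
  have dkL t : 0 <= t <= h ->
      is_derive t 1 (fun t => k (L t)) ('D_v f (L t + h *: w) - 'D_v f (L t)).
    move=> th; have [A1 A2] := AL t th; have [e1 e2] := dk v _ A1 A2.
    split; first exact: (derivable_along (Lvv t)).
    by rewrite (derive_along _ (Lvv t)).
  apply: (@MVT R (fun t => k (L t))
    (fun t => 'D_v f (L t + h *: w) - 'D_v f (L t)) 0 h h0).
    move=> t; rewrite in_itv /= => /andP[t0 th].
    by apply: dkL; rewrite !ltW.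
  apply: derivable_within_continuous => t; rewrite in_itv /= => th.
  by have [] := dkL t th.
have sh : 0 <= s <= h.
  by move: sI; rewrite in_itv /= => /andP[s0 sh]; rewrite !ltW.
have [t th E2] := @MVT_along A (fun y => 'D_v f y) (L s) w h h0
  (smooth_on_derive v sf) (fun t th => Ax s t sh th).
exists s, t; split => //.
move: E; rewrite /k /L scale0r addr0 subr0 => ->.
by move: E2; rewrite /L => ->; rewrite mulrC.
Qed.

(** Schwarz's argument: the second difference over a small parallelogram is symmetric in v and w, so
    the two mixed derivatives share a value at two points near x. By continuity this contradicts a
    gap between their values at x. *)
Lemma derive_comm1 A (f : T -> R) v w x : open A -> A x -> smooth_on A f ->
  'D_v (fun y => 'D_w f y) x = 'D_w (fun y => 'D_v f y) x.
Proof.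
move=> oA Ax sf.
have tri (a b z d : R) : `|a - z| < d -> `|b - z| < d -> `|a - b| < d + d.
  move=> az bz; have -> : a - b = (a - z) - (b - z) by ring.
  by rewrite (le_lt_trans (ler_normB _ _))// ltrD.
set a := LHS; set b := RHS; apply/eqP/negP => /negP ab.
pose d := `|a - b| / 2.
have d0 : 0 < d by rewrite divr_gt0// normr_gt0 subr_eq0.
have swv := smooth_on_derive w (smooth_on_derive v sf).
have svw := smooth_on_derive v (smooth_on_derive w sf).
have c1 := differentiable_continuous (smooth_on_diff svw Ax).
have c2 := differentiable_continuous (smooth_on_diff swv Ax).
have : \forall y \near x, A y /\
   (`|a - 'D_v (fun y => 'D_w f y) y| < d /\ `|b - 'D_w (fun y => 'D_v f y) y| < d).
  have n1 : \forall y \near x, A y by apply: open_nbhs_nbhs.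
  have n2 := (cvgrPdist_lt _ _).1 c1 d d0.
  have n3 := (cvgrPdist_lt _ _).1 c2 d d0.
  exact: (filterI n1 (filterI (n2 _) (n3 _))).
move=> /nbhs_normP[e /= e0 He].
have q0 : 0 < `|v| + `|w| + 1 by rewrite ltr_wpDl// addr_ge0.
(* This size keeps [s *: v + t *: w] within norm e / 2 for all s, t in [0, h]; the summand 1 keeps
   the denominator positive when v = w = 0. *)
pose h := e / 2 / (`|v| + `|w| + 1).
have h0 : 0 < h by rewrite !divr_gt0.
have small s t : 0 <= s <= h -> 0 <= t <= h -> `|s *: v + t *: w| < e.
  move=> /andP[s0 sh] /andP[t0 th].
  rewrite (le_lt_trans (ler_normD _ _))// !normrZ !ger0_norm//.
  have : h * (`|v| + `|w| + 1) = e / 2 by rewrite /h divfK// gt_eqF.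
  have : s * `|v| <= h * `|v| by rewrite ler_wpM2r.
  have : t * `|w| <= h * `|w| by rewrite ler_wpM2r.
  move=> *; lra.
have inB s t : 0 <= s <= h -> 0 <= t <= h ->
    A (x + s *: v + t *: w) /\
    (`|a - 'D_v (fun y => 'D_w f y) (x + s *: v + t *: w)| < d /\
     `|b - 'D_w (fun y => 'D_v f y) (x + s *: v + t *: w)| < d).
  move=> sh th; apply: He => /=.
  by rewrite -addrA opprD addNKr normrN small.
have [s [t [sh th E1]]] := mixed_increment oA h0 sf
  (fun s t sh th => (inB s t sh th).1).
have [t' [s' [th' sh' E2]]] := mixed_increment (v := w) (w := v) oA h0 sf
  (fun t s (th : 0 <= t <= h) (sh : 0 <= s <= h) =>
     eq_ind _ A (inB s t sh th).1 _ (addrAC _ _ _)).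
have E3 : f (x + h *: w + h *: v) - f (x + h *: w) - (f (x + h *: v) - f x) =
    f (x + h *: v + h *: w) - f (x + h *: v) - (f (x + h *: w) - f x).
  by rewrite [x + h *: w + _]addrAC; ring.
move: E2; rewrite E3 E1 => /(mulfI (lt0r_neq0 h0)) /(mulfI (lt0r_neq0 h0)) E.
have [_ [_ B1]] := inB _ _ sh th.
have [_ [B2 _]] := inB _ _ sh' th'.
move: B1 B2; rewrite E [x + s' *: v + _]addrAC => B1 B2.
have : `|a - b| < d + d.
  set z := derive _ _ _ in B1 B2.
  exact: (tri _ _ _ _ B2 B1).
by rewrite /d -splitr ltxx.
Qed.

Lemma derive_comm A m n (f : T -> 'M[R]_(m, n)) v w x : open A -> A x ->
  smooth_on A f ->
  'D_v (fun y => 'D_w f y) x = 'D_w (fun y => 'D_v f y) x.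
Proof.
move=> oA Ax sf.
have e u u' i j : ('D_u (fun y => 'D_u' f y) x) i j =
    'D_u (fun y => 'D_u' (fun y => f y i j) y) x.
  rewrite -derive_entry; last exact: (smooth_on_derivable (smooth_on_derive _ sf) Ax).
  apply: (derive_ext _ oA) => // y Ay.
  by rewrite derive_entry//; exact: (smooth_on_derivable sf Ay).
apply/matrixP => i j.
apply: etrans (e v w i j) _; apply: etrans _ (esym (e w v i j)).
exact: (derive_comm1 v w oA Ax (smooth_on_entry i j oA sf)).
Qed.

End Schwarz.

Lemma derive_addf (R : realType) (T W : normedModType R) (f h : T -> W) v x :
  derivable f x v -> derivable h x v ->
  'D_v (fun y => f y + h y) x = 'D_v f x + 'D_v h x.
Proof. by move=> df dh; exact: (deriveD df dh). Qed.

Lemma derive_oppf (R : realType) (T W : normedModType R) (f : T -> W) v x :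
  derivable f x v -> 'D_v (fun y => - f y) x = - 'D_v f x.
Proof. by move=> df; exact: (deriveN df). Qed.

Opaque derive derivable fun_of_matrix.

(* Rewriting with mxE leaves entries whose ring instances differ syntactically;
   refolding them into mxcoef makes equal entries syntactically equal. *)
Definition mxcoef (R : realType) m n (X : 'M[R]_(m, n)) i j : R := X i j.

Ltac mxring :=
  apply/matrixP => ? ?; rewrite !mxE;
  repeat match goal with |- context [@fun_of_matrix ?S ?m ?n ?X ?i ?j] =>
    change (@fun_of_matrix S m n X i j) with (mxcoef X i j)
  end;
  repeat match goal with |- context [@mxcoef ?S ?m ?n ?X ?i ?j] =>
    generalize (@mxcoef S m n X i j); intro
  end; ring.

(** * Leibniz rules for families of multilinear maps *)

Section Bilin.
Variables (R : realType) (T : normedModType R) (n k : nat).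
Local Notation V := 'rV[R]_n.
Variable A : set T.
Hypothesis oA : open A.

Lemma derive_app_on (F : T -> V -> 'rV[R]_k) (a : T -> V) v p : A p ->
  (forall x, A x -> linear (F x)) -> (forall c, smooth_on A (F ^~ c)) ->
  smooth_on A a ->
  'D_v (fun x => F x (a x)) p = 'D_v (fun x => F x (a p)) p + F p ('D_v a p).
Proof.
move=> Ap lF sF sa; apply: (derive_app oA Ap lF).
  by move=> c; exact: smooth_on_derivable (sF c) Ap.
exact: smooth_on_derivable sa Ap.
Qed.

Lemma derive_app2_on (F : T -> V -> V -> 'rV[R]_k) (a b : T -> V) v p : A p ->
  (forall x c, A x -> linear (F x ^~ c)) -> (forall x c, A x -> linear (F x c)) ->
  (forall c d, smooth_on A (fun x => F x c d)) ->
  smooth_on A a -> smooth_on A b ->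
  'D_v (fun x => F x (a x) (b x)) p =
  'D_v (fun x => F x (a p) (b p)) p + F p ('D_v a p) (b p)
  + F p (a p) ('D_v b p).
Proof.
move=> Ap l1 l2 sF sa sb.
rewrite (@derive_app_on (fun x c => F x c (b x)) a v p Ap); first last.
- exact: sa.
- move=> c; apply: (@smooth_on_app _ _ _ _ _ _ (fun x => F x c)) => //.
  by move=> x Ax; exact: l2.
- by move=> x Ax; exact: l1.
rewrite (@derive_app_on (fun x => F x (a p)) b v p Ap) //.
  by rewrite addrAC.
by move=> x Ax; exact: l2.
Qed.

Lemma derive_app3_on (F : T -> V -> V -> V -> 'rV[R]_k) (a b c : T -> V) v p :
  A p ->
  (forall x d e, A x -> linear (fun w => F x w d e)) ->
  (forall x d e, A x -> linear (fun w => F x d w e)) ->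
  (forall x d e, A x -> linear (fun w => F x d e w)) ->
  (forall d e w, smooth_on A (fun x => F x d e w)) ->
  smooth_on A a -> smooth_on A b -> smooth_on A c ->
  'D_v (fun x => F x (a x) (b x) (c x)) p =
  'D_v (fun x => F x (a p) (b p) (c p)) p + F p ('D_v a p) (b p) (c p)
  + F p (a p) ('D_v b p) (c p) + F p (a p) (b p) ('D_v c p).
Proof.
move=> Ap l1 l2 l3 sF sa sb sc.
rewrite (@derive_app2_on (fun x d e => F x d e (c x)) a b v p Ap) //; first last.
- move=> d e; apply: (@smooth_on_app _ _ _ _ _ _ (fun x => F x d e)) => //.
  by move=> x Ax; exact: l3.
- by move=> x d Ax; exact: l2.
- by move=> x d Ax; exact: l1.
rewrite (@derive_app_on (fun x => F x (a p) (b p)) c v p Ap) //.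
  by rewrite -!addrA; congr (_ + _); rewrite addrC addrA.
by move=> x Ax; exact: l3.
Qed.

Lemma smooth_on_app2 (F : T -> V -> V -> 'rV[R]_k) (a b : T -> V) :
  (forall x c, A x -> linear (F x ^~ c)) -> (forall x c, A x -> linear (F x c)) ->
  (forall c d, smooth_on A (fun x => F x c d)) ->
  smooth_on A a -> smooth_on A b ->
  smooth_on A (fun x => F x (a x) (b x)).
Proof.
move=> l1 l2 sF sa sb.
apply: (@smooth_on_app _ _ _ _ _ _ (fun x c => F x c (b x))) => //.
  by move=> x Ax; exact: l1.
move=> c; apply: (@smooth_on_app _ _ _ _ _ _ (fun x => F x c)) => //.
by move=> x Ax; exact: l2.
Qed.

Lemma smooth_on_app3 (F : T -> V -> V -> V -> 'rV[R]_k) (a b c : T -> V) :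
  (forall x d e, A x -> linear (fun w => F x w d e)) ->
  (forall x d e, A x -> linear (fun w => F x d w e)) ->
  (forall x d e, A x -> linear (fun w => F x d e w)) ->
  (forall d e w, smooth_on A (fun x => F x d e w)) ->
  smooth_on A a -> smooth_on A b -> smooth_on A c ->
  smooth_on A (fun x => F x (a x) (b x) (c x)).
Proof.
move=> l1 l2 l3 sF sa sb sc.
apply: (@smooth_on_app2 (fun x d e => F x d e (c x))) => //.
- by move=> x d Ax; exact: l1.
- by move=> x d Ax; exact: l2.
move=> d e; apply: (@smooth_on_app _ _ _ _ _ _ (fun x => F x d e)) => //.
by move=> x Ax; exact: l3.
Qed.
End Bilin.

(** * Connections and curvature in coordinates *)

Section Connection.
Variables (R : realType) (n : nat).
Local Notation V := 'rV[R]_n.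

(* C x u v stands for Gamma^k_(ij)(x) u^i v^j; the linearity and the symmetry are
   required at all points, as they hold for gamma g with its junk values. *)
Record is_connection (U : set V) (C : V -> V -> V -> V) : Prop := IsConnection {
  conn_open : open U;
  conn_linl : forall x v, linear (C x ^~ v);
  conn_linr : forall x u, linear (C x u);
  conn_sym : forall x u v, C x u v = C x v u;
  conn_smooth : forall u v, smooth_on U (fun x => C x u v) }.

(* The operators below are locked: unification would otherwise unfold them. *)
Fact conn_key : unit. Proof. by []. Qed.

Definition dconn_def (C : V -> V -> V -> V) (x z u v : V) : V :=
  'D_z (fun y => C y u v) x.
Definition dconn := locked_with conn_key dconn_def.

Lemma dconnE C x z u v : dconn C x z u v = 'D_z (fun y => C y u v) x.
Proof. by rewrite /dconn locked_withE. Qed.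

(** The coordinate formula with two derivatives and two products of Christoffel symbols. It is an
    expression in the values of the vectors at x alone, whereas [curv] acts on fields; [curv_riem]
    identifies the two. *)
Definition riem_def (C : V -> V -> V -> V) (x u v w : V) : V :=
  dconn C x u v w - dconn C x v u w + C x u (C x v w) - C x v (C x u w).
Definition riem := locked_with conn_key riem_def.

Lemma riemE C x u v w : riem C x u v w =
  dconn C x u v w - dconn C x v u w + C x u (C x v w) - C x v (C x u w).
Proof. by rewrite /riem locked_withE. Qed.

(* (nabla_z R)(u, v) w *)
Definition driem_def (C : V -> V -> V -> V) (x z u v w : V) : V :=
  'D_z (fun y => riem C y u v w) x + C x z (riem C x u v w)
  - riem C x (C x z u) v w - riem C x u (C x z v) w - riem C x u v (C x z w).
Definition driem := locked_with conn_key driem_def.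

Lemma driemE C x z u v w : driem C x z u v w =
  'D_z (fun y => riem C y u v w) x + C x z (riem C x u v w)
  - riem C x (C x z u) v w - riem C x u (C x z v) w - riem C x u v (C x z w).
Proof. by rewrite /driem locked_withE. Qed.

(* nabla_v Y for a vector field Y along f *)
Definition along_def (T : normedModType R) (C : V -> V -> V -> V) (f : T -> V)
    (v : T) (Y : T -> V) (p : T) : V := 'D_v Y p + C (f p) ('D_v f p) (Y p).
Definition along T := locked_with conn_key (@along_def T).

Lemma alongE (T : normedModType R) C (f : T -> V) v Y p :
  along C f v Y p = 'D_v Y p + C (f p) ('D_v f p) (Y p).
Proof. by rewrite /along locked_withE. Qed.

Variables (U : set V) (C : V -> V -> V -> V).
Hypothesis cC : is_connection U C.

Let oU := conn_open cC.
Let l1 := conn_linl cC.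
Let l2 := conn_linr cC.
Let sC := conn_smooth cC.

Lemma riem_skew x u v w : riem C x u v w = - riem C x v u w.
Proof. by rewrite !riemE; mxring. Qed.

Lemma dconn_lin2 x z v : U x -> linear (fun u => dconn C x z u v).
Proof.
move=> Ux c a b /=; rewrite !dconnE.
have d u : derivable (fun y => C y u v) x z by exact: smooth_on_derivable (sC u v) Ux.
have -> : (fun y => C y (c *: a + b) v) =
    c *: (fun y => C y a v) + (fun y => C y b v).
  apply/funext => y; exact: (l1 y v c a b).
rewrite (deriveD (derivableZ (k := c) (d a)) (d b)) (deriveZ c (d a)).
by [].
Qed.

Lemma dconn_sym x z u v : dconn C x z u v = dconn C x z v u.
Proof.
rewrite !dconnE; have -> // : (fun y => C y u v) = (fun y => C y v u).
apply/funext => y; exact: (conn_sym cC).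
Qed.

Lemma dconn_lin3 x z u : U x -> linear (fun v => dconn C x z u v).
Proof.
move=> Ux c a b /=; rewrite !(dconn_sym x z u).
exact: (@dconn_lin2 x z u Ux c a b).
Qed.

Lemma dconn_lin1 x u v : U x -> linear (fun z => dconn C x z u v).
Proof.
move=> Ux c a b; rewrite !dconnE.
exact: (derive_lin (smooth_on_diff (sC u v) Ux) c a b).
Qed.

Lemma dconn_smooth z u v : smooth_on U (fun x => dconn C x z u v).
Proof.
apply: (smooth_on_ext oU (f := fun x => 'D_z (fun y => C y u v) x)).
  by move=> x _; rewrite dconnE.
exact: smooth_on_derive (sC u v).
Qed.

Lemma riem_lin1 x v w : U x -> linear (fun u => riem C x u v w).
Proof.
move=> Ux c a b; rewrite !riemE.
rewrite (dconn_lin1 v w Ux c a b) (dconn_lin2 v w Ux c a b).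
rewrite !(l1 x _ c a b) (l2 x v c) /=.
by mxring.
Qed.

Lemma riem_lin2 x u w : U x -> linear (fun v => riem C x u v w).
Proof.
move=> Ux c a b.
rewrite [LHS]riem_skew [X in _ = _ *: X + _]riem_skew [X in _ = _ + X]riem_skew.
by rewrite (riem_lin1 u w Ux c a b) opprD scalerN.
Qed.

Lemma riem_lin3 x u v : U x -> linear (fun w => riem C x u v w).
Proof.
move=> Ux c a b; rewrite !riemE.
rewrite (dconn_lin3 u v Ux c a b) (dconn_lin3 v u Ux c a b) /=.
rewrite !(l2 x _ c) /=.
by mxring.
Qed.

(** As C is symmetric, the twelve terms cancel in pairs. *)
Lemma riem_bianchi x u v w :
  riem C x u v w + riem C x v w u + riem C x w u v = 0.
Proof.
rewrite !riemE (dconn_sym x u w v) (dconn_sym x v w u) (dconn_sym x w v u).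
rewrite (conn_sym cC x w v) (conn_sym cC x w u) (conn_sym cC x v u).
by mxring.
Qed.

Lemma riem_smooth u v w : smooth_on U (fun x => riem C x u v w).
Proof.
apply: (smooth_on_ext oU (f := fun x => dconn C x u v w - dconn C x v u w
    + C x u (C x v w) - C x v (C x u w))); first by move=> x _; rewrite riemE.
apply: smooth_onD => //; last first.
  apply: smooth_onN => //; apply: (@smooth_on_app _ _ _ _ _ U (fun x => C x v)) => //.
apply: smooth_onD => //; last first.
  by apply: (@smooth_on_app _ _ _ _ _ U (fun x => C x u)).
apply: smooth_onD => //; first exact: dconn_smooth.
by apply: smooth_onN => //; exact: dconn_smooth.
Qed.

Section Along.
Variables (T : normedModType R) (A : set T) (f : T -> V).
Hypothesis oA : open A.
Hypothesis sf : smooth_on A f.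
Hypothesis fU : forall p, A p -> U (f p).

Lemma conn_along_smooth a b : smooth_on A (fun p => C (f p) a b).
Proof.
exact: (@smooth_on_comp _ _ _ _ _ A U (fun x => C x a b) f oU oA fU (sC a b) sf).
Qed.

Lemma riem_along_smooth a b c : smooth_on A (fun p => riem C (f p) a b c).
Proof. exact: (@smooth_on_comp _ _ _ _ _ A U (fun x => riem C x a b c) f oU oA fU
  (riem_smooth a b c) sf). Qed.

Lemma smooth_conn (a b : T -> V) : smooth_on A a -> smooth_on A b ->
  smooth_on A (fun p => C (f p) (a p) (b p)).
Proof.
move=> sa sb; apply: (@smooth_on_app2 _ _ _ _ _ _ (fun p => C (f p))) => //.
exact: conn_along_smooth.
Qed.

Lemma smooth_riem (a b c : T -> V) :
  smooth_on A a -> smooth_on A b -> smooth_on A c ->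
  smooth_on A (fun p => riem C (f p) (a p) (b p) (c p)).
Proof.
move=> sa sb sc; apply: (@smooth_on_app3 _ _ _ _ _ _ (fun p => riem C (f p))) => //.
- by move=> x d e Ax; apply: riem_lin1; exact: fU.
- by move=> x d e Ax; apply: riem_lin2; exact: fU.
- by move=> x d e Ax; apply: riem_lin3; exact: fU.
exact: riem_along_smooth.
Qed.

Lemma derive_conn (a b : T -> V) v p : A p -> smooth_on A a -> smooth_on A b ->
  'D_v (fun p => C (f p) (a p) (b p)) p =
  dconn C (f p) ('D_v f p) (a p) (b p) + C (f p) ('D_v a p) (b p)
  + C (f p) (a p) ('D_v b p).
Proof.
move=> Ap sa sb.
have -> := derive_app2_on oA v Ap (fun x c _ => l1 (f x) c)
  (fun x c _ => l2 (f x) c) conn_along_smooth sa sb.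
have ch := @derive_chain _ _ _ _ (fun x => C x (a p) (b p)) f v p
  (smooth_on_diff sf Ap) (smooth_on_diff (sC _ _) (fU Ap)).
by rewrite dconnE -ch.
Qed.

Lemma derive_riem (a b c : T -> V) v p : A p ->
  smooth_on A a -> smooth_on A b -> smooth_on A c ->
  'D_v (fun p => riem C (f p) (a p) (b p) (c p)) p =
  'D_('D_v f p) (fun x => riem C x (a p) (b p) (c p)) (f p)
  + riem C (f p) ('D_v a p) (b p) (c p) + riem C (f p) (a p) ('D_v b p) (c p)
  + riem C (f p) (a p) (b p) ('D_v c p).
Proof.
move=> Ap sa sb sc.
have -> := derive_app3_on oA v Ap
  (fun x d e Ax => riem_lin1 d e (fU Ax))
  (fun x d e Ax => riem_lin2 d e (fU Ax))
  (fun x d e Ax => riem_lin3 d e (fU Ax)) riem_along_smooth sa sb sc.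
have ch := @derive_chain _ _ _ _ (fun x => riem C x (a p) (b p) (c p)) f v p
  (smooth_on_diff sf Ap) (smooth_on_diff (riem_smooth _ _ _) (fU Ap)).
by rewrite -ch.
Qed.

Lemma smooth_along v Y : smooth_on A Y -> smooth_on A (along C f v Y).
Proof.
move=> sY.
apply: (smooth_on_ext oA (f := fun p => 'D_v Y p + C (f p) ('D_v f p) (Y p))).
  by move=> p _; rewrite alongE.
apply: smooth_onD => //; first exact: smooth_on_derive.
by apply: smooth_conn => //; exact: smooth_on_derive.
Qed.

Lemma along_ext v (Y Z : T -> V) p : A p -> (forall q, A q -> Y q = Z q) ->
  along C f v Y p = along C f v Z p.
Proof.
by move=> Ap YZ; rewrite !alongE (YZ p Ap) (derive_ext v oA YZ Ap).
Qed.

Lemma alongD v (Y Z : T -> V) p : A p -> smooth_on A Y -> smooth_on A Z ->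
  along C f v (fun q => Y q + Z q) p = along C f v Y p + along C f v Z p.
Proof.
move=> Ap sY sZ; rewrite !alongE (linD (l2 _ _)).
rewrite (derive_addf (smooth_on_derivable sY Ap) (smooth_on_derivable sZ Ap)).
by rewrite addrACA.
Qed.

Lemma alongZ v (c : T -> R) (Y : T -> V) p : A p -> smooth_on A c ->
  smooth_on A Y ->
  along C f v (fun q => c q *: Y q) p = 'D_v c p *: Y p + c p *: along C f v Y p.
Proof.
move=> Ap sc sY; rewrite !alongE (linZ (l2 _ _)).
rewrite (derive_scale (smooth_on_derivable sc Ap) (smooth_on_derivable sY Ap)).
by rewrite scalerDr addrA.
Qed.

Lemma alongN v (Y : T -> V) p : A p -> smooth_on A Y ->
  along C f v (fun q => - Y q) p = - along C f v Y p.
Proof.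
move=> Ap sY; rewrite !alongE (linN (l2 _ _)) (derive_oppf (smooth_on_derivable sY Ap)).
by rewrite opprD.
Qed.

Lemma along_sum v (I : Type) (r : seq I) (P : pred I) (Y : I -> T -> V) p : A p ->
  (forall i, P i -> smooth_on A (Y i)) ->
  along C f v (fun q => \sum_(i <- r | P i) Y i q) p =
  \sum_(i <- r | P i) along C f v (Y i) p.
Proof.
move=> Ap sY; rewrite !alongE (lin_sum (l2 _ _)) derive_sumf.
  by rewrite -big_split /=; apply: eq_bigr => i _; rewrite alongE.
move=> i Pi; exact: smooth_on_derivable (sY i Pi) Ap.
Qed.

Lemma along_lin Y p : A p -> smooth_on A Y -> linear (fun v => along C f v Y p).
Proof.
move=> Ap sY c a b; rewrite !alongE.
rewrite (derive_lin (smooth_on_diff sY Ap) c a b).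
rewrite (derive_lin (smooth_on_diff sf Ap) c a b).
by rewrite (l1 (f p) (Y p) c) /= scalerDr addrACA.
Qed.

(** The connection has no torsion: second derivatives of f commute and C is symmetric. This
    exchanges the derivative in the variation parameter with those along M. *)
Lemma along_torsion v w p : A p ->
  along C f v (fun q => 'D_w f q) p = along C f w (fun q => 'D_v f q) p.
Proof.
by move=> Ap; rewrite !alongE (derive_comm v w oA Ap sf) (conn_sym cC).
Qed.

(** The directions v and w are constant on T, so their bracket is zero and only the curvature term
    remains. This is how curvature enters all the formulas for variations. *)
Lemma along_comm v w Y p : A p -> smooth_on A Y ->
  along C f v (along C f w Y) p =
  along C f w (along C f v Y) p + riem C (f p) ('D_v f p) ('D_w f p) (Y p).
Proof.
move=> Ap sY.
have e a b : along C f a (along C f b Y) p =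
    'D_a (fun q => 'D_b Y q) p
    + (dconn C (f p) ('D_a f p) ('D_b f p) (Y p)
       + C (f p) ('D_a (fun q => 'D_b f q) p) (Y p)
       + C (f p) ('D_b f p) ('D_a Y p))
    + (C (f p) ('D_a f p) ('D_b Y p)
       + C (f p) ('D_a f p) (C (f p) ('D_b f p) (Y p))).
  rewrite {1}alongE (derive_ext a oA (fun q _ => alongE C f b Y q) Ap) alongE.
  rewrite -(linD (l2 _ _)) -(derive_conn a Ap (smooth_on_derive b sf) sY).
  rewrite -derive_addf; first by [].
    exact: smooth_on_derivable (smooth_on_derive b sY) Ap.
  exact: smooth_on_derivable (smooth_conn (smooth_on_derive b sf) sY) Ap.
rewrite (e v w) (e w v) (derive_comm v w oA Ap sY) (derive_comm v w oA Ap sf) riemE.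
by mxring.
Qed.

Lemma along_riem v a b c p : A p ->
  smooth_on A a -> smooth_on A b -> smooth_on A c ->
  along C f v (fun p => riem C (f p) (a p) (b p) (c p)) p =
  driem C (f p) ('D_v f p) (a p) (b p) (c p)
  + riem C (f p) (along C f v a p) (b p) (c p)
  + riem C (f p) (a p) (along C f v b p) (c p)
  + riem C (f p) (a p) (b p) (along C f v c p).
Proof.
move=> Ap sa sb sc; rewrite alongE derive_riem// driemE !alongE.
rewrite (linD (riem_lin1 _ _ (fU Ap))) (linD (riem_lin2 _ _ (fU Ap))).
rewrite (linD (riem_lin3 _ _ (fU Ap))).
by mxring.
Qed.

End Along.
End Connection.

(** * The Levi-Civita connection *)

Section Inner.
Variables (R : realType) (n : nat).
Local Notation V := 'rV[R]_n.

Lemma inner_linl (G : 'M[R]_n) c (a b v : V) :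
  inner G (c *: a + b) v = c * inner G a v + inner G b v.
Proof. by rewrite /inner !mulmxDl -!scalemxAl !mxE. Qed.

Lemma inner_linr (G : 'M[R]_n) c (a b v : V) :
  inner G v (c *: a + b) = c * inner G v a + inner G v b.
Proof. by rewrite /inner linearP /= mulmxDr -scalemxAr !mxE. Qed.

Lemma inner_linm c (G H : 'M[R]_n) (u v : V) :
  inner (c *: G + H) u v = c * inner G u v + inner H u v.
Proof. by rewrite /inner mulmxDr mulmxDl -scalemxAr -scalemxAl !mxE. Qed.

Lemma inner_tr (G : 'M[R]_n) (u v : V) : inner G^T u v = inner G v u.
Proof.
transitivity ((v *m G *m u^T)^T 0 0); last by rewrite mxE.
by rewrite !trmx_mul trmxK mulmxA.
Qed.

Lemma inner_basis (G : 'M[R]_n) i j :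
  inner G (basis_vec R i) (basis_vec R j) = G i j.
Proof. by rewrite /inner /basis_vec -rowE trmx_delta -colE !mxE. Qed.

Lemma inner_inj (G : 'M[R]_n) (a b : V) : G \in unitmx ->
  (forall w, inner G a w = inner G b w) -> a = b.
Proof.
move=> Gu ab.
have E : a *m G = b *m G.
  apply/rowP => j; have := ab (basis_vec R j).
  by rewrite /inner /basis_vec trmx_delta -!colE !mxE.
by rewrite -[a](mulmxK Gu) E mulmxK.
Qed.

Lemma linR_basis (f : V -> R) u :
  (forall c a b, f (c *: a + b) = c * f a + f b) ->
  f u = \sum_i u 0 i * f (basis_vec R i).
Proof. by move=> lf; exact: (@lin_basis _ _ R^o f u lf). Qed.

Lemma trilin_ext (f h : V -> V -> V -> R) :
  (forall v w c a b, f (c *: a + b) v w = c * f a v w + f b v w) ->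
  (forall u w c a b, f u (c *: a + b) w = c * f u a w + f u b w) ->
  (forall u v c a b, f u v (c *: a + b) = c * f u v a + f u v b) ->
  (forall v w c a b, h (c *: a + b) v w = c * h a v w + h b v w) ->
  (forall u w c a b, h u (c *: a + b) w = c * h u a w + h u b w) ->
  (forall u v c a b, h u v (c *: a + b) = c * h u v a + h u v b) ->
  (forall i j k, f (basis_vec R i) (basis_vec R j) (basis_vec R k) =
     h (basis_vec R i) (basis_vec R j) (basis_vec R k)) ->
  forall u v w, f u v w = h u v w.
Proof.
move=> f1 f2 f3 h1 h2 h3 fh u v w.
rewrite (linR_basis (f := fun u => f u v w) u (f1 v w)).
rewrite (linR_basis (f := fun u => h u v w) u (h1 v w)).
apply: eq_bigr => i _; congr (_ * _).
rewrite (linR_basis (f := fun v => f _ v w) v (f2 _ w)).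
rewrite (linR_basis (f := fun v => h _ v w) v (h2 _ w)).
apply: eq_bigr => j _; congr (_ * _).
rewrite (linR_basis (f := f _ _) w (f3 _ _)) (linR_basis (f := h _ _) w (h3 _ _)).
by apply: eq_bigr => k _; rewrite fh.
Qed.

(** Both sides are trilinear, so the identity follows from its values on basis vectors. D stands for
    the derivative of the metric as a linear function of the direction. *)
Lemma koszul_ext (G : 'M[R]_n) (B : V -> V -> V) (D : V -> 'M[R]_n) :
  (forall v, linear (B ^~ v)) -> (forall u, linear (B u)) -> linear D ->
  (forall i j k, inner G (B (basis_vec R i) (basis_vec R j)) (basis_vec R k) =
     2^-1 * (D (basis_vec R i) j k + D (basis_vec R j) i k
       - D (basis_vec R k) i j)) ->
  forall u v w, inner G (B u v) w =
    2^-1 * (inner (D u) v w + inner (D v) u w - inner (D w) u v).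
Proof.
move=> B1 B2 lD E.
have B1' c a b v : B (c *: a + b) v = c *: B a v + B b v by exact: (B1 v c a b).
have B2' c a b v : B v (c *: a + b) = c *: B v a + B v b by exact: (B2 v c a b).
have lD' c a b : D (c *: a + b) = c *: D a + D b by exact: (lD c a b).
apply: (trilin_ext (f := fun u v w => inner G (B u v) w)
  (h := fun u v w => 2^-1 * (inner (D u) v w + inner (D v) u w
     - inner (D w) u v))) => //.
- by move=> v w c a b; rewrite B1' inner_linl.
- by move=> v w c a b; rewrite B2' inner_linl.
- by move=> v w c a b; rewrite inner_linr.
- by move=> v w c a b; rewrite lD' inner_linm !inner_linl; ring.
- by move=> v w c a b; rewrite lD' inner_linm inner_linl !inner_linr; ring.
- by move=> v w c a b; rewrite lD' inner_linm !inner_linr; ring.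
- by move=> i j k; rewrite E !inner_basis.
Qed.

Lemma gamma_linl (h : V -> 'M[R]_n) x v : linear (gamma h x ^~ v).
Proof.
move=> c a b; apply/rowP => k; rewrite !mxE mulr_sumr -big_split /=.
apply: eq_bigr => i _; rewrite mulr_sumr -big_split /=.
by apply: eq_bigr => j _; rewrite !mxE; ring.
Qed.

Lemma gamma_linr (h : V -> 'M[R]_n) x u : linear (gamma h x u).
Proof.
move=> c a b; apply/rowP => k; rewrite !mxE mulr_sumr -big_split /=.
apply: eq_bigr => i _; rewrite mulr_sumr -big_split /=.
by apply: eq_bigr => j _; rewrite !mxE; ring.
Qed.

Lemma gamma_basis (h : V -> 'M[R]_n) x i j :
  gamma h x (basis_vec R i) (basis_vec R j) = \row_k christoffel h k i j x.
Proof.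
apply/rowP => k; rewrite !mxE (bigD1 i) //= [X in _ + X]big1 ?addr0; last first.
  by move=> l li; apply: big1 => q _; rewrite !mxE eqxx (negbTE li) mulr0 mul0r.
rewrite (bigD1 j) //= [X in _ + X]big1 ?addr0; last first.
  by move=> l li; rewrite !mxE eqxx (negbTE li) mulr0.
by rewrite !mxE !eqxx !mulr1.
Qed.

End Inner.

Section LeviCivita.
Variables (R : realType) (n : nat).
Local Notation V := 'rV[R]_n.
Variables (U : set V) (h : V -> 'M[R]_n).
Hypothesis h_sym : forall x, (h x)^T = h x.
Hypothesis h_unit : forall x, U x -> h x \in unitmx.
Hypothesis h_diff : forall x, U x -> differentiable h x.

Lemma gamma_sym x u v : gamma h x u v = gamma h x v u.
Proof.
apply/rowP => k; rewrite !mxE exchange_big; apply: eq_bigr => i _.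
by apply: eq_bigr => j _; rewrite (christoffel_sym h_sym) mulrAC.
Qed.

Lemma inner_sym x u v : inner (h x) u v = inner (h x) v u.
Proof. by rewrite -inner_tr h_sym. Qed.

Lemma derive_metric_tr x z : U x -> ('D_z h x)^T = 'D_z h x.
Proof.
move=> Ux; have dh : derivable h x z by apply: diff_derivable; exact: h_diff.
apply/matrixP => i j; rewrite mxE -!(derive_entry _ _ dh).
have -> // : (fun y => h y j i) = (fun y => h y i j).
by apply/funext => y; rewrite -[in LHS]h_sym mxE.
Qed.

Lemma koszul x u v w : U x ->
  inner (h x) (gamma h x u v) w = 2^-1 * (inner ('D_u h x) v w
    + inner ('D_v h x) u w - inner ('D_w h x) u v).
Proof.
move=> Ux; move: u v w.
have lD := derive_lin (h_diff Ux).
apply: (koszul_ext (gamma_linl h x) (gamma_linr h x) lD).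
move=> i j r.
have dh z : derivable h x z by apply: diff_derivable; exact: h_diff.
have chE l p q : christoffel h l p q x = 2^-1 * \sum_s invmx (h x) l s *
    (('D_(basis_vec R p) h x) q s + ('D_(basis_vec R q) h x) p s
     - ('D_(basis_vec R s) h x) p q).
  rewrite /christoffel; congr (_ * _); apply: eq_bigr => s _.
  by rewrite !(derive_entry _ _ (dh _)).
move: chE.
(* With the derivative of the metric replaced by an arbitrary family D, pure index algebra is left:
   lowering the index with [h x] cancels [invmx (h x)]. *)
suff gen (D : V -> 'M[R]_n) : (forall l p q, christoffel h l p q x =
    2^-1 * \sum_s invmx (h x) l s * (D (basis_vec R p) q s
     + D (basis_vec R q) p s - D (basis_vec R s) p q)) ->
    inner (h x) (gamma h x (basis_vec R i) (basis_vec R j)) (basis_vec R r) =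
    2^-1 * (D (basis_vec R i) j r + D (basis_vec R j) i r
      - D (basis_vec R r) i j).
  exact: (gen (fun w => 'D_w h x)).
move=> chE; rewrite gamma_basis /inner /basis_vec trmx_delta -colE !mxE.
have ginv s : \sum_l invmx (h x) l s * h x l r = (s == r)%:R.
  have /matrixP/(_ s r) : invmx (h x) *m h x = 1%:M by rewrite mulVmx// h_unit.
  rewrite !mxE => <-; apply: eq_bigr => l _; congr (_ * _).
  by rewrite -[in LHS](h_sym x) -trmx_inv mxE.
under eq_bigr => l _ do rewrite mxE chE -mulrA mulr_suml.
rewrite -mulr_sumr exchange_big /=; congr (_ * _).
rewrite (bigD1 r) //= [X in _ + X]big1 ?addr0 => [|s sr].
  under eq_bigr => l _ do rewrite mulrAC.
  by rewrite -mulr_suml ginv eqxx mul1r.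
under eq_bigr => l _ do rewrite mulrAC.
by rewrite -mulr_suml ginv (negbTE sr) mul0r.
Qed.

(** Adding Koszul's formulas for (z, u, v) and (z, v, u), the derivatives along u and v cancel and
    the two halves of the derivative along z add up. *)
Lemma metric_compat x z u v : U x ->
  inner ('D_z h x) u v =
  inner (h x) (gamma h x z u) v + inner (h x) u (gamma h x z v).
Proof.
move=> Ux; rewrite [X in _ + X]inner_sym !koszul//.
have gen (D : V -> 'M[R]_n) : (forall w, (D w)^T = D w) -> inner (D z) u v =
    2^-1 * (inner (D z) u v + inner (D u) z v - inner (D v) z u)
    + 2^-1 * (inner (D z) v u + inner (D v) z u - inner (D u) z v).
  move=> Dtr.
  have -> : inner (D z) v u = inner (D z) u v by rewrite -inner_tr Dtr.
  by move: (inner _ _ _) (inner _ _ _) (inner _ _ _) => a b c; lra.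
exact: (gen (fun w => 'D_w h x) (fun w => derive_metric_tr w Ux)).
Qed.

(** A nondegenerate metric recovers the connection from Koszul's formula. The connection of the
    Sasaki-type metric and the transformation law of Christoffel symbols are both obtained this way,
    with no inverse matrix computed. *)
Lemma levi_civita_unique x (B : V -> V -> V) u v : U x ->
  (forall w, inner (h x) (B u v) w = 2^-1 * (inner ('D_u h x) v w
    + inner ('D_v h x) u w - inner ('D_w h x) u v)) ->
  gamma h x u v = B u v.
Proof.
move=> Ux hB; apply: (inner_inj (h_unit Ux)) => w.
by rewrite hB koszul.
Qed.

End LeviCivita.

(** Serves the identity and the projections of a product: their directional derivatives do not
    depend on the point, so all further ones are zero. *)
Lemma smooth_on_const_derive (R : realType) (T W : normedModType R) (A : set T)
    (f : T -> W) (c : T -> W) : open A -> (forall x, differentiable f x) ->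
  (forall v x, 'D_v f x = c v) -> smooth_on A f.
Proof.
move=> oA df Df; apply/smooth_onP; case => [|k]; split => // v.
apply: (Cn_ext oA (f := fun=> c v)); last exact: Cn_cst.
by move=> y _; rewrite Df.
Qed.

Lemma smooth_on_id (R : realType) (T : normedModType R) (A : set T) :
  open A -> smooth_on A (fun y : T => y).
Proof.
move=> oA; apply: (smooth_on_const_derive (c := id)) => //.
by move=> v x; exact: derive_id.
Qed.

Section DeriveMatrix.
Variables (R : realType) (T : normedModType R) (A : set T).
Hypothesis oA : open A.

Lemma derive_mulmx m n k (f : T -> 'M[R]_(m, n)) (h : T -> 'M[R]_(n, k)) v p :
  A p -> smooth_on A f -> smooth_on A h ->
  'D_v (fun x => f x *m h x) p = 'D_v f p *m h p + f p *m 'D_v h p.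
Proof.
move=> Ap sf sh; apply/matrixP => i j.
have df := smooth_on_derivable (v := v) sf Ap.
have dh := smooth_on_derivable (v := v) sh Ap.
rewrite -derive_entry; last exact: (smooth_on_derivable (smooth_on_mulmx oA sf sh) Ap).
have -> : (fun x => (f x *m h x) i j) = (fun x => \sum_l f x i l * h x l j).
  by apply/funext => x; rewrite mxE.
have dfe l := smooth_on_derivable (v := v) (smooth_on_entry i l oA sf) Ap.
have dhe l := smooth_on_derivable (v := v) (smooth_on_entry l j oA sh) Ap.
rewrite derive_sumf; last by move=> l _; exact: (derivableM (dfe l) (dhe l)).
rewrite !mxE -big_split /=; apply: eq_bigr => l _.
rewrite (deriveM (dfe l) (dhe l)) (derive_entry _ _ df) (derive_entry _ _ dh).
rewrite addrC; congr (_ + _); exact: mulrC.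
Qed.

Lemma derive_trmx m n (f : T -> 'M[R]_(m, n)) v p : A p -> smooth_on A f ->
  'D_v (fun x => (f x)^T) p = ('D_v f p)^T.
Proof.
move=> Ap sf; apply/matrixP => i j; rewrite [RHS]mxE.
have df := smooth_on_derivable (v := v) sf Ap.
rewrite -derive_entry; last exact: (smooth_on_derivable (smooth_on_trmx oA sf) Ap).
rewrite -(derive_entry _ _ df).
have -> // : (fun x => (f x)^T i j) = (fun x => f x j i).
by apply/funext => x; rewrite mxE.
Qed.

Lemma smooth_inner n (G : T -> 'M[R]_n) (a b : T -> 'rV[R]_n) :
  smooth_on A G -> smooth_on A a -> smooth_on A b ->
  smooth_on A (fun x => inner (G x) (a x) (b x)).
Proof.
move=> sG sa sb; apply: smooth_on_entry => //.
apply: smooth_on_mulmx => //; last exact: smooth_on_trmx.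
exact: smooth_on_mulmx.
Qed.

Lemma derive_inner n (G : T -> 'M[R]_n) (a b : T -> 'rV[R]_n) v p : A p ->
  smooth_on A G -> smooth_on A a -> smooth_on A b ->
  'D_v (fun x => inner (G x) (a x) (b x)) p =
  inner ('D_v G p) (a p) (b p) + inner (G p) ('D_v a p) (b p)
  + inner (G p) (a p) ('D_v b p).
Proof.
move=> Ap sG sa sb.
have saG := smooth_on_mulmx oA sa sG.
have sbt := smooth_on_trmx oA sb.
rewrite (derive_entry (f := fun x => a x *m G x *m (b x)^T)); last first.
  exact: (smooth_on_derivable (smooth_on_mulmx oA saG sbt) Ap).
rewrite (derive_mulmx v Ap saG sbt) (derive_mulmx v Ap sa sG) (derive_trmx v Ap sb).
rewrite mulmxDl [LHS]mxE [X in X + _ = _]mxE [X in X + _ = _]addrC.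
by [].
Qed.

End DeriveMatrix.

(** * Curvature of a metric connection with a parallel endomorphism *)

Section MetricConnection.
Variables (R : realType) (n : nat).
Local Notation V := 'rV[R]_n.
Variables (U : set V) (C : V -> V -> V -> V) (g : V -> 'M[R]_n).
Hypothesis cC : is_connection U C.
Hypothesis sg : smooth_on U g.
Hypothesis g_sym : forall x, (g x)^T = g x.
Hypothesis g_compat : forall x z u v, U x -> inner ('D_z g x) u v =
  inner (g x) (C x z u) v + inner (g x) u (C x z v).
Let oU := conn_open cC.

Lemma innerDl (G : 'M[R]_n) a b v : inner G (a + b) v = inner G a v + inner G b v.
Proof. by have := inner_linl G 1 a b v; rewrite scale1r mul1r. Qed.
Lemma innerDr (G : 'M[R]_n) a b v : inner G v (a + b) = inner G v a + inner G v b.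
Proof. by have := inner_linr G 1 a b v; rewrite scale1r mul1r. Qed.
Lemma inner0l (G : 'M[R]_n) v : inner G 0 v = 0.
Proof. by rewrite /inner !mul0mx mxE. Qed.
Lemma inner0r (G : 'M[R]_n) v : inner G v 0 = 0.
Proof. by rewrite /inner trmx0 mulmx0 mxE. Qed.
Lemma innerZl (G : 'M[R]_n) c a v : inner G (c *: a) v = c * inner G a v.
Proof. by have := inner_linl G c a 0 v; rewrite inner0l !addr0. Qed.
Lemma innerZr (G : 'M[R]_n) c a v : inner G v (c *: a) = c * inner G v a.
Proof. by have := inner_linr G c a 0 v; rewrite inner0r !addr0. Qed.
Lemma innerNl (G : 'M[R]_n) a v : inner G (- a) v = - inner G a v.
Proof. by rewrite -scaleN1r innerZl mulN1r. Qed.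
Lemma innerNr (G : 'M[R]_n) a v : inner G v (- a) = - inner G v a.
Proof. by rewrite -scaleN1r innerZr mulN1r. Qed.

Lemma smooth_conn_id (a b : V -> V) : smooth_on U a -> smooth_on U b ->
  smooth_on U (fun y => C y (a y) (b y)).
Proof.
move=> sa sb; apply: (@smooth_on_app2 _ _ _ _ _ oU C) => //.
- by move=> x c _; exact: (conn_linl cC).
- by move=> x c _; exact: (conn_linr cC).
exact: (conn_smooth cC).
Qed.

Lemma derive_inner_compat (a b : V -> V) x z : U x -> smooth_on U a -> smooth_on U b ->
  'D_z (fun y => inner (g y) (a y) (b y)) x =
  inner (g x) ('D_z a x + C x z (a x)) (b x)
  + inner (g x) (a x) ('D_z b x + C x z (b x)).
Proof.
move=> Ux sa sb; rewrite (derive_inner oU z Ux sg sa sb) g_compat// innerDl innerDr.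
have sw (p q r s : R) : p + q + r + s = r + p + (s + q) by ring.
exact: sw.
Qed.

(** The second derivatives of the function g(a, b), for constant a and b, commute. Expanded by
    compatibility, the products of two first-order terms are symmetric in the directions and cancel,
    leaving the two curvature terms. *)
Lemma riem_metric_skew x u v a b : U x ->
  inner (g x) (riem C x u v a) b = - inner (g x) a (riem C x u v b).
Proof.
move=> Ux.
have sc (c : V) : smooth_on U (fun=> c) by exact: smooth_on_cst.
have e1 z y : U y -> 'D_z (fun y => inner (g y) a b) y =
    inner (g y) (C y z a) b + inner (g y) a (C y z b).
  move=> Uy; rewrite (derive_inner_compat z Uy (sc a) (sc b)).
  by rewrite !derive_cst !add0r.
have sC z c : smooth_on U (fun y => C y z c) by exact: (conn_smooth cC).
have e2 z w : 'D_z (fun y => 'D_w (fun y => inner (g y) a b) y) x =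
    inner (g x) (dconn C x z w a + C x z (C x w a)) b
    + inner (g x) (C x w a) (C x z b)
    + (inner (g x) (C x z a) (C x w b)
    + inner (g x) a (dconn C x z w b + C x z (C x w b))).
  rewrite (derive_ext z oU (e1 w) Ux) derive_addf; last 2 first.
  - exact: (smooth_on_derivable (smooth_inner oU sg (sC w a) (sc b)) Ux).
  - exact: (smooth_on_derivable (smooth_inner oU sg (sc a) (sC w b)) Ux).
  rewrite (derive_inner_compat z Ux (sC w a) (sc b)).
  rewrite (derive_inner_compat z Ux (sc a) (sC w b)).
  by rewrite !derive_cst !add0r !dconnE.
have := derive_comm1 u v oU Ux (smooth_inner oU sg (sc a) (sc b)).
rewrite e2 e2 !riemE !innerDl !innerDr !innerNl !innerNr.
repeat match goal with |- context [@inner ?S ?k ?G ?a ?b] =>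
  generalize (@inner S k G a b); intro end.
lra.
Qed.

Lemma inner_symg x u v : inner (g x) u v = inner (g x) v u.
Proof. by rewrite -inner_tr g_sym. Qed.

(** The octahedron argument: pair symmetry is a linear consequence of four Bianchi identities and of
    skew-symmetry in the first and in the last two arguments. Once Q is opaque the listed instances
    form a linear system. *)
Lemma riem_pair x u v a b : U x ->
  inner (g x) (riem C x u v a) b = inner (g x) (riem C x a b u) v.
Proof.
move=> Ux; pose Q u v a b := inner (g x) (riem C x u v a) b.
have s1 p q r s : Q p q r s = - Q q p r s.
  by rewrite /Q riem_skew innerNl.
have s2 p q r s : Q p q r s = - Q p q s r.
  by rewrite /Q riem_metric_skew// inner_symg.
have B p q r s : Q p q r s + Q q r p s + Q r p q s = 0.
  by rewrite /Q -!innerDl (riem_bianchi cC) inner0l.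
rewrite -!/(Q _ _ _ _).
clearbody Q.
have := B u v a b; have := B v a b u; have := B a b u v; have := B b u v a.
have := s1 u v a b; have := s2 u v a b; have := s1 v a b u; have := s2 v a b u.
have := s1 a b u v; have := s2 a b u v; have := s1 b u v a; have := s2 b u v a.
have := s1 u a v b; have := s2 u a v b; have := s1 v b a u; have := s2 v b a u.
have := s1 a u v b; have := s2 a u v b; have := s1 b v a u; have := s2 b v a u.
have := s1 a u b v; have := s2 a u b v; have := s1 b v u a; have := s2 b v u a.
have := s1 v a u b; have := s1 b u a v; have := s2 u b v a; have := s2 b u a v.
have := s1 u b v a; have := s1 u b a v.
lra.
Qed.

Variable phi : V -> 'M[R]_n.
Hypothesis sphi : smooth_on U phi.
Hypothesis phi_parallel : forall x z b, U x ->
  'D_z (fun y => b *m phi y) x + C x z (b *m phi x) = C x z b *m phi x.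

Section Along.
Variables (T : normedModType R) (A : set T) (f : T -> V).
Hypothesis oA : open A.
Hypothesis sf : smooth_on A f.
Hypothesis fU : forall p, A p -> U (f p).

Lemma smooth_phi (Y : T -> V) : smooth_on A Y ->
  smooth_on A (fun p => Y p *m phi (f p)).
Proof.
move=> sY; apply: smooth_on_mulmx => //.
exact: (@smooth_on_comp _ _ _ _ _ A U phi f oU oA fU sphi sf).
Qed.

Lemma derive_inner_along v (a b : T -> V) p : A p -> smooth_on A a -> smooth_on A b ->
  'D_v (fun p => inner (g (f p)) (a p) (b p)) p =
  inner (g (f p)) (along C f v a p) (b p)
  + inner (g (f p)) (a p) (along C f v b p).
Proof.
move=> Ap sa sb.
have sgf : smooth_on A (fun p => g (f p)).
  exact: (@smooth_on_comp _ _ _ _ _ A U g f oU oA fU sg sf).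
rewrite (derive_inner oA v Ap sgf sa sb) !alongE.
have -> := @derive_chain _ _ _ _ g f v p (smooth_on_diff sf Ap)
  (smooth_on_diff sg (fU Ap)).
rewrite (g_compat _ _ _ (fU Ap)) !innerDl !innerDr.
have sw (k l r s : R) : k + l + r + s = r + k + (s + l) by ring.
exact: sw.
Qed.

Lemma along_phi v Y p : A p -> smooth_on A Y ->
  along C f v (fun p => Y p *m phi (f p)) p = along C f v Y p *m phi (f p).
Proof.
move=> Ap sY; rewrite !alongE.
have lF x : A x -> linear (fun c : V => c *m phi (f x)).
  by move=> _ c a b; rewrite mulmxDl scalemxAl.
have sF (c : V) : smooth_on A (fun q => c *m phi (f q)).
  by apply: (smooth_phi (Y := fun=> c)); exact: smooth_on_cst.
have -> := @derive_app_on _ _ _ _ _ oA (fun q c => c *m phi (f q)) Y v p Ap lF sF sY.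
have sc : smooth_on U (fun y => Y p *m phi y).
  by apply: smooth_on_mulmx => //; exact: smooth_on_cst.
have -> := @derive_chain _ _ _ _ (fun y => Y p *m phi y) f v p
  (smooth_on_diff sf Ap) (smooth_on_diff sc (fU Ap)).
rewrite addrAC (phi_parallel _ _ (fU Ap)) [RHS]mulmxDl.
exact: addrC.
Qed.

End Along.

(** The curvature is a commutator of covariant derivatives along the identity map, by [along_comm],
    and a parallel endomorphism commutes with each of them. The vector w is extended by constant
    components. *)
Lemma riem_phi x u v w : U x ->
  riem C x u v (w *m phi x) = riem C x u v w *m phi x.
Proof.
move=> Ux.
have sid := @smooth_on_id _ V U oU.
have fU y : U y -> U y by [].
have Did z y : 'D_z (fun y : V => y) y = z by exact: derive_id.
have sc (c : V) : smooth_on U (fun=> c) by exact: smooth_on_cst.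
have sp := smooth_phi oU sid fU (sc w).
have com Y (sY : smooth_on U Y) : riem C x u v (Y x) =
    along C id u (along C id v Y) x - along C id v (along C id u Y) x.
  have := along_comm cC oU sid fU u v Ux sY.
  by rewrite !Did => ->; rewrite addrAC subrr add0r.
rewrite (com _ sp) (com _ (sc w)).
have sal z : smooth_on U (along C id z (fun=> w)).
  exact: (smooth_along cC oU sid fU z (sc w)).
have e z z' : along C id z (along C id z' (fun y => w *m phi y)) x =
    along C id z (along C id z' (fun=> w)) x *m phi x.
  rewrite (along_ext C id oU z Ux
    (fun y Uy => along_phi oU sid fU z' Uy (sc w))).
  exact: (along_phi oU sid fU z Ux (sal z')).
by rewrite !e mulmxBl.
Qed.

End MetricConnection.

(** * The Sasaki-type metric *)

Section DeriveBlock.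
Variables (R : realType) (T : normedModType R) (A : set T).
Hypothesis oA : open A.

Lemma derive_lsubmx m n k (Z : T -> 'M[R]_(m, n + k)) v p : A p ->
  smooth_on A Z -> 'D_v (fun q => lsubmx (Z q)) p = lsubmx ('D_v Z p).
Proof.
move=> Ap sZ; apply/matrixP => i j.
rewrite -derive_entry; last exact: (smooth_on_derivable (smooth_on_lsubmx oA sZ) Ap).
rewrite [RHS]mxE -(derive_entry _ _ (smooth_on_derivable sZ Ap)).
have -> // : (fun q => lsubmx (Z q) i j) = (fun q => Z q i (lshift k j)).
by apply/funext => q; rewrite mxE.
Qed.

Lemma derive_rsubmx m n k (Z : T -> 'M[R]_(m, n + k)) v p : A p ->
  smooth_on A Z -> 'D_v (fun q => rsubmx (Z q)) p = rsubmx ('D_v Z p).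
Proof.
move=> Ap sZ; apply/matrixP => i j.
rewrite -derive_entry; last exact: (smooth_on_derivable (smooth_on_rsubmx oA sZ) Ap).
rewrite [RHS]mxE -(derive_entry _ _ (smooth_on_derivable sZ Ap)).
have -> // : (fun q => rsubmx (Z q) i j) = (fun q => Z q i (rshift n j)).
by apply/funext => q; rewrite mxE.
Qed.
End DeriveBlock.

Section SasakiConnection.
Variables (R : realType) (n : nat).
Local Notation V := 'rV[R]_n.
Local Notation VV := 'rV[R]_(n + n).
Variables (U : set V) (C : V -> V -> V -> V) (g phi : V -> 'M[R]_n).
Hypothesis cC : is_connection U C.
Hypothesis sg : smooth_on U g.
Hypothesis g_sym : forall x, (g x)^T = g x.
Hypothesis g_unit : forall x, U x -> g x \in unitmx.
Hypothesis g_compat : forall x z u v, U x -> inner ('D_z g x) u v =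
  inner (g x) (C x z u) v + inner (g x) u (C x z v).
Hypothesis sphi : smooth_on U phi.
Hypothesis phi_parallel : forall x z b, U x ->
  'D_z (fun y => b *m phi y) x + C x z (b *m phi x) = C x z b *m phi x.
Hypothesis phi_adj : forall x u v, U x ->
  inner (g x) (u *m phi x) v = inner (g x) u (v *m phi x).
Hypothesis phi_invol : forall x, U x -> phi x *m phi x = 1%:M.
Let oU := conn_open cC.

(* The vertical part of the tangent vector a = (a1, a2) at z = (x, u) of TM. *)
Definition connector_def (C : V -> V -> V -> V) (z a : VV) : V :=
  rsubmx a + C (lsubmx z) (lsubmx a) (rsubmx z).
Definition connector := locked_with conn_key connector_def.

Lemma connectorE (K : V -> V -> V -> V) z a :
  connector K z a = rsubmx a + K (lsubmx z) (lsubmx a) (rsubmx z).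
Proof. by rewrite /connector locked_withE. Qed.

Definition TU : set VV := [set z | U (lsubmx z)].

Variable h : VV -> 'M[R]_(n + n).
Hypothesis h_sym : forall z, (h z)^T = h z.
Hypothesis hE : forall z a b, TU z -> inner (h z) a b =
  inner (g (lsubmx z)) (lsubmx a) (lsubmx b)
  + inner (g (lsubmx z)) (connector C z a) (connector C z b *m phi (lsubmx z)).

Lemma open_TU : open TU.
Proof. by apply: open_comp => // z _; exact: continuous_lsubmx. Qed.
Let oTU := open_TU.

Lemma smooth_lsub : smooth_on TU (fun z : VV => lsubmx z).
Proof. exact: (smooth_on_lsubmx oTU (smooth_on_id oTU)). Qed.

Lemma smooth_rsub : smooth_on TU (fun z : VV => rsubmx z).
Proof. exact: (smooth_on_rsubmx oTU (smooth_on_id oTU)). Qed.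

Lemma lsub_TU z : TU z -> U (lsubmx z). Proof. by []. Qed.

Let sl := smooth_lsub.
Let sr := smooth_rsub.

Lemma derive_lsub z a : TU z -> 'D_a (fun z : VV => lsubmx z) z = lsubmx a.
Proof.
move=> zU; rewrite (derive_lsubmx oTU a zU (smooth_on_id oTU)).
by rewrite derive_id.
Qed.

Lemma derive_rsub z a : TU z -> 'D_a (fun z : VV => rsubmx z) z = rsubmx a.
Proof.
move=> zU; rewrite (derive_rsubmx oTU a zU (smooth_on_id oTU)).
by rewrite derive_id.
Qed.

Lemma smooth_connector a : smooth_on TU (fun z => connector C z a).
Proof.
have sc k (c : 'rV[R]_k) : smooth_on TU (fun=> c) by exact: smooth_on_cst.
apply: (smooth_on_ext oTU _ (smooth_onD oTU (sc _ (rsubmx a)) _)); last first.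
  exact: (smooth_conn cC oTU sl lsub_TU (sc _ (lsubmx a)) sr).
by move=> z _; rewrite connectorE.
Qed.

(* nabla_a of the connector applied to a constant b, see along_connector *)
Definition vertical_deriv_def (z a b : VV) : V :=
  C (lsubmx z) (lsubmx a) (connector C z b)
  + dconn C (lsubmx z) (lsubmx a) (lsubmx b) (rsubmx z)
  + C (lsubmx z) (lsubmx b) (rsubmx a).
Definition vertical_deriv := locked_with conn_key vertical_deriv_def.

Lemma vertical_derivE z a b : vertical_deriv z a b =
  C (lsubmx z) (lsubmx a) (connector C z b)
  + dconn C (lsubmx z) (lsubmx a) (lsubmx b) (rsubmx z)
  + C (lsubmx z) (lsubmx b) (rsubmx a).
Proof. by rewrite /vertical_deriv locked_withE. Qed.

Lemma along_connector z a b : TU z ->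
  along C (fun z : VV => lsubmx z) a (fun z => connector C z b) z = vertical_deriv z a b.
Proof.
move=> zU; rewrite alongE (derive_lsub _ zU) vertical_derivE [LHS]addrC -addrA.
have sc k (c : 'rV[R]_k) : smooth_on TU (fun=> c) by exact: smooth_on_cst.
have -> : 'D_a (fun z => connector C z b) z =
    'D_a (fun z => C (lsubmx z) (lsubmx b) (rsubmx z)) z.
  rewrite (derive_ext a oTU (fun z _ => connectorE C z b) zU) derive_addf.
  - by rewrite derive_cst add0r.
  - exact: (smooth_on_derivable (sc _ _) zU).
  - exact: (smooth_on_derivable (smooth_conn cC oTU sl lsub_TU (sc _ _) sr) zU).
have -> := @derive_conn _ _ _ _ cC _ _ _ oTU sl lsub_TU (fun=> lsubmx b)
  (fun z => rsubmx z) a z zU (sc _ _) sr.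
rewrite derive_cst (derive_lsub _ zU) (derive_rsub _ zU).
by rewrite (lin0 (conn_linl cC _ _)) addr0.
Qed.

(** The connector is a one-form on TM with values in V. For constant fields a and b, which commute,
    the left-hand side is its covariant exterior derivative; that it is the curvature expresses the
    failure of the horizontal distribution to be integrable. *)
Lemma vertical_deriv_skew z a b : vertical_deriv z a b - vertical_deriv z b a =
  riem C (lsubmx z) (lsubmx a) (lsubmx b) (rsubmx z).
Proof.
rewrite !vertical_derivE !connectorE riemE !(linD (conn_linr cC _ _)).
by mxring.
Qed.

Let sc k (c : 'rV[R]_k) : smooth_on TU (fun=> c).
Proof. exact: smooth_on_cst. Qed.

Let sgl : smooth_on TU (fun z => g (lsubmx z)).
Proof. exact: (@smooth_on_comp _ _ _ _ _ TU U g _ oU oTU lsub_TU sg sl). Qed.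

Let sKphi (b : VV) : smooth_on TU (fun z => connector C z b *m phi (lsubmx z)).
Proof. exact: (smooth_phi cC sphi oTU sl lsub_TU (smooth_connector b)). Qed.

Let sh1 (a b : VV) : smooth_on TU (fun z => inner (g (lsubmx z)) (lsubmx a) (lsubmx b)).
Proof. exact: (smooth_inner oTU sgl (sc (lsubmx a)) (sc (lsubmx b))). Qed.

Let sh2 (a b : VV) : smooth_on TU (fun z =>
  inner (g (lsubmx z)) (connector C z a) (connector C z b *m phi (lsubmx z))).
Proof. exact: (smooth_inner oTU sgl (smooth_connector a) (sKphi b)). Qed.

Lemma smooth_sasaki : smooth_on TU h.
Proof.
apply: (smooth_on_mx oTU) => i j.
apply: (smooth_on_ext oTU _
  (smooth_onD oTU (sh1 (basis_vec R i) (basis_vec R j))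
    (sh2 (basis_vec R i) (basis_vec R j)))).
by move=> z zU; rewrite -hE// inner_basis.
Qed.

Lemma derive_sasaki z c a b : TU z -> inner ('D_c h z) a b =
  inner (g (lsubmx z)) (C (lsubmx z) (lsubmx c) (lsubmx a)) (lsubmx b)
  + inner (g (lsubmx z)) (lsubmx a) (C (lsubmx z) (lsubmx c) (lsubmx b))
  + (inner (g (lsubmx z)) (vertical_deriv z c a) (connector C z b *m phi (lsubmx z))
  + inner (g (lsubmx z)) (connector C z a) (vertical_deriv z c b *m phi (lsubmx z))).
Proof.
move=> zU.
have := derive_inner oTU c zU smooth_sasaki (sc a) (sc b).
rewrite !derive_cst inner0l inner0r !addr0 => <-.
rewrite (derive_ext c oTU (fun z zU => hE a b zU) zU) derive_addf; last 2 first.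
- exact: (smooth_on_derivable (sh1 a b) zU).
- exact: (smooth_on_derivable (sh2 a b) zU).
have al k : along C (fun z : VV => lsubmx z) c (fun=> lsubmx k) z =
    C (lsubmx z) (lsubmx c) (lsubmx k).
  by rewrite alongE derive_cst add0r (derive_lsub _ zU).
have -> := derive_inner_along cC sg g_compat oTU sl lsub_TU c zU
  (sc (lsubmx a)) (sc (lsubmx b)).
have -> := derive_inner_along cC sg g_compat oTU sl lsub_TU c zU
  (smooth_connector a) (sKphi b).
rewrite !al (along_phi cC sphi phi_parallel oTU sl lsub_TU c zU (smooth_connector b)).
by rewrite !along_connector.
Qed.

(** A vector in the kernel is tested against vertical vectors, which kills its connector, and then
    against vectors with arbitrary first block, which kills its projection to M. *)
Lemma sasaki_unit z : TU z -> h z \in unitmx.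
Proof.
move=> zU; rewrite -row_free_unit; apply: inj_row_free => a a0.
have H b : inner (h z) a b = 0 by rewrite /inner a0 mul0mx mxE.
have K0 : connector C z a = 0.
  apply: (inner_inj (g_unit (lsub_TU zU))) => w; rewrite inner0l.
  (* The vertical vector with components [w *m phi]: the phi of the metric and this one cancel by
     phi^2 = 1, which leaves g(connector, w). *)
  have := H (row_mx 0 (w *m phi (lsubmx z))).
  rewrite hE// [connector _ _ (row_mx _ _)]connectorE row_mxKl row_mxKr inner0r add0r.
  rewrite (lin0 (conn_linl cC _ _)) addr0 -mulmxA phi_invol ?mulmx1//.
have A0 : lsubmx a = 0.
  apply: (inner_inj (g_unit (lsub_TU zU))) => w; rewrite inner0l.
  by have := H (row_mx w 0); rewrite hE// K0 inner0l addr0 row_mxKl.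
have B0 : rsubmx a = 0.
  by move: K0; rewrite connectorE A0 (lin0 (conn_linl cC _ _)) addr0.
by rewrite -[a]hsubmxK A0 B0 row_mx0.
Qed.

(** The solution of Koszul's formula for the projection to M. Each curvature term comes from the
    antisymmetrised derivative of the connector, rewritten by [inner_riem_phi] as an inner product
    with the free third vector. *)
Definition sasaki_h (z a b : VV) : V :=
  let x := lsubmx z in let u := rsubmx z *m phi x in
  C x (lsubmx a) (lsubmx b)
  + 2^-1 *: (riem C x u (connector C z b) (lsubmx a)
             + riem C x u (connector C z a) (lsubmx b)).

(** The symmetrised derivative of the connector is the covariant vertical part. The subtracted term
    converts it into the second coordinate block, see [connector_sasaki]. *)
Definition sasaki_conn (z a b : VV) : VV :=
  row_mx (sasaki_h z a b)
    (2^-1 *: (vertical_deriv z a b + vertical_deriv z b a) - C (lsubmx z) (sasaki_h z a b) (rsubmx z)).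

Lemma connector_sasaki z a b : connector C z (sasaki_conn z a b) =
  2^-1 *: (vertical_deriv z a b + vertical_deriv z b a).
Proof. by rewrite connectorE /sasaki_conn row_mxKl row_mxKr subrK. Qed.

(** Pair symmetry brings [u *m phi x] to the last slot of the curvature, from which phi can be taken
    out. In Koszul's formula this isolates the third vector c. *)
Lemma inner_riem_phi x u k a c : U x ->
  inner (g x) (riem C x (u *m phi x) k a) c =
  inner (g x) k (riem C x a c u *m phi x).
Proof.
move=> Ux.
rewrite (riem_pair cC sg g_sym g_compat)// (riem_phi cC sphi phi_parallel)//.
by rewrite (inner_symg g_sym).
Qed.

(** Both sides of Koszul's formula are written with the same inner products of Christoffel terms,
    connectors and derivatives of connectors; a linear identity among them remains. *)
Lemma gamma_sasaki z a b : TU z -> gamma h z a b = sasaki_conn z a b.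
Proof.
move=> zU; have Ux := lsub_TU zU.
apply: (levi_civita_unique h_sym sasaki_unit
  (fun z zU => smooth_on_diff smooth_sasaki zU) zU) => c.
rewrite (hE _ _ zU) connector_sasaki {1}/sasaki_conn row_mxKl.
rewrite (derive_sasaki a b c zU) (derive_sasaki b a c zU) (derive_sasaki c a b zU).
rewrite /sasaki_h !innerDl !innerZl !innerDl.
rewrite !(inner_riem_phi _ _ _ _ Ux).
(* The curvature terms of [sasaki_h] turn into differences of derivatives of the connector, the
   quantities that [derive_sasaki] produces. *)
rewrite -!(vertical_deriv_skew z _ c) !mulmxBl !innerDr !innerNr.
have sK p q : inner (g (lsubmx z)) p (q *m phi (lsubmx z)) =
    inner (g (lsubmx z)) q (p *m phi (lsubmx z)).
  by rewrite -phi_adj// (inner_symg g_sym).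
rewrite (conn_sym cC _ (lsubmx b) (lsubmx a)) (conn_sym cC _ (lsubmx c) (lsubmx a)).
rewrite (conn_sym cC _ (lsubmx c) (lsubmx b)) (sK (vertical_deriv z c a)).
rewrite (inner_symg g_sym _ (C _ (lsubmx a) (lsubmx c)) (lsubmx b)).
repeat match goal with |- context [@inner ?S ?k ?G ?a ?b] =>
  let x := fresh "x" in set x := (@inner S k G a b); clearbody x end.
lra.
Qed.

Lemma sasaki_is_connection : is_connection TU (gamma h).
Proof.
split => //.
- by move=> x v; exact: gamma_linl.
- by move=> x u; exact: gamma_linr.
- by move=> x u v; exact: gamma_sym.
move=> a b.
apply: (smooth_on_ext oTU (f := fun z => sasaki_conn z a b)).
  by move=> z zU; rewrite gamma_sasaki.
have su : smooth_on TU (fun z => rsubmx z *m phi (lsubmx z)).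
  exact: (smooth_phi cC sphi oTU sl lsub_TU sr).
have sR (k l : VV) : smooth_on TU (fun z => riem C (lsubmx z) (rsubmx z *m phi (lsubmx z))
    (connector C z k) (lsubmx l)).
  exact: (smooth_riem cC oTU sl lsub_TU su (smooth_connector k) (sc (lsubmx l))).
have shh : smooth_on TU (fun z => sasaki_h z a b).
  apply: (smooth_onD oTU).
    exact: (smooth_conn cC oTU sl lsub_TU (sc (lsubmx a)) (sc (lsubmx b))).
  apply: (smooth_onZ oTU); first exact: smooth_on_cst.
  exact: (smooth_onD oTU (sR b a) (sR a b)).
have sN k l : smooth_on TU (fun z => vertical_deriv z k l).
  apply: (smooth_on_ext oTU (f := along C (fun z : VV => lsubmx z) k
    (fun z => connector C z l))).
    by move=> z zU; exact: along_connector.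
  exact: (smooth_along cC oTU sl lsub_TU k (smooth_connector l)).
apply: (smooth_on_row_mx oTU shh); apply: (smooth_onD oTU).
  apply: (smooth_onZ oTU); first exact: smooth_on_cst.
  exact: (smooth_onD oTU (sN a b) (sN b a)).
apply: (smooth_onN oTU).
exact: (smooth_conn cC oTU sl lsub_TU shh sr).
Qed.

Section Along.
Variables (T : normedModType R) (A : set T) (f u : T -> V).
Hypothesis oA : open A.
Hypothesis sf : smooth_on A f.
Hypothesis su : smooth_on A u.
Hypothesis fU : forall p, A p -> U (f p).

Let psi (p : T) : VV := row_mx (f p) (u p).

Lemma smooth_psi : smooth_on A psi.
Proof. exact: (smooth_on_row_mx oA sf su). Qed.

Lemma psi_TU p : A p -> TU (psi p).
Proof. by move=> Ap; rewrite /TU /= row_mxKl; exact: fU. Qed.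

Lemma derive_psi v p : A p -> 'D_v psi p = row_mx ('D_v f p) ('D_v u p).
Proof.
move=> Ap; rewrite -[LHS]hsubmxK.
rewrite -(derive_lsubmx oA v Ap smooth_psi) -(derive_rsubmx oA v Ap smooth_psi).
have -> : (fun q => lsubmx (psi q)) = f.
  by apply/funext => q; rewrite row_mxKl.
have -> // : (fun q => rsubmx (psi q)) = u.
by apply/funext => q; rewrite row_mxKr.
Qed.

Lemma connector_psi z p : connector C (psi p) z = rsubmx z + C (f p) (lsubmx z) (u p).
Proof. by rewrite connectorE row_mxKl row_mxKr. Qed.

Lemma connector_dpsi v p : A p ->
  connector C (psi p) ('D_v psi p) = along C f v u p.
Proof. by move=> Ap; rewrite connector_psi derive_psi// row_mxKl row_mxKr alongE. Qed.

Lemma smooth_connector_psi Z : smooth_on A Z ->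
  smooth_on A (fun p => connector C (psi p) (Z p)).
Proof.
move=> sZ; apply: (smooth_on_ext oA (f := fun p => rsubmx (Z p)
    + C (f p) (lsubmx (Z p)) (u p))); first by move=> p _; rewrite connector_psi.
apply: (smooth_onD oA (smooth_on_rsubmx oA sZ)).
exact: (smooth_conn cC oA sf fU (smooth_on_lsubmx oA sZ) su).
Qed.

Lemma lsub_along_sasaki Z v p : A p -> smooth_on A Z ->
  lsubmx (along (gamma h) psi v Z p) =
  along C f v (fun q => lsubmx (Z q)) p
  + 2^-1 *: (riem C (f p) (u p *m phi (f p)) (connector C (psi p) (Z p)) ('D_v f p)
    + riem C (f p) (u p *m phi (f p)) (along C f v u p) (lsubmx (Z p))).
Proof.
move=> Ap sZ; rewrite !alongE (gamma_sasaki _ _ (psi_TU Ap)).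
rewrite linearD /= /sasaki_conn [X in _ + X]row_mxKl /sasaki_h.
rewrite (connector_dpsi v Ap) (derive_lsubmx oA v Ap sZ) alongE.
by rewrite row_mxKl row_mxKr (derive_psi v Ap) row_mxKl addrA.
Qed.

Lemma connector_along_sasaki Z v p : A p -> smooth_on A Z ->
  connector C (psi p) (along (gamma h) psi v Z p) =
  along C f v (fun q => connector C (psi q) (Z q)) p
  - 2^-1 *: riem C (f p) ('D_v f p) (lsubmx (Z p)) (u p).
Proof.
move=> Ap sZ; rewrite alongE (gamma_sasaki _ _ (psi_TU Ap)).
have cD a b : connector C (psi p) (a + b) = connector C (psi p) a + connector C (psi p) b.
  by rewrite !connectorE !linearD /= (linD (conn_linl cC _ _)) addrACA.
rewrite cD connector_sasaki [in RHS]alongE.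
rewrite (derive_ext v oA (fun q _ => connector_psi (Z q) q) Ap).
have sZl := smooth_on_lsubmx oA sZ.
have sZr := smooth_on_rsubmx oA sZ.
rewrite derive_addf; last 2 first.
- exact: (smooth_on_derivable sZr Ap).
- exact: (smooth_on_derivable (smooth_conn cC oA sf fU sZl su) Ap).
rewrite (derive_conn cC oA sf fU v Ap sZl su).
have := vertical_deriv_skew (psi p) ('D_v psi p) (Z p).
rewrite connector_psi row_mxKl row_mxKr (derive_lsubmx oA v Ap sZ).
rewrite (derive_rsubmx oA v Ap sZ) (derive_psi v Ap) row_mxKl => <-.
rewrite [vertical_deriv _ _ (Z p)]vertical_derivE row_mxKl row_mxKr !row_mxKl row_mxKr.
(* With X = k + d + e and N the two orders of [vertical_deriv], (X + N) / 2 = X - (X - N) / 2: X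
   completes the covariant derivative of the connector of Z, and X - N is the curvature. *)
have half (r c k d e N : V) : r + c + 2^-1 *: (k + d + e + N) =
    r + (d + c + e) + k - 2^-1 *: (k + d + e - N).
  apply/rowP => i; rewrite !mxE.
  by move: (r 0 i) (c 0 i) (k 0 i) (d 0 i) (e 0 i) (N 0 i) => *; lra.
exact: half.
Qed.
End Along.

End SasakiConnection.

(** * Traces and divergences, and their commutation with a variation *)

Section Trace.
Variables (R : realType) (n k : nat) (T : normedModType R).
Variables (e : 'I_n -> T) (gi : 'I_n -> 'I_n -> T -> R)
  (ga : 'I_n -> 'I_n -> 'I_n -> T -> R).
Local Notation V := 'rV[R]_k.

(** [gi] and [ga] play the roles of the inverse metric and of the Christoffel symbols of the source.
    They are arbitrary functions on T, so that M and M x R are treated together. *)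
Definition trace2 (B : 'I_n -> 'I_n -> T -> V) (p : T) : V :=
  \sum_i \sum_j gi i j p *: B i j p.

(* Tr_g of the covariant derivative of the one-form Y along f *)
Definition divg (C : V -> V -> V -> V) (f : T -> V) (Y : 'I_n -> T -> V) : T -> V :=
  trace2 (fun i j p => along C f (e i) (Y j) p - \sum_l ga i j l p *: Y l p).

Lemma trace2_ext (B B' : 'I_n -> 'I_n -> T -> V) p :
  (forall i j, B i j p = B' i j p) -> trace2 B p = trace2 B' p.
Proof. by move=> BB; apply: eq_bigr => i _; apply: eq_bigr => j _; rewrite BB. Qed.

Lemma trace2D (B B' : 'I_n -> 'I_n -> T -> V) p :
  trace2 (fun i j p => B i j p + B' i j p) p = trace2 B p + trace2 B' p.
Proof.
rewrite /trace2 -big_split; apply: eq_bigr => i _.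
by rewrite -big_split; apply: eq_bigr => j _; rewrite scalerDr.
Qed.

Lemma trace2Z c (B : 'I_n -> 'I_n -> T -> V) p :
  trace2 (fun i j p => c *: B i j p) p = c *: trace2 B p.
Proof.
rewrite /trace2 scaler_sumr; apply: eq_bigr => i _.
by rewrite scaler_sumr; apply: eq_bigr => j _; rewrite !scalerA mulrC.
Qed.

Lemma trace2N (B : 'I_n -> 'I_n -> T -> V) p :
  trace2 (fun i j p => - B i j p) p = - trace2 B p.
Proof.
rewrite -scaleN1r -trace2Z; apply: trace2_ext => i j.
by rewrite scaleN1r.
Qed.

Lemma trace2B (B B' : 'I_n -> 'I_n -> T -> V) p :
  trace2 (fun i j p => B i j p - B' i j p) p = trace2 B p - trace2 B' p.
Proof. by rewrite trace2D trace2N. Qed.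

Lemma trace2_tr (B : 'I_n -> 'I_n -> T -> V) p :
  (forall i j, gi i j p = gi j i p) ->
  trace2 (fun i j => B j i) p = trace2 B p.
Proof.
move=> gs; rewrite /trace2 exchange_big; apply: eq_bigr => i _.
by apply: eq_bigr => j _; rewrite gs.
Qed.

Lemma divg_ext C f (Y Y' : 'I_n -> T -> V) A p : open A -> A p ->
  (forall i q, A q -> Y i q = Y' i q) -> divg C f Y p = divg C f Y' p.
Proof.
move=> oA Ap YY; apply: trace2_ext => i j.
rewrite (along_ext C f oA (e i) Ap (YY j)); congr (_ - _).
by apply: eq_bigr => l _; rewrite YY.
Qed.

End Trace.

Section Commutation.
Variables (R : realType) (n k : nat) (T : normedModType R) (A : set T).
Local Notation V := 'rV[R]_k.
Variables (e : 'I_n -> T) (t : T) (gi : 'I_n -> 'I_n -> T -> R)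
  (ga : 'I_n -> 'I_n -> 'I_n -> T -> R).
Variables (U : set V) (C : V -> V -> V -> V) (f : T -> V).
Hypothesis cC : is_connection U C.
Hypothesis oA : open A.
Hypothesis sf : smooth_on A f.
Hypothesis fU : forall p, A p -> U (f p).
Hypothesis sgi : forall i j, smooth_on A (gi i j).
Hypothesis sga : forall i j l, smooth_on A (ga i j l).
Hypothesis gi_t : forall i j p, A p -> 'D_t (gi i j) p = 0.
Hypothesis ga_t : forall i j l p, A p -> 'D_t (ga i j l) p = 0.

Lemma smooth_trace2 (B : 'I_n -> 'I_n -> T -> V) :
  (forall i j, smooth_on A (B i j)) -> smooth_on A (trace2 gi B).
Proof.
move=> sB; rewrite /trace2.
apply: (smooth_on_sum _ oA) => i _; apply: (smooth_on_sum _ oA) => j _.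
exact: (smooth_onZ oA (sgi i j) (sB i j)).
Qed.

Lemma smooth_divg (Y : 'I_n -> T -> V) :
  (forall i, smooth_on A (Y i)) -> smooth_on A (divg e gi ga C f Y).
Proof.
move=> sY; apply: smooth_trace2 => i j; apply: (smooth_onD oA).
  exact: (smooth_along cC oA sf fU (e i) (sY j)).
apply: (smooth_onN oA); apply: (smooth_on_sum _ oA) => l _.
exact: (smooth_onZ oA (sga i j l) (sY l)).
Qed.

Lemma along_trace2 (B : 'I_n -> 'I_n -> T -> V) p : A p ->
  (forall i j, smooth_on A (B i j)) ->
  along C f t (trace2 gi B) p = trace2 gi (fun i j => along C f t (B i j)) p.
Proof.
move=> Ap sB.
have sgB i j := smooth_onZ oA (sgi i j) (sB i j).
rewrite /trace2 (along_sum cC f t _ Ap); last first.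
  by move=> i _; apply: (smooth_on_sum _ oA).
apply: eq_bigr => i _; rewrite (along_sum cC f t _ Ap) //.
apply: eq_bigr => j _; rewrite (alongZ cC f t Ap (sgi i j) (sB i j)).
by rewrite gi_t// scale0r add0r.
Qed.

(** The coefficients do not depend on t, so the derivative along t reaches each term, where
    exchanging it with the derivative along [e i] costs one curvature term. It serves for the
    connection of TM and for that of M. *)
Lemma along_divg (Y : 'I_n -> T -> V) p : A p ->
  (forall i, smooth_on A (Y i)) ->
  along C f t (divg e gi ga C f Y) p =
  divg e gi ga C f (fun i => along C f t (Y i)) p
  + trace2 gi (fun i j q => riem C (f q) ('D_t f q) ('D_(e i) f q) (Y j q)) p.
Proof.
move=> Ap sY; rewrite -trace2D.
have sal i j := smooth_along cC oA sf fU (e i) (sY j).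
have sga' i j l := smooth_onZ oA (sga i j l) (sY l).
have sgs i j : smooth_on A (fun q => \sum_l ga i j l q *: Y l q).
  by apply: (smooth_on_sum _ oA) => l _; exact: sga'.
rewrite along_trace2//; last first.
  by move=> i j; apply: (smooth_onD oA (sal i j)); exact: (smooth_onN oA (sgs i j)).
apply: trace2_ext => i j.
rewrite (alongD cC f t Ap (sal i j) (smooth_onN oA (sgs i j))).
rewrite (alongN cC f t Ap (sgs i j)) (along_sum cC f t _ Ap) //.
rewrite (along_comm cC oA sf fU t (e i) Ap (sY j)) addrAC; congr (_ - _ + _).
apply: eq_bigr => l _; rewrite (alongZ cC f t Ap (sga i j l) (sY l)).
by rewrite ga_t// scale0r add0r.
Qed.

End Commutation.

Lemma trace2_lin (R : realType) (n k m : nat) (T : normedModType R)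
    (gi : 'I_n -> 'I_n -> T -> R) (L : 'rV[R]_k -> 'rV[R]_m)
    (B : 'I_n -> 'I_n -> T -> 'rV[R]_k) p : linear L ->
  L (trace2 gi B p) = trace2 gi (fun i j q => L (B i j q)) p.
Proof.
move=> lL; rewrite /trace2 (lin_sum lL); apply: eq_bigr => i _.
by rewrite (lin_sum lL); apply: eq_bigr => j _; rewrite (linZ lL).
Qed.

(** * The tension field of a map into TM and its variation *)

Section SasakiTension.
Variables (R : realType) (n : nat).
Local Notation V := 'rV[R]_n.
Local Notation VV := 'rV[R]_(n + n).
Variables (U : set V) (C : V -> V -> V -> V) (g phi : V -> 'M[R]_n).
Hypothesis cC : is_connection U C.
Hypothesis sg : smooth_on U g.
Hypothesis g_sym : forall x, (g x)^T = g x.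
Hypothesis g_unit : forall x, U x -> g x \in unitmx.
Hypothesis g_compat : forall x z u v, U x -> inner ('D_z g x) u v =
  inner (g x) (C x z u) v + inner (g x) u (C x z v).
Hypothesis sphi : smooth_on U phi.
Hypothesis phi_parallel : forall x z b, U x ->
  'D_z (fun y => b *m phi y) x + C x z (b *m phi x) = C x z b *m phi x.
Hypothesis phi_adj : forall x u v, U x ->
  inner (g x) (u *m phi x) v = inner (g x) u (v *m phi x).
Hypothesis phi_invol : forall x, U x -> phi x *m phi x = 1%:M.
Variable h : VV -> 'M[R]_(n + n).
Hypothesis h_sym : forall z, (h z)^T = h z.
Hypothesis hE : forall z a b, TU U z -> inner (h z) a b =
  inner (g (lsubmx z)) (lsubmx a) (lsubmx b)
  + inner (g (lsubmx z)) (connector C z a) (connector C z b *m phi (lsubmx z)).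

Variables (T : normedModType R) (A : set T) (f u : T -> V).
Hypothesis oA : open A.
Hypothesis sf : smooth_on A f.
Hypothesis su : smooth_on A u.
Hypothesis fU : forall p, A p -> U (f p).

Variables (e : 'I_n -> T) (t : T) (gi : 'I_n -> 'I_n -> T -> R)
  (ga : 'I_n -> 'I_n -> 'I_n -> T -> R).
Hypothesis sgi : forall i j, smooth_on A (gi i j).
Hypothesis sga : forall i j l, smooth_on A (ga i j l).
Hypothesis gi_t : forall i j p, A p -> 'D_t (gi i j) p = 0.
Hypothesis ga_t : forall i j l p, A p -> 'D_t (ga i j l) p = 0.
Hypothesis gi_sym : forall i j p, gi i j p = gi j i p.

Let psi (p : T) : VV := row_mx (f p) (u p).
Let H := gamma h.
Let spsi : smooth_on A psi := smooth_psi oA sf su.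
Let cH : is_connection (TU U) H := sasaki_is_connection cC sg g_sym g_unit
  g_compat sphi phi_parallel phi_adj phi_invol h_sym hE.
Let psiU : forall p, A p -> TU U (psi p) := psi_TU u fU.
Let sD k := smooth_on_derive (e k) spsi.
Let sfD k := smooth_on_derive (e k) sf.
Let sal k := smooth_along cC oA sf fU (e k) su.
Let suphi := smooth_phi cC sphi oA sf fU su.

Definition tau_map : T -> VV := divg e gi ga H psi (fun k => 'D_(e k) psi).

Definition tau_curv (i j : 'I_n) (q : T) : V :=
  riem C (f q) (u q *m phi (f q)) (along C f (e i) u q) ('D_(e j) f q).

(** When f is the identity the divergence of its differential is zero, but its derivative along t is
    not: it is the origin of the rough Laplacian of S and of the trace of R(S, e_i) e_j. *)
Definition tau_h (p : T) : V :=
  divg e gi ga C f (fun k => 'D_(e k) f) p + trace2 gi tau_curv p.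

Definition tau_v : T -> V := divg e gi ga C f (fun k => along C f (e k) u).

Lemma lsub_dpsi k q : A q -> lsubmx ('D_(e k) psi q) = 'D_(e k) f q.
Proof. by move=> Aq; rewrite (derive_psi oA sf su _ Aq) row_mxKl. Qed.

Lemma lsubmx_lin : linear (fun a : VV => lsubmx a).
Proof. by move=> c a b; rewrite linearP. Qed.

Lemma connector_lin z : linear (connector C z).
Proof.
move=> c a b; rewrite !connectorE !linearP /= (conn_linl cC _ _ c) /=.
by mxring.
Qed.

(** The two terms with factor 1/2 in [lsub_along_sasaki], applied to the differential of [psi],
    differ by the exchange of i and j; under a symmetric trace they add up to one full term. *)
Lemma half_sym (X : 'I_n -> 'I_n -> T -> V) p :
  trace2 gi (fun i j q => 2^-1 *: (X j i q + X i j q)) p = trace2 gi X p.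
Proof.
rewrite trace2Z trace2D (trace2_tr X (fun i j => gi_sym i j p)).
have half (v : V) : 2^-1 *: (v + v) = v.
  by apply/rowP => i; rewrite !mxE; move: (v 0 i) => a; lra.
exact: half.
Qed.

(** Removes the curvature term of [connector_along_sasaki] from the vertical part of the tension
    field. *)
Lemma half_skew (X : 'I_n -> 'I_n -> T -> V) p :
  (forall i j q, X i j q = - X j i q) ->
  trace2 gi X p = 0.
Proof.
move=> Xs; have E := trace2_tr X (fun i j => gi_sym i j p).
have : trace2 gi X p = - trace2 gi X p.
  rewrite -{2}E -trace2N; exact: (trace2_ext _ (fun i j => Xs i j p)).
have half (v : V) : v = - v -> v = 0.
  by move=> /rowP vE; apply/rowP => i; have := vE i; rewrite !mxE; lra.
exact: half.
Qed.

Lemma lsub_tau p : A p -> lsubmx (tau_map p) = tau_h p.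
Proof.
move=> Ap; rewrite /tau_map (trace2_lin _ _ _ lsubmx_lin).
rewrite /tau_h -(half_sym tau_curv) -trace2D; apply: trace2_ext => i j.
rewrite (linB lsubmx_lin) (lin_sum lsubmx_lin).
rewrite (lsub_along_sasaki cC sg g_sym g_unit g_compat sphi phi_parallel
  phi_adj phi_invol h_sym hE oA sf su fU (e i) Ap (sD j)).
rewrite (along_ext C f oA (e i) Ap (lsub_dpsi j)).
rewrite (connector_dpsi C oA sf su (e j) Ap) (lsub_dpsi j Ap) -!addrA; congr (_ + _).
rewrite addrC; congr (_ + _).
by congr (- _); apply: eq_bigr => l _; rewrite (linZ lsubmx_lin) lsub_dpsi.
Qed.

Lemma connector_tau p : A p -> connector C (psi p) (tau_map p) = tau_v p.
Proof.
move=> Ap; rewrite /tau_map (trace2_lin _ _ _ (connector_lin (psi p))).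
have sk : trace2 gi (fun i j q =>
    2^-1 *: riem C (f q) ('D_(e i) f q) ('D_(e j) f q) (u q)) p = 0.
  by apply: half_skew => i j q; rewrite riem_skew scalerN.
transitivity (tau_v p - trace2 gi (fun i j q =>
    2^-1 *: riem C (f q) ('D_(e i) f q) ('D_(e j) f q) (u q)) p); last first.
  by rewrite sk subr0.
rewrite /tau_v /divg -trace2B; apply: trace2_ext => i j.
rewrite (linB (connector_lin _)) (lin_sum (connector_lin _)).
rewrite (connector_along_sasaki cC sg g_sym g_unit g_compat sphi phi_parallel
  phi_adj phi_invol h_sym hE oA sf su fU (e i) Ap (sD j)).
rewrite (along_ext C f oA (e i) Ap (fun q Aq => connector_dpsi C oA sf su (e j) Aq)).
rewrite (lsub_dpsi j Ap) -!addrA; congr (_ + _).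
rewrite addrC; congr (- _ + _).
apply: eq_bigr => l _; rewrite (linZ (connector_lin _)).
by rewrite (connector_dpsi C oA sf su (e l) Ap).
Qed.

Let stau : smooth_on A tau_map := smooth_divg e cH oA spsi psiU sgi sga sD.
Let stc i j : smooth_on A (tau_curv i j) :=
  smooth_riem cC oA sf fU suphi (sal i) (sfD j).
Let ft q := 'D_t f q.
Let ut := along C f t u.

(** The Leibniz rule, with phi parallel, with one commutator of covariant derivatives of u, and with
    the symmetry of the second derivative of f. These are the trace terms of [first_expr] other than
    [Rm S E F], the third summand giving two of them. *)
Lemma along_tau_curv i j p : A p -> along C f t (tau_curv i j) p =
  driem C (f p) (ft p) (u p *m phi (f p)) (along C f (e i) u p) ('D_(e j) f p)
  + riem C (f p) (ut p *m phi (f p)) (along C f (e i) u p) ('D_(e j) f p)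
  + riem C (f p) (u p *m phi (f p))
      (along C f (e i) ut p + riem C (f p) (ft p) ('D_(e i) f p) (u p)) ('D_(e j) f p)
  + riem C (f p) (u p *m phi (f p)) (along C f (e i) u p) (along C f (e j) ft p).
Proof.
move=> Ap; rewrite (along_riem cC oA sf fU t Ap suphi (sal i) (sfD j)).
rewrite (along_phi cC sphi phi_parallel oA sf fU t Ap su).
rewrite (along_comm cC oA sf fU t (e i) Ap su).
by rewrite (along_torsion cC oA sf t (e j) Ap).
Qed.

Lemma along_tau_h p : A p -> along C f t tau_h p =
  divg e gi ga C f (fun k => along C f (e k) ft) p
  + trace2 gi (fun i j q => riem C (f q) (ft q) ('D_(e i) f q) ('D_(e j) f q)) p
  + trace2 gi (fun i j => along C f t (tau_curv i j)) p.
Proof.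
move=> Ap.
have sdv := smooth_divg e cC oA sf fU sgi sga sfD.
have str := smooth_trace2 oA sgi stc.
rewrite (alongD cC f t Ap sdv str) (along_trace2 f cC oA sgi gi_t Ap stc).
rewrite (along_divg e cC oA sf fU sgi sga gi_t ga_t Ap sfD).
have tors k q : A q -> along C f t ('D_(e k) f) q = along C f (e k) ft q.
  by move=> Aq; exact: (along_torsion cC oA sf t (e k) Aq).
by rewrite (divg_ext e gi ga C f oA Ap tors).
Qed.

Lemma along_tau_v p : A p -> along C f t tau_v p =
  divg e gi ga C f (fun k q => along C f (e k) ut q
    + riem C (f q) (ft q) ('D_(e k) f q) (u q)) p
  + trace2 gi (fun i j q => riem C (f q) (ft q) ('D_(e i) f q) (along C f (e j) u q)) p.
Proof.
move=> Ap; rewrite (along_divg e cC oA sf fU sgi sga gi_t ga_t Ap sal).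
have com k q : A q -> along C f t (along C f (e k) u) q = along C f (e k) ut q
    + riem C (f q) (ft q) ('D_(e k) f q) (u q).
  by move=> Aq; exact: (along_comm cC oA sf fU t (e k) Aq su).
by rewrite (divg_ext e gi ga C f oA Ap com).
Qed.

Lemma lsub_along_tau p : A p -> lsubmx (along H psi t tau_map p) =
  along C f t tau_h p
  + 2^-1 *: (riem C (f p) (u p *m phi (f p)) (tau_v p) (ft p)
    + riem C (f p) (u p *m phi (f p)) (ut p) (tau_h p)).
Proof.
move=> Ap; rewrite -(along_ext C f oA t Ap lsub_tau) -(lsub_tau Ap) -(connector_tau Ap).
exact: (lsub_along_sasaki cC sg g_sym g_unit g_compat sphi phi_parallel
  phi_adj phi_invol h_sym hE oA sf su fU t Ap stau).
Qed.

Lemma connector_along_tau p : A p -> connector C (psi p) (along H psi t tau_map p) =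
  along C f t tau_v p - 2^-1 *: riem C (f p) (ft p) (tau_h p) (u p).
Proof.
move=> Ap; rewrite -(along_ext C f oA t Ap connector_tau) -(lsub_tau Ap).
exact: (connector_along_sasaki cC sg g_sym g_unit g_compat sphi
  phi_parallel phi_adj phi_invol h_sym hE oA sf su fU t Ap stau).
Qed.

End SasakiTension.

(** * The operators on vector fields in terms of pointwise tensors *)

Section Fields.
Variables (R : realType) (n : nat).
Local Notation V := 'rV[R]_n.
Variables (U : set V) (g : V -> 'M[R]_n).
Hypothesis cG : is_connection U (gamma g).
Let C := gamma g.
Let cC : is_connection U C := cG.
Let oU := conn_open cC.
Let sid := smooth_on_id oU.
Let idU y : U y -> U y. Proof. by []. Qed.

Lemma derive_idf (T : normedModType R) (v x : T) : 'D_v (fun y : T => y) x = v.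
Proof. exact: derive_id. Qed.

Lemma cov_along X Y x : cov g X Y x = along C (fun y => y) (X x) Y x.
Proof. by rewrite alongE derive_idf. Qed.

Lemma smooth_dir m (X : V -> V) (Y : V -> 'rV[R]_m) : smooth_on U X -> smooth_on U Y ->
  smooth_on U (fun x => 'D_(X x) Y x).
Proof.
move=> sX sY; apply: (@smooth_on_app _ _ _ _ _ U (fun x c => 'D_c Y x)) => //.
  by move=> x Ux; exact: (derive_lin (smooth_on_diff sY Ux)).
by move=> c; exact: smooth_on_derive.
Qed.

Lemma smooth_cov X Y : smooth_on U X -> smooth_on U Y -> smooth_on U (cov g X Y).
Proof.
move=> sX sY; apply: (smooth_onD oU (smooth_dir sX sY)).
exact: (smooth_conn_id cC sX sY).
Qed.

Lemma derive_dir m (X : V -> V) (Y : V -> 'rV[R]_m) a x : U x -> smooth_on U X ->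
  smooth_on U Y -> 'D_a (fun y => 'D_(X y) Y y) x =
  'D_a (fun y => 'D_(X x) Y y) x + 'D_('D_a X x) Y x.
Proof.
move=> Ux sX sY.
exact: (derive_app_on oU a Ux (F := fun y c => 'D_c Y y)
  (fun y Uy => derive_lin (smooth_on_diff sY Uy))
  (fun c => smooth_on_derive c sY) sX).
Qed.

Lemma cov_cov X Y Z x : U x -> smooth_on U X -> smooth_on U Y -> smooth_on U Z ->
  cov g X (cov g Y Z) x =
  'D_(X x) (fun y => 'D_(Y x) Z y) x + 'D_('D_(X x) Y x) Z x
  + (dconn C x (X x) (Y x) (Z x) + C x ('D_(X x) Y x) (Z x)
     + C x (Y x) ('D_(X x) Z x))
  + (C x (X x) ('D_(Y x) Z x) + C x (X x) (C x (Y x) (Z x))).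
Proof.
move=> Ux sX sY sZ; transitivity ('D_(X x) (fun y => 'D_(Y y) Z y + C y (Y y) (Z y)) x
    + C x (X x) ('D_(Y x) Z x + C x (Y x) (Z x))); first by [].
rewrite (linD (conn_linr cC x (X x))) derive_addf; last 2 first.
- exact: (smooth_on_derivable (smooth_dir sY sZ) Ux).
- exact: (smooth_on_derivable (smooth_conn_id cC sY sZ) Ux).
rewrite (derive_dir _ Ux sY sZ).
have := derive_conn cC oU sid idU (X x) Ux sY sZ; rewrite derive_idf => ->.
by [].
Qed.

(** Tensoriality: the derivatives of X and Y cancel against the bracket term, the second derivatives
    of Z by their symmetry, and the remaining first derivatives of Z by antisymmetry in X and Y. *)
Lemma curv_riem X Y Z x : U x -> smooth_on U X -> smooth_on U Y -> smooth_on U Z ->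
  curv g X Y Z x = riem C x (X x) (Y x) (Z x).
Proof.
move=> Ux sX sY sZ.
transitivity (cov g X (cov g Y Z) x - cov g Y (cov g X Z) x - cov g (lie X Y) Z x).
  by [].
rewrite (cov_cov Ux sX sY sZ) (cov_cov Ux sY sX sZ).
have -> : cov g (lie X Y) Z x = 'D_('D_(X x) Y x) Z x - 'D_('D_(Y x) X x) Z x
    + (C x ('D_(X x) Y x) (Z x) - C x ('D_(Y x) X x) (Z x)).
  rewrite -(linB (derive_lin (smooth_on_diff sZ Ux))).
  by rewrite -(linB (conn_linl cC x (Z x))).
rewrite (derive_comm (Y x) (X x) oU Ux sZ) riemE.
by mxring.
Qed.

Lemma curv_at_riem x u v w : U x -> curv_at g x u v w = riem C x u v w.
Proof. by move=> Ux; apply: (curv_riem Ux); exact: smooth_on_cst. Qed.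

Lemma smooth_curv X Y Z : smooth_on U X -> smooth_on U Y -> smooth_on U Z ->
  smooth_on U (curv g X Y Z).
Proof.
move=> sX sY sZ.
apply: (smooth_on_ext oU (f := fun x => riem C x (X x) (Y x) (Z x))).
  by move=> x Ux; rewrite curv_riem.
exact: (smooth_riem cC oU sid idU sX sY sZ).
Qed.

Lemma cov_curv_driem W X Y Z x : U x ->
  smooth_on U W -> smooth_on U X -> smooth_on U Y -> smooth_on U Z ->
  cov_curv g W X Y Z x = driem C x (W x) (X x) (Y x) (Z x).
Proof.
move=> Ux sW sX sY sZ.
transitivity (cov g W (curv g X Y Z) x - curv g (cov g W X) Y Z x
  - curv g X (cov g W Y) Z x - curv g X Y (cov g W Z) x); first by [].
rewrite (curv_riem Ux (smooth_cov sW sX) sY sZ).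
rewrite (curv_riem Ux sX (smooth_cov sW sY) sZ).
rewrite (curv_riem Ux sX sY (smooth_cov sW sZ)).
rewrite !cov_along.
rewrite (along_ext C (fun y => y) oU (W x) Ux
  (fun y Uy => curv_riem Uy sX sY sZ)).
rewrite (along_riem cC oU sid idU (W x) Ux sX sY sZ) derive_idf.
by mxring.
Qed.

Lemma driem_skew x z u v w : U x -> driem C x z u v w = - driem C x z v u w.
Proof.
move=> Ux; rewrite !driemE.
have -> : (fun y => riem C y u v w) = (fun y => - riem C y v u w).
  by apply/funext => y; rewrite riem_skew.
rewrite (derive_oppf (smooth_on_derivable (riem_smooth cC v u w) Ux)).
rewrite (riem_skew C x u v w) (riem_skew C x (C x z u)) (riem_skew C x u (C x z v)).
rewrite (riem_skew C x u v (C x z w)) (linN (conn_linr cC _ _)).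
have zsum (a b c d e : V) : - a - b - - c - - d - - e = - (a + b - d - c - e).
  by mxring.
exact: zsum.
Qed.

Definition inv_metric (i j : 'I_n) (x : V) : R := invmx (g x) i j.
Definition gamma_coef (i j l : 'I_n) (x : V) : R :=
  gamma g x (basis_vec R i) (basis_vec R j) 0 l.

Lemma gamma_coefE i j x :
  gamma g x (basis_vec R i) (basis_vec R j) = \sum_l gamma_coef i j l x *: basis_vec R l.
Proof. exact: row_basis. Qed.

Lemma cov_basis i j x :
  cov g (fun=> basis_vec R i) (fun=> basis_vec R j) x =
  gamma g x (basis_vec R i) (basis_vec R j).
Proof. by rewrite /cov derive_cst add0r. Qed.

Lemma rough_laplacian_divg X x : U x -> smooth_on U X ->
  rough_laplacian g X x =
  - divg (@basis_vec R n) inv_metric gamma_coef C (fun y => y)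
      (fun k => along C (fun y => y) (basis_vec R k) X) x.
Proof.
move=> Ux sX; rewrite /rough_laplacian [LHS]/(- _); congr (- _).
apply: eq_bigr => i _; apply: eq_bigr => j _; congr (_ *: _).
rewrite [LHS]/(_ - _) cov_along; congr (_ - _).
  congr (along _ _ _ _ _); apply/funext => y; exact: cov_along.
rewrite cov_along cov_basis (lin_basis _ (along_lin cC sid Ux sX)).
by [].
Qed.

End Fields.

(** * Tension and bitension *)

Section MapFields.
Variables (R : realType) (n k : nat).
Local Notation V := 'rV[R]_n.
Local Notation W := 'rV[R]_k.
Variables (U : set V) (g : V -> 'M[R]_n) (TW : set W) (h : W -> 'M[R]_k).
Variable psi : V -> W.
Hypothesis cH : is_connection TW (gamma h).
Hypothesis spsi : smooth_on U psi.
Hypothesis psiW : forall x, U x -> TW (psi x).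
Let H := gamma h.

Lemma pull_cov_along X Y x : pull_cov h psi X Y x = along H psi (X x) Y x.
Proof. by rewrite alongE. Qed.

Lemma tension_divg x : U x -> tension g h psi x =
  divg (@basis_vec R n) (inv_metric g) (gamma_coef g) H psi (fun l => 'D_(basis_vec R l) psi) x.
Proof.
move=> Ux; apply: eq_bigr => i _; apply: eq_bigr => j _; congr (_ *: _).
rewrite [LHS]/(_ - _) pull_cov_along; congr (_ - _).
rewrite /dmap cov_basis (lin_basis _ (derive_lin (smooth_on_diff spsi Ux))).
by [].
Qed.

Lemma pull_rough_laplacian_divg Y x : U x -> smooth_on U Y ->
  pull_rough_laplacian g h psi Y x =
  - divg (@basis_vec R n) (inv_metric g) (gamma_coef g) H psi
      (fun l => along H psi (basis_vec R l) Y) x.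
Proof.
move=> Ux sY; rewrite /pull_rough_laplacian [LHS]/(- _); congr (- _).
apply: eq_bigr => i _; apply: eq_bigr => j _; congr (_ *: _).
rewrite [LHS]/(_ - _) pull_cov_along; congr (_ - _).
  congr (along _ _ _ _ _); apply/funext => y; exact: pull_cov_along.
rewrite pull_cov_along cov_basis (lin_basis _ (along_lin cH spsi Ux sY)).
by [].
Qed.

Lemma bitension_divg x : U x -> smooth_on U (tension g h psi) ->
  bitension g h psi x =
  - (divg (@basis_vec R n) (inv_metric g) (gamma_coef g) H psi
      (fun l => along H psi (basis_vec R l) (tension g h psi)) x
    + trace2 (inv_metric g) (fun i j q => riem H (psi q) (tension g h psi q)
        ('D_(basis_vec R i) psi q) ('D_(basis_vec R j) psi q)) x).
Proof.
move=> Ux st; rewrite opprD -(pull_rough_laplacian_divg Ux st).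
rewrite [LHS]/(_ - _); congr (_ - _).
apply: eq_bigr => i _; apply: eq_bigr => j _; congr (_ *: _).
exact: (curv_at_riem cH _ _ _ (psiW Ux)).
Qed.

End MapFields.

(** * Functions on M x R and their restriction to t = 0 *)

Section Restriction.
Variables (R : realType) (n k : nat).
Local Notation V := 'rV[R]_n.
Local Notation T := ('rV[R]_n * R)%type.

Lemma derive_slice (W : normedModType R) (Y : T -> W) (v x : V) :
  'D_((v, 0) : T) Y (x, 0) = 'D_v (fun y => Y (y, 0)) x.
Proof.
symmetry; apply: (derive_along Y (L := fun y => (y, 0 : R))) => c.
by congr pair; rewrite /= scaler0 addr0.
Qed.

Lemma along_slice (C : 'rV[R]_k -> 'rV[R]_k -> 'rV[R]_k -> 'rV[R]_k)
    (F Y : T -> 'rV[R]_k) (v x : V) :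
  along C F ((v, 0) : T) Y (x, 0) =
  along C (fun y => F (y, 0)) v (fun y => Y (y, 0)) x.
Proof. by rewrite !alongE !derive_slice. Qed.

Lemma derive_fst (W : normedModType R) (Y : V -> W) (w p : T) :
  'D_w (fun q : T => Y q.1) p = 'D_(w.1) Y p.1.
Proof. by apply: (derive_along Y (L := fun q : T => q.1)). Qed.

Lemma smooth_fst (A : set T) : open A -> smooth_on A (fun q : T => q.1).
Proof.
move=> oA; apply: (smooth_on_const_derive (c := fun v : T => v.1)) => //.
  move=> p; apply: (@linear_differentiable R T V (@fst V R : {linear T -> V})) => q.
  exact: cvg_fst.
by move=> v p; rewrite (derive_fst (fun x => x)) derive_idf.
Qed.

Lemma smooth_snd (A : set T) : open A -> smooth_on A (fun q : T => q.2).
Proof.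
move=> oA; apply: (smooth_on_const_derive (c := fun v : T => v.2)) => //.
  move=> p; apply: (@linear_differentiable R T R (@snd V R^o : {linear T -> R^o})) => q.
  exact: cvg_snd.
move=> v p; rewrite -[RHS](@derive_idf R R v.2 p.2).
by apply: (derive_along (fun x : R => x) (L := fun q : T => q.2)).
Qed.

Lemma open_preimage_on (S W : normedModType R) (A : set S) (B : set W) (f : S -> W) :
  open A -> open B -> smooth_on A f -> open (A `&` f @^-1` B).
Proof.
move=> oA oB sf; rewrite openE => p [Ap Bfp]; apply: filterI.
  exact: open_nbhs_nbhs.
have cf : {for p, continuous f}.
  exact: (differentiable_continuous (smooth_on_diff sf Ap)).
by apply: cf; exact: open_nbhs_nbhs.
Qed.

End Restriction.

Lemma gamma_is_connection (R : realType) n (U : set 'rV[R]_n) (g : 'rV[R]_n -> 'M[R]_n) :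
  open U -> smooth_on U g -> (forall x, (g x)^T = g x) ->
  (forall x, U x -> g x \in unitmx) -> is_connection U (gamma g).
Proof.
move=> oU sg gs gu; split => //.
- by move=> x v; exact: gamma_linl.
- by move=> x u; exact: gamma_linr.
- by move=> x u v; exact: gamma_sym.
move=> u v; apply: (smooth_on_mx oU) => i0 l.
have sc (c : R) : smooth_on U (fun=> c) by exact: smooth_on_cst.
have sD i j p : smooth_on U (fun x => 'D_(basis_vec R p) (fun y => g y i j) x).
  exact: (smooth_on_derive _ (smooth_on_entry i j oU sg)).
apply: (smooth_on_ext oU (f := fun x => \sum_i \sum_j
  christoffel g l i j x * u 0 i * v 0 j)); first by move=> x _; rewrite mxE.
apply: (smooth_on_sum _ oU) => i _; apply: (smooth_on_sum _ oU) => j _.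
apply: (smooth_onM oU _ (sc _)); apply: (smooth_onM oU _ (sc _)).
apply: (smooth_onM oU (sc _)); apply: (smooth_on_sum _ oU) => s _.
apply: (smooth_onM oU); first exact: (smooth_on_entry _ _ oU (smooth_on_invmx oU gu sg)).
apply: (smooth_onD oU (smooth_onD oU (sD _ _ _) (sD _ _ _))).
apply: (smooth_on_ext oU _ (smooth_onM oU (sc (-1)) (sD i j s))).
by move=> x _; rewrite mulN1r.
Qed.

Lemma divg_slice (R : realType) (n k : nat) (gi : 'I_n -> 'I_n -> 'rV[R]_n -> R)
    (ga : 'I_n -> 'I_n -> 'I_n -> 'rV[R]_n -> R) C
    (F : 'rV[R]_n * R -> 'rV[R]_k) Y x :
  divg (fun i => (basis_vec R i, 0)) (fun i j p => gi i j p.1)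
    (fun i j l p => ga i j l p.1) C F Y (x, 0) =
  divg (@basis_vec R n) gi ga C (fun y => F (y, 0)) (fun i y => Y i (y, 0)) x.
Proof.
apply: eq_bigr => i _; apply: eq_bigr => j _ /=.
by rewrite along_slice.
Qed.

(** * The bitension field of a vector field in one chart *)

Section Biharmonic.
Variables (R : realType) (n : nat).
Local Notation V := 'rV[R]_n.
Local Notation VV := 'rV[R]_(n + n).
Local Notation T := ('rV[R]_n * R)%type.
Variables (U : set V) (g phi : V -> 'M[R]_n) (xi : V -> V) (h : VV -> 'M[R]_(n + n)).
Hypothesis oU : open U.
Hypothesis sg : smooth_on U g.
Hypothesis g_sym : forall x, (g x)^T = g x.
Hypothesis g_unit : forall x, U x -> g x \in unitmx.
Hypothesis sphi : smooth_on U phi.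
Hypothesis phi_parallel : forall x z b, U x ->
  'D_z (fun y => b *m phi y) x + gamma g x z (b *m phi x) = gamma g x z b *m phi x.
Hypothesis phi_adj : forall x u v, U x ->
  inner (g x) (u *m phi x) v = inner (g x) u (v *m phi x).
Hypothesis phi_invol : forall x, U x -> phi x *m phi x = 1%:M.
Hypothesis h_sym : forall z, (h z)^T = h z.
Hypothesis hE : forall z a b, TU U z -> inner (h z) a b =
  inner (g (lsubmx z)) (lsubmx a) (lsubmx b)
  + inner (g (lsubmx z)) (connector (gamma g) z a)
      (connector (gamma g) z b *m phi (lsubmx z)).
Hypothesis sxi : smooth_on U xi.

Let C := gamma g.
Let cC : is_connection U C := gamma_is_connection oU sg g_sym g_unit.
Let g_compat x z u v (Ux : U x) : inner ('D_z g x) u v =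
  inner (g x) (C x z u) v + inner (g x) u (C x z v) :=
  metric_compat g_sym g_unit (fun x Ux => smooth_on_diff sg Ux) z u v Ux.
Let H := gamma h.
Let cH : is_connection (TU U) H := sasaki_is_connection cC sg g_sym g_unit
  g_compat sphi phi_parallel phi_adj phi_invol h_sym hE.

Let psi0 (x : V) : VV := row_mx x (xi x).
Let sid : smooth_on U (fun y : V => y) := smooth_on_id oU.
Let idU y : U y -> U y. Proof. by []. Qed.
Let spsi0 : smooth_on U psi0 := smooth_on_row_mx oU sid sxi.
Let psi0U : forall x, U x -> TU U (psi0 x) := psi_TU xi idU.

Let tau0 := tension g h psi0.
Let sgi0 i j : smooth_on U (inv_metric g i j).
Proof. exact: (smooth_on_entry _ _ oU (smooth_on_invmx oU g_unit sg)). Qed.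
Let sga0 i j l : smooth_on U (gamma_coef g i j l).
Proof. exact: (smooth_on_entry _ _ oU (conn_smooth cC _ _)). Qed.

Let stau0 : smooth_on U tau0.
Proof.
apply: (smooth_on_ext oU (f := divg (@basis_vec R n) (inv_metric g) (gamma_coef g) H psi0
  (fun l => 'D_(basis_vec R l) psi0))).
  by move=> x Ux; rewrite -(tension_divg _ _ spsi0 Ux).
exact: (smooth_divg _ cH oU spsi0 psi0U sgi0 sga0
  (fun l => smooth_on_derive (basis_vec R l) spsi0)).
Qed.

(** [w] is the coordinate component of the tension field along the fibre, needed to write the
    variation down; [W] is its covariant vertical part, which differs from [w] by a Christoffel term
    and is -Delta xi by [DxE]. *)
Let S y := lsubmx (tau0 y).
Let w y := rsubmx (tau0 y).
Let W y := connector C (psi0 y) (tau0 y).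
Let sS : smooth_on U S := smooth_on_lsubmx oU stau0.
Let sw : smooth_on U w := smooth_on_rsubmx oU stau0.
Let sW : smooth_on U W := smooth_connector_psi cC oU sid sxi idU stau0.

(** A straight line in the induced chart of TM, so that the coordinate velocity of [psi] is [tau0]
    for every t, see [dpsi]. *)
Let f (p : T) : V := p.1 + p.2 *: S p.1.
Let u (p : T) : V := xi p.1 + p.2 *: w p.1.
Let t : T := (0, 1).
Let A1 : set T := [set p | U p.1].

Let oA1 : open A1.
Proof.
have -> : A1 = setT `&` (fun p : T => p.1) @^-1` U.
  by apply/seteqP; split => p /=; [move=> ?; split|case].
apply: (open_preimage_on openT oU); exact: (smooth_fst openT).
Qed.

Let sfst m (Y : V -> 'rV[R]_m) : smooth_on U Y -> smooth_on A1 (fun p => Y p.1).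
Proof.
move=> sY; exact: (@smooth_on_comp _ _ _ _ _ A1 U Y (fun p => p.1) oU oA1
  (fun p Ap => Ap) sY (smooth_fst oA1)).
Qed.

Let svar (Y Z : V -> V) : smooth_on U Y -> smooth_on U Z ->
  smooth_on A1 (fun q : T => Y q.1 + q.2 *: Z q.1).
Proof.
move=> sY sZ; apply: (smooth_onD oA1 (sfst sY)).
exact: (smooth_onZ oA1 (smooth_snd oA1) (sfst sZ)).
Qed.

Let dvar (Y Z : V -> V) p : smooth_on U Y -> smooth_on U Z -> A1 p ->
  'D_t (fun q : T => Y q.1 + q.2 *: Z q.1) p = Z p.1.
Proof.
move=> sY sZ Ap.
have sA := smooth_snd oA1.
rewrite derive_addf; last 2 first.
- exact: (smooth_on_derivable (sfst sY) Ap).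
- exact: (smooth_on_derivable (smooth_onZ oA1 sA (sfst sZ)) Ap).
rewrite (derive_scale (smooth_on_derivable sA Ap) (smooth_on_derivable (sfst sZ) Ap)).
rewrite !(derive_fst _ t p) !derive0 scaler0 addr0 add0r.
have -> : 'D_t (fun q : T => q.2) p = 1.
  rewrite -[RHS](@derive_idf R R 1 p.2).
  by apply: (derive_along (fun x : R => x) (L := fun q : T => q.2)).
by rewrite scale1r.
Qed.

(** The base point x + t S(x) may leave the chart. A is the open set of pairs for which it does not;
    it contains U x {0}, where all the results are read off. *)
Let A : set T := A1 `&` f @^-1` U.
Let oA : open A := open_preimage_on oA1 oU (svar sid sS).
Let AA1 : A `<=` A1. Proof. by move=> p []. Qed.
Let sf : smooth_on A f := smooth_on_sub AA1 (svar sid sS).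
Let su : smooth_on A u := smooth_on_sub AA1 (svar sxi sw).
Let fU p : A p -> U (f p). Proof. by case. Qed.
Let A0 x : U x -> A (x, 0).
Proof. by move=> Ux; split => //=; rewrite /f /= scale0r addr0. Qed.

Let f0 : (fun y => f (y, 0)) = (fun y => y).
Proof. by apply/funext => y; rewrite /f /= scale0r addr0. Qed.
Let u0 : (fun y => u (y, 0)) = xi.
Proof. by apply/funext => y; rewrite /u /= scale0r addr0. Qed.

Let e (i : 'I_n) : T := (basis_vec R i, 0).
Let gi i j (p : T) := inv_metric g i j p.1.
Let ga i j l (p : T) := gamma_coef g i j l p.1.

Let sgi i j : smooth_on A (gi i j).
Proof.
apply: (smooth_on_sub AA1).
exact: (@smooth_on_comp1 _ _ _ A1 U (inv_metric g i j) (fun p => p.1) oA1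
  (fun p Ap => Ap) (sgi0 i j) (smooth_fst oA1)).
Qed.
Let sga i j l : smooth_on A (ga i j l).
Proof.
apply: (smooth_on_sub AA1).
exact: (@smooth_on_comp1 _ _ _ A1 U (gamma_coef g i j l) (fun p => p.1) oA1
  (fun p Ap => Ap) (sga0 i j l) (smooth_fst oA1)).
Qed.
Let gi_t i j p : A p -> 'D_t (gi i j) p = 0.
Proof. by move=> _; rewrite (derive_fst (inv_metric g i j) t p) derive0. Qed.
Let ga_t i j l p : A p -> 'D_t (ga i j l) p = 0.
Proof. by move=> _; rewrite (derive_fst (gamma_coef g i j l) t p) derive0. Qed.
Let gi_sym i j p : gi i j p = gi j i p.
Proof. by rewrite /gi /inv_metric -[in RHS](g_sym p.1) -trmx_inv [RHS]mxE. Qed.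

Let psi (p : T) : VV := row_mx (f p) (u p).
Let spsi : smooth_on A psi := smooth_psi oA sf su.
Let psiU : forall p, A p -> TU U (psi p) := psi_TU u fU.

Let psi_slice : (fun y => psi (y, 0)) = psi0.
Proof.
by apply/funext => y; rewrite /psi /f /u /= !scale0r !addr0.
Qed.

Let dpsi p : A p -> 'D_t psi p = tau0 p.1.
Proof.
move=> Ap; rewrite (derive_psi oA sf su t Ap).
rewrite (dvar sid sS (AA1 Ap)) (dvar sxi sw (AA1 Ap)).
exact: hsubmxK.
Qed.

Let along_dpsi k y : U y ->
  along H psi t ('D_(e k) psi) (y, 0) = along H psi0 (basis_vec R k) tau0 y.
Proof.
move=> Uy; rewrite (along_torsion cH oA spsi t (e k) (A0 Uy)) along_slice psi_slice.
by apply: (along_ext H psi0 oU _ Uy) => z Uz; rewrite dpsi//; exact: A0.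
Qed.

Lemma bitension_variation x : U x ->
  bitension g h psi0 x =
  - along H psi t (divg e gi ga H psi (fun k => 'D_(e k) psi)) (x, 0).
Proof.
move=> Ux; have Ax := A0 Ux.
rewrite (bitension_divg cH spsi0 psi0U Ux stau0); congr (- _).
have sD k := smooth_on_derive (e k) spsi.
(* The curvature term that this commutation produces on TM is the one in the bitension field,
   because the velocity of [psi] is the tension field. *)
rewrite (along_divg e cH oA spsi psiU sgi sga gi_t ga_t Ax sD).
rewrite divg_slice psi_slice.
rewrite (divg_ext _ _ _ _ _ oU Ux (fun k y Uy => along_dpsi k Uy)).
congr (_ + _); apply: eq_bigr => i _; apply: eq_bigr => j _ /=.
have psix : psi (x, 0) = psi0 x := congr1 (fun F => F x) psi_slice.
by rewrite psix (dpsi Ax) !derive_slice psi_slice.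
Qed.

Let N (k : 'I_n) (Y : V -> V) : V -> V := along C (fun y => y) (basis_vec R k) Y.
Let divg0 := divg (@basis_vec R n) (inv_metric g) (gamma_coef g) C (fun y : V => y).
Let th := tau_h C phi f u e gi ga.
Let tv := tau_v C f u e gi ga.

Let sN k Y : smooth_on U Y -> smooth_on U (N k Y).
Proof. by move=> sY; exact: (smooth_along cC oU sid idU (basis_vec R k) sY). Qed.

Let tau_map0 y : U y -> tau_map h f u e gi ga (y, 0) = tau0 y.
Proof.
move=> Uy; rewrite /tau_map divg_slice psi_slice /tau0 (tension_divg _ _ spsi0 Uy).
by apply: (divg_ext _ _ _ _ _ oU Uy) => k q _; rewrite derive_slice psi_slice.
Qed.

Let psiy y : psi (y, 0) = psi0 y := congr1 (fun F => F y) psi_slice.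
Let fy y : f (y, 0) = y := congr1 (fun F => F y) f0.
Let uy y : u (y, 0) = xi y := congr1 (fun F => F y) u0.

Let th0 y : U y -> th (y, 0) = S y.
Proof.
move=> Uy; rewrite /S -(tau_map0 Uy); symmetry.
exact: (lsub_tau cC sg g_sym g_unit g_compat sphi phi_parallel phi_adj phi_invol
  h_sym hE oA sf su fU e ga gi_sym (A0 Uy)).
Qed.

Let tv0 y : U y -> tv (y, 0) = W y.
Proof.
move=> Uy; rewrite /W -(tau_map0 Uy) -psiy; symmetry.
exact: (connector_tau cC sg g_sym g_unit g_compat sphi phi_parallel phi_adj phi_invol
  h_sym hE oA sf su fU e ga gi_sym (A0 Uy)).
Qed.

Let ft0 y : U y -> 'D_t f (y, 0) = S y.
Proof. by move=> Uy; rewrite (dvar sid sS (AA1 (A0 Uy))). Qed.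

Let ut0 y : U y -> along C f t u (y, 0) = W y.
Proof.
move=> Uy; have E : connector C (psi (y, 0)) ('D_t psi (y, 0)) =
    along C f t u (y, 0) := connector_dpsi C oA sf su t (A0 Uy).
by rewrite -E psiy (dpsi (A0 Uy)).
Qed.

Let df0 k y : 'D_(e k) f (y, 0) = basis_vec R k.
Proof. by rewrite derive_slice f0 derive_idf. Qed.

Let du0 k y : along C f (e k) u (y, 0) = N k xi y.
Proof. by rewrite along_slice f0 u0. Qed.

Let divg_slice0 (Y : 'I_n -> T -> V) (Y' : 'I_n -> V -> V) x : U x ->
  (forall k y, U y -> Y k (y, 0) = Y' k y) ->
  divg e gi ga C f Y (x, 0) = divg0 Y' x.
Proof.
by move=> Ux YY; rewrite divg_slice f0; exact: (divg_ext _ _ _ _ _ oU Ux YY).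
Qed.

Let along_slice0 (v : V) (Y : T -> V) (Y' : V -> V) x : U x ->
  (forall y, U y -> Y (y, 0) = Y' y) ->
  along C f (v, 0) Y (x, 0) = along C (fun y => y) v Y' x.
Proof.
move=> Ux YY; rewrite along_slice f0; exact: (along_ext C (fun y => y) oU v Ux YY).
Qed.

Lemma S_eq y : U y -> S y =
  trace2 (inv_metric g) (fun i j q => riem C q (xi q *m phi q) (N i xi q) (basis_vec R j)) y.
Proof.
move=> Uy; rewrite -(th0 Uy) /th /tau_h (divg_slice0 Uy (fun k y _ => df0 k y)).
(* The identity map is totally geodesic: the covariant derivative of a coordinate vector is the
   Christoffel combination that [divg] subtracts. *)
have -> : divg0 (fun k _ => basis_vec R k) y = 0.
  rewrite /divg0 /divg /trace2; apply: big1 => i _; apply: big1 => j _.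
  rewrite alongE derive_idf (derive_cst (basis_vec R j)) add0r -(gamma_coefE g i j y).
  by rewrite subrr scaler0.
rewrite add0r; apply: eq_bigr => i _; apply: eq_bigr => j _.
by rewrite /tau_curv fy uy df0 du0.
Qed.

Lemma W_eq y : U y -> W y = divg0 (fun k => N k xi) y.
Proof.
by move=> Uy; rewrite -(tv0 Uy) /tv /tau_v (divg_slice0 Uy (fun k y _ => du0 k y)).
Qed.

Let hor_part x := divg0 (fun k => N k S) x
  + trace2 (inv_metric g) (fun i j q => riem C q (S q) (basis_vec R i) (basis_vec R j)) x
  + trace2 (inv_metric g) (fun i j q =>
      driem C q (S q) (xi q *m phi q) (N i xi q) (basis_vec R j)
      + riem C q (W q *m phi q) (N i xi q) (basis_vec R j)
      + riem C q (xi q *m phi q)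
          (N i W q + riem C q (S q) (basis_vec R i) (xi q)) (basis_vec R j)
      + riem C q (xi q *m phi q) (N i xi q) (N j S q)) x.

Let ver_part x := divg0 (fun k q => N k W q + riem C q (S q) (basis_vec R k) (xi q)) x
  + trace2 (inv_metric g) (fun i j q => riem C q (S q) (basis_vec R i) (N j xi q)) x.

Let along_th x : U x -> along C f t th (x, 0) = hor_part x.
Proof.
move=> Ux; have Ax := A0 Ux.
rewrite (along_tau_h cC sphi oA sf su fU e sgi sga gi_t ga_t Ax).
have E k y : U y -> along C f (e k) ('D_t f) (y, 0) = N k S y.
  by move=> Uy; exact: (along_slice0 _ Uy (fun z Uz => ft0 Uz)).
rewrite (divg_slice0 Ux E) /hor_part; congr (_ + _ + _).
  apply: eq_bigr => i _; apply: eq_bigr => j _.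
  by rewrite fy (ft0 Ux) !df0.
apply: eq_bigr => i _; apply: eq_bigr => j _; congr (_ *: _).
rewrite (along_tau_curv cC sphi phi_parallel oA sf su fU e t i j Ax).
rewrite fy uy (ft0 Ux) !df0 du0 (ut0 Ux) (E j x Ux).
by rewrite (along_slice0 _ Ux (fun z Uz => ut0 Uz)).
Qed.

Let along_tv x : U x -> along C f t tv (x, 0) = ver_part x.
Proof.
move=> Ux; have Ax := A0 Ux.
rewrite (along_tau_v cC oA sf su fU e sgi sga gi_t ga_t Ax).
have E k y : U y -> along C f (e k) (along C f t u) (y, 0)
    + riem C (f (y, 0)) ('D_t f (y, 0)) ('D_(e k) f (y, 0)) (u (y, 0))
    = N k W y + riem C y (S y) (basis_vec R k) (xi y).
  move=> Uy; rewrite fy uy (ft0 Uy) df0.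
  by rewrite (along_slice0 _ Uy (fun z Uz => ut0 Uz)).
rewrite (divg_slice0 Ux E) /ver_part; congr (_ + _).
apply: eq_bigr => i _; apply: eq_bigr => j _.
by rewrite fy (ft0 Ux) df0 du0.
Qed.

Lemma lsub_bitension x : U x -> lsubmx (bitension g h psi0 x) =
  - (hor_part x + riem C x (xi x *m phi x) (W x) (S x)).
Proof.
move=> Ux; rewrite (bitension_variation Ux) (linN (@lsubmx_lin R n)); congr (- _).
rewrite (lsub_along_tau cC sg g_sym g_unit g_compat sphi phi_parallel phi_adj
  phi_invol h_sym hE oA sf su fU e t sgi sga gi_sym (A0 Ux)).
rewrite -/th -/tv (along_th Ux) fy uy (ft0 Ux) (ut0 Ux) (th0 Ux) (tv0 Ux).
congr (_ + _).
(* The horizontal velocity and the horizontal tension are both S, the vertical ones both W, so the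
   two terms with factor 1/2 are equal. *)
have half (v : V) : 2^-1 *: (v + v) = v.
  by apply/rowP => i; rewrite !mxE; move: (v 0 i) => a; lra.
exact: half.
Qed.

Lemma connector_bitension x : U x ->
  connector C (psi0 x) (bitension g h psi0 x) = - ver_part x.
Proof.
move=> Ux; rewrite (bitension_variation Ux) (linN (connector_lin cC _)); congr (- _).
rewrite -psiy.
rewrite (connector_along_tau cC sg g_sym g_unit g_compat sphi phi_parallel phi_adj
  phi_invol h_sym hE oA sf su fU e t sgi sga gi_sym (A0 Ux)).
rewrite -/th -/tv (along_tv Ux) fy uy (ft0 Ux) (th0 Ux).
(* The curvature term of the vertical part pairs the horizontal velocity with the horizontal
   tension, which are the same vector. *)
have r0 : riem C x (S x) (S x) (xi x) = 0.
  have := riem_skew C x (S x) (S x) (xi x); move: (riem _ _ _ _ _) => r /rowP rE.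
  by apply/rowP => i; have := rE i; rewrite !mxE; move: (r 0 i) => a; lra.
by rewrite r0 scaler0 subr0.
Qed.

Let Pxi := endo phi xi.
Let Dx := rough_laplacian g xi.
Let Sf := Sfield phi g xi.
Let E (i : 'I_n) : V -> V := fun=> basis_vec R i.

Let covE i Y : cov g (E i) Y = N i Y.
Proof. by apply/funext => y; exact: cov_along. Qed.

Let sE i : smooth_on U (E i).
Proof. exact: smooth_on_cst. Qed.

Let sPxi : smooth_on U Pxi := smooth_phi cC sphi oU sid idU sxi.

Let SfE y : U y -> Sf y = S y.
Proof.
move=> Uy; rewrite (S_eq Uy); apply: eq_bigr => i _; apply: eq_bigr => j _.
by rewrite -/(E i) covE (curv_riem cC Uy sPxi (sN i sxi) (sE j)).
Qed.

Let DxE y : U y -> Dx y = - W y.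
Proof. by move=> Uy; rewrite /Dx (rough_laplacian_divg cC Uy sxi) (W_eq Uy). Qed.

Let sSf : smooth_on U Sf.
Proof. by apply: (smooth_on_ext oU _ sS) => y Uy; rewrite SfE. Qed.

Let sDx : smooth_on U Dx.
Proof. by apply: (smooth_on_ext oU _ (smooth_onN oU sW)) => y Uy; rewrite DxE. Qed.

Let NSf k y : U y -> N k Sf y = N k S y.
Proof. by move=> Uy; exact: (along_ext C (fun y => y) oU _ Uy SfE). Qed.

Let NDx k y : U y -> N k Dx y = - N k W y.
Proof.
move=> Uy; rewrite -(alongN cC (fun y => y) _ Uy sW).
exact: (along_ext C (fun y => y) oU _ Uy DxE).
Qed.

Lemma first_expr_eq x : U x ->
  first_expr phi g xi x = - (hor_part x + riem C x (xi x *m phi x) (W x) (S x)).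
Proof.
move=> Ux.
have sPDx : smooth_on U (endo phi Dx) := smooth_phi cC sphi oU sid idU sDx.
have sRE i := smooth_curv cC (sE i) sSf sxi.
transitivity (rough_laplacian g Sf x + curv g Pxi Dx Sf x
  - trace2 (inv_metric g) (fun i j q => curv g Sf (E i) (E j) q
      + cov_curv g Sf Pxi (cov g (E i) xi) (E j) q
      + curv g Pxi (cov g (E i) xi) (cov g (E j) Sf) q
      - curv g Pxi (curv g (E i) Sf xi) (E j) q
      - curv g Pxi (cov g (E i) Dx) (E j) q
      - curv g (endo phi Dx) (cov g (E i) xi) (E j) q) x); first by [].
rewrite (rough_laplacian_divg cC Ux sSf) (curv_riem cC Ux sPxi sDx sSf).
have -> : divg (@basis_vec R n) (inv_metric g) (gamma_coef g) C (fun y => y)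
    (fun k => along C (fun y => y) (basis_vec R k) Sf) x = divg0 (fun k => N k S) x.
  exact: (divg_ext _ _ _ _ _ oU Ux (fun k y Uy => NSf k Uy)).
rewrite (DxE Ux) (SfE Ux) (linN (riem_lin2 cC _ _ Ux)) /hor_part.
set D0 := divg0 _ _; set Q := riem _ _ _ _ _.
set T1 := trace2 _ _ _; set T2 := trace2 _ _ _; set T3 := trace2 _ _ _.
(* The Laplacian of S and the term outside the trace already agree, by Delta xi = -W; what is left
   is an identity of integrands. *)
suff -> : T1 = T2 + T3.
  have zs (d q a b : V) : - d - q - (a + b) = - (d + a + b + q) by mxring.
  exact: zs.
rewrite /T1 /T2 /T3 -trace2D; apply: eq_bigr => i _; apply: eq_bigr => j _.
congr (_ *: _); rewrite !covE.
rewrite (curv_riem cC Ux sSf (sE i) (sE j)).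
rewrite (cov_curv_driem cC Ux sSf sPxi (sN i sxi) (sE j)).
rewrite (curv_riem cC Ux sPxi (sN i sxi) (sN j sSf)).
rewrite (curv_riem cC Ux sPxi (sRE i) (sE j)).
rewrite (curv_riem cC Ux sPxi (sN i sDx) (sE j)).
rewrite (curv_riem cC Ux sPDx (sN i sxi) (sE j)).
rewrite (curv_riem cC Ux (sE i) sSf sxi).
rewrite (SfE Ux) (NSf j Ux) (NDx i Ux) /endo (DxE Ux) mulNmx.
(* The last three terms of the trace carry a minus sign in [first_expr]. It is absorbed by R(e_i, S)
   = -R(S, e_i) in the first of them and by Delta xi = -W in the other two. *)
rewrite (riem_skew C x (E i x)) !(linN (riem_lin2 cC _ _ Ux)).
rewrite (linN (riem_lin1 cC _ _ Ux)) (linD (riem_lin2 cC _ _ Ux)) !opprK.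
have zsum (a b c d k l : V) : a + b + c + d + k + l = a + (b + l + (k + d) + c).
  by mxring.
exact: zsum.
Qed.

(** The divergence of the one-form e_k -> R(S, e_k) xi by the Leibniz rule; the derivative of the
    coordinate vector e_j cancels the Christoffel correction contained in [divg]. *)
Let divg0D x : U x ->
  divg0 (fun k q => N k W q + riem C q (S q) (basis_vec R k) (xi q)) x =
  divg0 (fun k => N k W) x
  + trace2 (inv_metric g) (fun i j q => driem C q (basis_vec R i) (S q) (basis_vec R j) (xi q)
      + riem C q (N i S q) (basis_vec R j) (xi q)
      + riem C q (S q) (basis_vec R j) (N i xi q)) x.
Proof.
move=> Ux; rewrite /divg0 /divg -trace2D; apply: trace2_ext => i j.
have sr := smooth_riem cC oU sid idU sS (sE j) sxi.
rewrite (alongD cC (fun y => y) _ Ux (sN j sW) sr).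
rewrite (along_riem cC oU sid idU (basis_vec R i) Ux sS (sE j) sxi) derive_idf.
have aE : along C (fun y => y) (basis_vec R i) (E j) x =
    \sum_l gamma_coef g i j l x *: basis_vec R l.
  by rewrite alongE derive_idf derive_cst add0r; exact: gamma_coefE.
have -> : \sum_l gamma_coef g i j l x *: (N l W x + riem C x (S x) (basis_vec R l) (xi x)) =
    \sum_l gamma_coef g i j l x *: N l W x
    + riem C x (S x) (along C (fun y => y) (basis_vec R i) (E j) x) (xi x).
  rewrite aE (lin_sum (riem_lin2 cC _ _ Ux)) -big_split; apply: eq_bigr => l _.
  by rewrite (linZ (riem_lin2 cC _ _ Ux)) scalerDr.
have zs (a b c d k l : V) : a + (b + c + d + k) - (l + d) = a - l + (b + c + k).
  by mxring.
exact: zs.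
Qed.

(** The factor 2 has two sources: [c] arises when the variation is commuted with the divergence, and
    again, with i and j exchanged, when R(S, e_k) xi is differentiated by that divergence. *)
Lemma second_expr_eq x : U x -> second_expr phi g xi x = ver_part x.
Proof.
move=> Ux.
transitivity (rough_laplacian g Dx x
  - trace2 (inv_metric g) (fun i j q => cov_curv g (E i) (E j) Sf xi q
      + curv g (E i) (cov g (E j) Sf) xi q
      + curv g (E i) Sf (cov g (E j) xi) q *+ 2) x); first by [].
rewrite (rough_laplacian_divg cC Ux sDx) /ver_part (divg0D Ux).
have gs i j : inv_metric g i j x = inv_metric g j i x := gi_sym i j (x, 0).
have -> : divg (@basis_vec R n) (inv_metric g) (gamma_coef g) C (fun y => y)
    (fun k => along C (fun y => y) (basis_vec R k) Dx) x =
    - divg0 (fun k => N k W) x.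
  rewrite (divg_ext _ _ _ _ _ oU Ux (fun k y Uy => NDx k Uy)) /divg0 /divg -trace2N.
  apply: trace2_ext => i j.
  rewrite (alongN cC (fun y => y) _ Ux (sN j sW)) opprB [RHS]addrC; congr (_ + _).
  by rewrite -sumrN; apply: eq_bigr => l _; rewrite scalerN opprK.
rewrite opprK -addrA; congr (_ + _).
pose a i j q := driem C q (E i q) (S q) (E j q) (xi q).
pose b i j q := riem C q (N j S q) (E i q) (xi q).
pose c i j q := riem C q (S q) (E i q) (N j xi q).
have -> : trace2 (inv_metric g) (fun i j q => cov_curv g (E i) (E j) Sf xi q
      + curv g (E i) (cov g (E j) Sf) xi q
      + curv g (E i) Sf (cov g (E j) xi) q *+ 2) x =
    trace2 (inv_metric g) (fun i j q => - (a i j q + b i j q + c i j q + c i j q)) x.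
  apply: trace2_ext => i j.
  rewrite !covE (cov_curv_driem cC Ux (sE i) (sE j) sSf sxi).
  rewrite (curv_riem cC Ux (sE i) (sN j sSf) sxi).
  rewrite (curv_riem cC Ux (sE i) sSf (sN j sxi)) (SfE Ux) (NSf j Ux).
  rewrite (driem_skew cC (E i x) (E j x) (S x) (xi x) Ux).
  rewrite (riem_skew C x (E i x) (N j S x)) (riem_skew C x (E i x) (S x)).
  have zs (k l m : V) : - k + - l + (- m) *+ 2 = - (k + l + m + m).
    by rewrite mulr2n; mxring.
  exact: zs.
rewrite trace2N opprK.
have -> : trace2 (inv_metric g) (fun i j q =>
      driem C q (basis_vec R i) (S q) (basis_vec R j) (xi q)
      + riem C q (N i S q) (basis_vec R j) (xi q)
      + riem C q (S q) (basis_vec R j) (N i xi q)) x =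
    trace2 (inv_metric g) a x + trace2 (inv_metric g) b x + trace2 (inv_metric g) c x.
  (* The divergence yields [b] and [c] with the indices in the other order, which the symmetric
     trace does not see. *)
  rewrite -(trace2_tr b gs) -(trace2_tr c gs).
  by rewrite -(trace2D _ a (fun i j => b j i)) -(trace2D _ _ (fun i j => c j i)).
rewrite (trace2D _ (fun i j q => a i j q + b i j q + c i j q) c).
rewrite (trace2D _ (fun i j q => a i j q + b i j q) c) (trace2D _ a b).
by [].
Qed.

Lemma bitension_eq0 x : U x ->
  bitension g h psi0 x = 0 <->
  first_expr phi g xi x = 0 /\ second_expr phi g xi x = 0.
Proof.
move=> Ux; have := lsub_bitension Ux; rewrite -(first_expr_eq Ux).
have := connector_bitension Ux; rewrite -(second_expr_eq Ux).
move: (bitension _ _ _ _) (first_expr _ _ _ _) (second_expr _ _ _ _) => b f1 f2.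
rewrite connectorE row_mxKl row_mxKr => B2 B1; split.
  move=> b0; move: B1 B2; rewrite b0 !linear0 (lin0 (conn_linl cC _ _)) addr0.
  by move=> <- /eqP; rewrite eq_sym oppr_eq0 => /eqP.
move=> [f10 f20]; move: B2; rewrite B1 f10 f20 oppr0 (lin0 (conn_linl cC _ _)) addr0.
by move=> b0; rewrite -[b]hsubmxK B1 f10 b0 row_mx0.
Qed.

Lemma smooth_tension_section : smooth_on U tau0.
Proof. exact: stau0. Qed.

Lemma sasaki_connection : is_connection (TU U) H.
Proof. exact: cH. Qed.

End Biharmonic.

(** * Naturality under isometries *)

Section ChangeOfChart.
Variables (R : realType) (n k : nat).
Local Notation V := 'rV[R]_n.
Local Notation W := 'rV[R]_k.
Variables (A B : set V) (t : V -> V) (ga gb : V -> 'M[R]_n).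
Hypothesis oA : open A.
Hypothesis oB : open B.
Hypothesis st : smooth_on A t.
Hypothesis tB : forall x, A x -> B (t x).
Hypothesis sga : smooth_on A ga.
Hypothesis ga_sym : forall x, (ga x)^T = ga x.
Hypothesis ga_unit : forall x, A x -> ga x \in unitmx.
Hypothesis sgb : smooth_on B gb.
Hypothesis gb_sym : forall x, (gb x)^T = gb x.
Hypothesis gb_unit : forall x, B x -> gb x \in unitmx.
Hypothesis isom : forall x u v, A x ->
  inner (ga x) u v = inner (gb (t x)) ('D_u t x) ('D_v t x).

Let cB : is_connection B (gamma gb) := gamma_is_connection oB sgb gb_sym gb_unit.
Let J x := jacobian t x.

Let dt x v : A x -> 'D_v t x = v *m J x.
Proof. by move=> Ax; apply: deriveEjacobian; exact: smooth_on_diff st Ax. Qed.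

Let gaJ x : A x -> ga x = J x *m gb (t x) *m (J x)^T.
Proof.
move=> Ax; apply/matrixP => i j; rewrite -[LHS]inner_basis isom// !dt//.
by rewrite -[RHS]inner_basis /inner trmx_mul !mulmxA.
Qed.

Let J_unit x : A x -> J x \in unitmx.
Proof.
move=> Ax; have := ga_unit Ax; rewrite gaJ// !unitmx_mul => /andP[/andP[]].
by [].
Qed.

Let ga_inv x : A x -> (J x)^T *m invmx (ga x) *m J x = invmx (gb (t x)).
Proof.
move=> Ax; have Ju := J_unit Ax; have JTu : (J x)^T \in unitmx by rewrite unitmx_tr.
have gbu := gb_unit (tB Ax).
have E : (J x)^T *m invmx (ga x) *m J x *m gb (t x) = 1%:M.
  have : ga x *m invmx (ga x) = 1%:M by rewrite mulmxV// ga_unit.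
  move=> /mulmx1C; rewrite {2}gaJ// => E.
  have E2 : invmx (ga x) *m (J x *m gb (t x)) *m (J x)^T = 1%:M.
    by rewrite -[RHS]E !mulmxA.
  by move: E2 => /mulmx1C; rewrite !mulmxA.
by rewrite -[LHS](mulmxK gbu) E mul1mx.
Qed.

(** The inverse metric is carried by the Jacobian J of the isometry: J^T ga^-1 J = gb^-1, which is
    [ga_inv]. *)
Lemma trace_pullback (b : V -> V -> W) x : A x ->
  (forall v, linear (b ^~ v)) -> (forall u, linear (b u)) ->
  \sum_i \sum_j invmx (ga x) i j *: b ('D_(basis_vec R i) t x) ('D_(basis_vec R j) t x) =
  \sum_i \sum_j invmx (gb (t x)) i j *: b (basis_vec R i) (basis_vec R j).
Proof.
move=> Ax l1 l2.
have bE i j : b ('D_(basis_vec R i) t x) ('D_(basis_vec R j) t x) =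
    \sum_p \sum_q (J x i p * J x j q) *: b (basis_vec R p) (basis_vec R q).
  rewrite !dt// (lin_basis _ (l1 _)); apply: eq_bigr => p _.
  rewrite (lin_basis _ (l2 _)) scaler_sumr; apply: eq_bigr => q _.
  by rewrite scalerA /basis_vec -!rowE !mxE.
transitivity (\sum_i \sum_j \sum_p \sum_q
    (invmx (ga x) i j * (J x i p * J x j q)) *: b (basis_vec R p) (basis_vec R q)).
  apply: eq_bigr => i _; apply: eq_bigr => j _; rewrite bE scaler_sumr.
  by apply: eq_bigr => p _; rewrite scaler_sumr; apply: eq_bigr => q _; rewrite scalerA.
transitivity (\sum_p \sum_q \sum_i \sum_j
    (invmx (ga x) i j * (J x i p * J x j q)) *: b (basis_vec R p) (basis_vec R q)).
  transitivity (\sum_i \sum_p \sum_q \sum_j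
      (invmx (ga x) i j * (J x i p * J x j q)) *: b (basis_vec R p) (basis_vec R q)).
    apply: eq_bigr => i _; rewrite exchange_big; apply: eq_bigr => p _.
    by rewrite exchange_big.
  by rewrite exchange_big; apply: eq_bigr => p _; rewrite exchange_big.
apply: eq_bigr => p _; apply: eq_bigr => q _.
rewrite -(ga_inv Ax) !mxE scaler_suml exchange_big; apply: eq_bigr => j _.
have -> : ((J x)^T *m invmx (ga x)) p j = \sum_i J x i p * invmx (ga x) i j.
  by rewrite mxE; apply: eq_bigr => i _; rewrite mxE.
rewrite mulr_suml scaler_suml; apply: eq_bigr => i _.
by congr (_ *: _); rewrite mulrA [_ * J x i p]mulrC.
Qed.

Let hs x (u v : V) : V := along (gamma gb) t u (fun q => 'D_v t q) x.

(** The transformation law of Christoffel symbols. Differentiating the isometry condition expresses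
    the derivative of [ga] by [hs], which is symmetric by absence of torsion; so [hs] brought back
    by the inverse Jacobian satisfies Koszul's formula for [ga]. *)
Lemma gamma_pullback x u v : A x -> 'D_(gamma ga x u v) t x = hs x u v.
Proof.
move=> Ax; have Ju := J_unit Ax.
have hsym p q : hs x p q = hs x q p := along_torsion cB oA st p q Ax.
have dga z p q : inner ('D_z ga x) p q =
    inner (gb (t x)) (hs x z p) ('D_q t x) + inner (gb (t x)) ('D_p t x) (hs x z q).
  have sc (c : V) : smooth_on A (fun=> c) by exact: smooth_on_cst.
  have := derive_inner oA z Ax sga (sc p) (sc q).
  rewrite !derive_cst inner0l inner0r !addr0 => <-.
  rewrite (derive_ext z oA (fun y Ay => isom p q Ay) Ax).
  have gbc y z' a b (By : B y) := metric_compat gb_sym gb_unit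
    (fun x Bx => smooth_on_diff sgb Bx) z' a b By.
  exact: (derive_inner_along cB sgb gbc oA st tB z Ax
    (smooth_on_derive p st) (smooth_on_derive q st)).
have -> : gamma ga x u v = hs x u v *m invmx (J x).
  apply: (levi_civita_unique (B := fun u v => hs x u v *m invmx (J x)) ga_sym ga_unit
    (fun x Ax => smooth_on_diff sga Ax) Ax) => w.
  rewrite !dga isom// [in LHS]dt// mulmxKV//.
  rewrite (hsym v u) (hsym w u) (hsym w v).
  have s p q : inner (gb (t x)) p q = inner (gb (t x)) q p.
    by rewrite -inner_tr gb_sym.
  rewrite (s ('D_v t x)) (s ('D_u t x) (hs x v w)).
  have l3 (a b c : R) : a = 2^-1 * (a + b + (a + c) - (b + c)) by lra.
  exact: l3.
by rewrite dt// mulmxKV.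
Qed.

Variables (TW : set W) (H : W -> W -> W -> W) (psi psi' : V -> W).
Hypothesis cH : is_connection TW H.
Hypothesis spsi : smooth_on B psi.
Hypothesis psiE : forall x, A x -> psi' x = psi (t x).

Lemma derive_pullback m (Y Y' : V -> 'rV[R]_m) v x : A x -> smooth_on B Y ->
  (forall y, A y -> Y' y = Y (t y)) -> 'D_v Y' x = 'D_('D_v t x) Y (t x).
Proof.
move=> Ax sY YE; rewrite (derive_ext v oA YE Ax); apply: derive_chain.
  exact: smooth_on_diff st Ax.
exact: smooth_on_diff sY (tB Ax).
Qed.

Lemma along_pullback (Y Y' : V -> W) v x : A x -> smooth_on B Y ->
  (forall y, A y -> Y' y = Y (t y)) ->
  along H psi' v Y' x = along H psi ('D_v t x) Y (t x).
Proof.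
move=> Ax sY YE; rewrite !alongE psiE// (derive_pullback v Ax sY YE).
by rewrite (derive_pullback v Ax spsi psiE) YE.
Qed.

(** Z is a one-form with values along psi, and the two sides are its covariant derivative read in
    two charts. The second derivative of t, contained in the first term, cancels against the one
    that [gamma_pullback] yields. *)
Lemma oneform_pullback (Z Z' : V -> V -> W) x v w : A x ->
  (forall y, B y -> linear (Z y)) -> (forall c, smooth_on B (Z ^~ c)) ->
  (forall y c, A y -> Z' y c = Z (t y) ('D_c t y)) ->
  along H psi' v (Z' ^~ w) x - Z' x (gamma ga x v w) =
  along H psi ('D_v t x) (Z ^~ ('D_w t x)) (t x)
  - Z (t x) (gamma gb (t x) ('D_v t x) ('D_w t x)).
Proof.
move=> Ax lZ sZ ZE.
have lZx := lZ _ (tB Ax).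
have sZt c : smooth_on A (fun q => Z (t q) c).
  exact: (@smooth_on_comp _ _ _ _ _ A B (Z ^~ c) t oB oA tB (sZ c) st).
rewrite !alongE psiE// (derive_pullback v Ax spsi psiE) !ZE// gamma_pullback//.
rewrite (derive_ext v oA (fun y Ay => ZE y w Ay) Ax).
rewrite (derive_app_on oA v Ax (F := fun q c => Z (t q) c)
  (fun y Ay => lZ _ (tB Ay)) sZt (smooth_on_derive w st)).
have -> := @derive_chain _ _ _ _ (Z ^~ ('D_w t x)) t v x
  (smooth_on_diff st Ax) (smooth_on_diff (sZ _) (tB Ax)).
rewrite /hs alongE (linD lZx).
have zs (a b c d : W) : a + b + c - (b + d) = a + c - d by mxring.
exact: zs.
Qed.

(** The tension field is such a trace with Z the differential of psi, and the rough Laplacian is, up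
    to sign, one with Z the covariant derivative of the tension field. Naturality of both follows
    from this one statement. *)
Lemma oneform_trace_pullback (Z Z' : V -> V -> W) x : A x ->
  (forall y, B y -> linear (Z y)) -> (forall c, smooth_on B (Z ^~ c)) ->
  (forall y c, A y -> Z' y c = Z (t y) ('D_c t y)) ->
  \sum_i \sum_j invmx (ga x) i j *:
    (along H psi' (basis_vec R i) (Z' ^~ (basis_vec R j)) x
     - Z' x (gamma ga x (basis_vec R i) (basis_vec R j))) =
  \sum_i \sum_j invmx (gb (t x)) i j *:
    (along H psi (basis_vec R i) (Z ^~ (basis_vec R j)) (t x)
     - Z (t x) (gamma gb (t x) (basis_vec R i) (basis_vec R j))).
Proof.
move=> Ax lZ sZ ZE; have Bt := tB Ax; have lZx := lZ _ Bt.
pose b v w := along H psi v (Z ^~ w) (t x) - Z (t x) (gamma gb (t x) v w).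
transitivity (\sum_i \sum_j invmx (ga x) i j *:
    b ('D_(basis_vec R i) t x) ('D_(basis_vec R j) t x)).
  apply: eq_bigr => i _; apply: eq_bigr => j _.
  by rewrite (oneform_pullback _ _ Ax lZ sZ ZE).
apply: (trace_pullback Ax) => [w c v v'|v c w w']; rewrite /b.
  rewrite (along_lin cH spsi Bt (sZ w) c v v') (gamma_linl gb (t x) w c v v').
  by rewrite (lZx c) /= scalerBr addrACA opprD.
rewrite (gamma_linr gb (t x) v c w w') (lZx c) /=.
have sc : smooth_on B (fun=> c) by exact: smooth_on_cst.
rewrite (along_ext H psi oB v Bt (fun y By => lZ y By c w w')).
rewrite (alongD cH psi v Bt (smooth_onZ oB sc (sZ w)) (sZ w')).
rewrite (alongZ cH psi v Bt sc (sZ w)) derive_cst scale0r add0r.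
by rewrite scalerBr addrACA opprD.
Qed.

End ChangeOfChart.

Section BitensionPullback.
Variables (R : realType) (n k : nat).
Local Notation V := 'rV[R]_n.
Local Notation W := 'rV[R]_k.
Variables (A B : set V) (t : V -> V) (ga gb : V -> 'M[R]_n).
Hypothesis oA : open A.
Hypothesis oB : open B.
Hypothesis st : smooth_on A t.
Hypothesis tB : forall x, A x -> B (t x).
Hypothesis sga : smooth_on A ga.
Hypothesis ga_sym : forall x, (ga x)^T = ga x.
Hypothesis ga_unit : forall x, A x -> ga x \in unitmx.
Hypothesis sgb : smooth_on B gb.
Hypothesis gb_sym : forall x, (gb x)^T = gb x.
Hypothesis gb_unit : forall x, B x -> gb x \in unitmx.
Hypothesis isom : forall x u v, A x ->
  inner (ga x) u v = inner (gb (t x)) ('D_u t x) ('D_v t x).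
Variables (TW : set W) (h : W -> 'M[R]_k) (psi psi' : V -> W).
Hypothesis cH : is_connection TW (gamma h).
Hypothesis spsi : smooth_on B psi.
Hypothesis psiW : forall y, B y -> TW (psi y).
Hypothesis psiE : forall x, A x -> psi' x = psi (t x).
Hypothesis stau : smooth_on B (tension gb h psi).

Lemma tension_oneform (g : V -> 'M[R]_n) (f : V -> W) x : tension g h f x =
  \sum_i \sum_j invmx (g x) i j *:
    (along (gamma h) f (basis_vec R i) (fun q => 'D_(basis_vec R j) f q) x
     - 'D_(gamma g x (basis_vec R i) (basis_vec R j)) f x).
Proof.
apply: eq_bigr => i _; apply: eq_bigr => j _.
apply: (congr1 (fun v => invmx (g x) i j *: v)).
by rewrite [LHS]/(_ - _) pull_cov_along /dmap cov_basis.
Qed.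

Lemma pull_rough_laplacian_oneform (g : V -> 'M[R]_n) (f Y : V -> W) x :
  pull_rough_laplacian g h f Y x =
  - \sum_i \sum_j invmx (g x) i j *:
    (along (gamma h) f (basis_vec R i) (along (gamma h) f (basis_vec R j) Y) x
     - along (gamma h) f (gamma g x (basis_vec R i) (basis_vec R j)) Y x).
Proof.
rewrite /pull_rough_laplacian [LHS]/(- _); apply: (congr1 -%R).
apply: eq_bigr => i _; apply: eq_bigr => j _.
apply: (congr1 (fun v => invmx (g x) i j *: v)).
have -> : pull_cov h f (fun=> basis_vec R j) Y = along (gamma h) f (basis_vec R j) Y.
  apply/funext => y; exact: pull_cov_along.
by rewrite [LHS]/(_ - _) !pull_cov_along cov_basis.
Qed.

Let sD c : smooth_on B (fun q => 'D_c psi q). Proof. exact: smooth_on_derive. Qed.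

Lemma tension_pullback x : A x -> tension ga h psi' x = tension gb h psi (t x).
Proof.
move=> Ax; rewrite !tension_oneform.
apply: (oneform_trace_pullback oA oB st tB sga ga_sym ga_unit sgb gb_sym gb_unit isom
  cH spsi psiE (Z := fun q c => 'D_c psi q) (Z' := fun q c => 'D_c psi' q) Ax).
- by move=> y By; exact: (derive_lin (smooth_on_diff spsi By)).
- exact: sD.
by move=> y c Ay; exact: (derive_pullback oA st tB c Ay spsi psiE).
Qed.

Lemma bitension_pullback x : A x -> bitension ga h psi' x = bitension gb h psi (t x).
Proof.
move=> Ax; have Bt := tB Ax.
transitivity (pull_rough_laplacian ga h psi' (tension ga h psi') x
  - \sum_i \sum_j invmx (ga x) i j *: curv_at h (psi' x) (tension ga h psi' x)
      ('D_(basis_vec R i) psi' x) ('D_(basis_vec R j) psi' x)); first by [].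
transitivity (pull_rough_laplacian gb h psi (tension gb h psi) (t x)
  - \sum_i \sum_j invmx (gb (t x)) i j *: curv_at h (psi (t x)) (tension gb h psi (t x))
      ('D_(basis_vec R i) psi (t x)) ('D_(basis_vec R j) psi (t x))); last by [].
have -> : pull_rough_laplacian ga h psi' (tension ga h psi') x =
    pull_rough_laplacian gb h psi (tension gb h psi) (t x).
  rewrite (pull_rough_laplacian_oneform ga) (pull_rough_laplacian_oneform gb).
  apply: (congr1 -%R).
  apply: (oneform_trace_pullback oA oB st tB sga ga_sym ga_unit sgb gb_sym gb_unit isom
    cH spsi psiE (Z := fun q c => along (gamma h) psi c (tension gb h psi) q)
    (Z' := fun q c => along (gamma h) psi' c (tension ga h psi') q) Ax).
  - by move=> y By; exact: (along_lin cH spsi By stau).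
  - by move=> c; exact: (smooth_along cH oB spsi psiW c stau).
  move=> y c Ay.
  exact: (along_pullback oA st tB (gamma h) spsi psiE c Ay stau tension_pullback).
apply: (congr1 (fun v => _ - v)).
pose b v w := riem (gamma h) (psi (t x)) (tension gb h psi (t x))
  ('D_v psi (t x)) ('D_w psi (t x)).
have lD := derive_lin (smooth_on_diff spsi Bt).
have lb1 w : linear (b ^~ w).
  by move=> c v v'; rewrite /b (lD c v v'); exact: (riem_lin2 cH _ _ (psiW Bt)).
have lb2 v : linear (b v).
  by move=> c w w'; rewrite /b (lD c w w'); exact: (riem_lin3 cH _ _ (psiW Bt)).
transitivity (\sum_i \sum_j invmx (ga x) i j *:
    b ('D_(basis_vec R i) t x) ('D_(basis_vec R j) t x)).
  apply: eq_bigr => i _; apply: eq_bigr => j _.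
  apply: (congr1 (fun v => invmx (ga x) i j *: v)).
  rewrite psiE// (curv_at_riem cH _ _ _ (psiW Bt)) tension_pullback//.
  by rewrite !(derive_pullback oA st tB _ Ax spsi psiE).
rewrite (trace_pullback st tB ga_unit gb_unit isom (b := b) Ax lb1 lb2).
apply: eq_bigr => i _; apply: eq_bigr => j _.
by rewrite (curv_at_riem cH _ _ _ (psiW Bt)).
Qed.

End BitensionPullback.

(** * Charts *)

Local Notation coord := Defs.coord.

Section Charts.
Variables (R : realType) (n : nat) (M : charted R n).
Hypothesis manM : is_manifold M.

Lemma in_chartE (W : zmodType) (a : chart M) (F : M -> W) p :
  dom a p -> in_chart a F (coord a p) = F p.
Proof.
move=> ap; rewrite /in_chart; case: pselect => [e|]; last by case; exists p.
by case: (cid e) => q [aq /= E]; rewrite (coord_inj manM aq ap E).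
Qed.

Lemma in_chart_out (W : zmodType) (a : chart M) (F : M -> W) x :
  ~ (coord a @` dom a) x -> in_chart a F x = 0.
Proof.
move=> ax; rewrite /in_chart; case: pselect => // -[p [ap E]].
by case: ax; exists p.
Qed.

Lemma chart_image_open (a : chart M) : open (coord a @` dom a).
Proof. by have := @overlap_open _ _ _ manM a a; rewrite setIid. Qed.

Lemma transitionE (a b : chart M) p : dom a p -> transition a b (coord a p) = coord b p.
Proof. exact: in_chartE. Qed.

Lemma derive_transition (a b : chart M) p v : dom a p -> dom b p ->
  'D_v (transition a b) (coord a p) = v *m jac a b p.
Proof.
move=> ap bp; apply: deriveEjacobian.
by apply: (smooth_on_diff (@transition_smooth _ _ _ manM a b)); exists p.
Qed.

Lemma jac_refl (a : chart M) p : dom a p -> jac a a p = 1%:M.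
Proof.
move=> ap; apply/row_matrixP => i; rewrite !rowE mulmx1 -derive_transition//.
have E y : (coord a @` dom a) y -> transition a a y = y.
  by move=> [q aq <-]; exact: transitionE.
have ap' : (coord a @` dom a) (coord a p) by exists p.
by rewrite (derive_ext _ (@chart_image_open a) E ap') derive_idf.
Qed.

(** The chain rule on an open set around p where b meets both a and c. A coordinate in it comes with
    a point of each overlap; the two points agree because the chart b is injective. *)
Lemma jac_cocycle (b a c : chart M) p : dom b p -> dom a p -> dom c p ->
  jac b c p = jac b a p *m jac a c p.
Proof.
move=> bp ap cp; apply/row_matrixP => i; rewrite !rowE mulmxA.
set v := delta_mx 0 i.
apply: etrans (esym (derive_transition v bp cp)) _.
apply: etrans _ (derive_transition (v *m jac b a p) ap cp).
rewrite -(derive_transition v bp ap).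
pose O := coord b @` (dom b `&` dom a) `&` coord b @` (dom b `&` dom c).
have oO : open O by apply: openI; exact: (overlap_open manM).
have Op : O (coord b p) by split; exists p.
have E y : O y -> transition b c y = transition a c (transition b a y).
  move=> [[q [bq aq] <-] [q' [bq' cq'] E]].
  have qq' := coord_inj manM bq' bq E.
  have cq : dom c q by rewrite -qq'.
  by rewrite (transitionE c bq) (transitionE a bq) (transitionE c aq).
rewrite (derive_ext v oO E Op) -(transitionE a bp).
apply: derive_chain.
  by apply: (smooth_on_diff (@transition_smooth _ _ _ manM b a)); exists p.
rewrite (transitionE a bp).
by apply: (smooth_on_diff (@transition_smooth _ _ _ manM a c)); exists p.
Qed.

(** Any components in one chart extend to the others by the Jacobians, consistently by the cocycle
    identity. So the induced chart of TM is onto U x R^n. *)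
Lemma tangent_of_components (b : chart M) p (y : 'rV[R]_n) : dom b p ->
  exists v : tangent p, sval v b = y.
Proof.
move=> bp.
pose v (c : chart M) := if pselect (dom c p) is left _ then y *m jac b c p else 0.
have vE c : dom c p -> v c = y *m jac b c p by rewrite /v; case: pselect.
have tv : is_tangent p v.
  split; last by move=> c; rewrite /v; case: pselect.
  move=> a c ap cp; rewrite (vE c cp) (vE a ap) -mulmxA.
  exact: (congr1 (mulmx y) (jac_cocycle bp ap cp)).
by exists (exist _ v tv); rewrite /= vE// jac_refl// mulmx1.
Qed.

(** Injectivity of the induced charts of TM: the base points agree by injectivity of the chart of M,
    and the components in one chart fix the whole family, its values at charts away from the point
    being 0. *)
Lemma in_chartTE (W : zmodType) (b : chart M) (F : tangent_bundle M -> W)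
    (q : tangent_bundle M) : dom b (projT1 q) ->
  in_chart (b : chart (tangent_bundle M)) F
    (row_mx (coord b (projT1 q)) (sval (projT2 q) b)) = F q.
Proof.
move=> bq; rewrite /in_chart; case: pselect => [e|]; last by case; exists q.
case: (cid e) => q' [bq' /= E]; congr F.
have [E1 E2] := eq_row_mx E.
case: q q' bq bq' E E1 E2 {e} => [p [v tv]] [p' [v' tv']] /= bp bp' _ E1 E2.
have pp' := coord_inj manM bp' bp E1; subst p'.
congr existT; apply: eq_exist; apply/funext => c.
case: (pselect (dom c p)) => cp; last by rewrite (tv.2 c cp) (tv'.2 c cp).
by rewrite (tv.1 b c bp cp) (tv'.1 b c bp cp) E2.
Qed.

(** Outside the chart the default value 0 is symmetric too, so that the symmetry holds at all
    points, as the results on connections assume. *)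
Lemma local_mx_sym (t : mx_field M) (a : chart M) x :
  (forall p, dom a p -> (t p a)^T = t p a) -> (local_mx t a x)^T = local_mx t a x.
Proof.
move=> ts; rewrite /local_mx; case: (pselect ((coord a @` dom a) x)) => [[p ap <-]|ax].
  by rewrite in_chartE// ts.
by rewrite in_chart_out// trmx0.
Qed.

End Charts.

(** * The phi-Sasaki metric in an induced chart *)

Section SasakiCharts.
Variables (R : realType) (n : nat) (M : charted R n) (phi g : mx_field M).
Hypothesis manM : is_manifold M.
Variable G : mx_field (tangent_bundle M).
Hypothesis sasG : is_phi_sasaki phi g G.
Variable b : chart M.
Let U := coord b @` dom b.
Local Notation gb := (local_mx g b).
Local Notation h := (local_mx G (b : chart (tangent_bundle M))).

Lemma TU_points z : TU U z -> exists q : tangent_bundle M,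
  dom b (projT1 q) /\ z = row_mx (coord b (projT1 q)) (sval (projT2 q) b).
Proof.
move=> [p bp E]; have [v vE] := tangent_of_components manM (rsubmx z) bp.
by exists (existT _ p v); split => //=; rewrite E vE hsubmxK.
Qed.

Lemma local_sasaki_sym z : (h z)^T = h z.
Proof.
rewrite /local_mx /in_chart; case: pselect => [e|]; last by rewrite trmx0.
by case: (cid e) => q [bq _] /=; exact: (phi_sasaki_sym sasG).
Qed.

Lemma local_sasakiE z c d : TU U z -> inner (h z) c d =
  inner (gb (lsubmx z)) (lsubmx c) (lsubmx d)
  + inner (gb (lsubmx z)) (connector (gamma gb) z c)
      (connector (gamma gb) z d *m local_mx phi b (lsubmx z)).
Proof.
move=> /TU_points[q [bq ->]]; rewrite row_mxKl /local_mx in_chartTE// !in_chartE//.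
(* Every vector is the horizontal lift of its projection plus the vertical lift of its connector, so
   the four defining equations determine the metric. *)
have dec w : w = hlift g q b (lsubmx w) + vlift (connector (gamma (local_mx g b))
    (row_mx (coord b (projT1 q)) (sval (projT2 q) b)) w).
  rewrite connectorE row_mxKl row_mxKr /hlift /vlift add_row_mx addr0.
  by rewrite addrCA addNr addr0 hsubmxK.
rewrite {1}(dec c) {1}(dec d) !innerDl !innerDr.
rewrite (phi_sasaki_hh sasG)// (phi_sasaki_hv sasG)// (phi_sasaki_vv sasG)//.
rewrite -[X in _ + (X + _)]inner_tr (phi_sasaki_sym sasG)// (phi_sasaki_hv sasG)//.
by rewrite addr0 add0r.
Qed.

End SasakiCharts.

(** * From one chart to the manifold *)

Section BiharmonicManifold.
Variables (R : realType) (m : nat) (M : charted R (2 * m)).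
Local Notation n := (2 * m)%N.
Variables (phi g : mx_field M) (G : mx_field (tangent_bundle M)) (xi : vector_field M).
Hypothesis manM : is_manifold M.
Hypothesis pkn : para_kahler_norden phi g.
Hypothesis sasG : is_phi_sasaki phi g G.
Hypothesis sxi : smooth_vf xi.
Local Notation img c := (coord c @` dom c).

Let rg : riemannian g := pkn_metric pkn.

Let g_sym (a : chart M) x : (local_mx g a x)^T = local_mx g a x.
Proof. by apply: local_mx_sym => // p ap; exact: (Defs.metric_sym rg ap). Qed.

Let g_unit (a : chart M) x : img a x -> local_mx g a x \in unitmx.
Proof.
move=> [p ap <-]; rewrite /local_mx in_chartE//.
rewrite -row_free_unit; apply: inj_row_free => v v0; apply/eqP/negP => /negP vn0.
by have := Defs.metric_pos rg ap vn0; rewrite /inner v0 mul0mx mxE ltxx.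
Qed.

Let sphi (a : chart M) : smooth_on (img a) (local_mx phi a).
Proof. exact: (pkn_smooth pkn). Qed.
Let sg (a : chart M) : smooth_on (img a) (local_mx g a).
Proof. exact: (Defs.metric_smooth rg). Qed.

Let parallel (a : chart M) x z v : img a x ->
  'D_z (fun y => v *m local_mx phi a y) x
  + gamma (local_mx g a) x z (v *m local_mx phi a x) =
  gamma (local_mx g a) x z v *m local_mx phi a x.
Proof.
move=> ax; have sc (c : 'rV[R]_n) : smooth_on (img a) (fun=> c).
  exact: smooth_on_cst.
have E : 'D_z (fun y => v *m local_mx phi a y) x
    + gamma (local_mx g a) x z (v *m local_mx phi a x) =
    ('D_z (fun=> v) x + gamma (local_mx g a) x z v) *m local_mx phi a x.
  (* Fields with constant components are enough: z for the direction and v for the argument of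
     phi. *)
  exact: (pkn_parallel pkn (sc z) (sc v) ax).
by rewrite E derive_cst add0r.
Qed.

Let adj (a : chart M) x u v : img a x ->
  inner (local_mx g a x) (u *m local_mx phi a x) v =
  inner (local_mx g a x) u (v *m local_mx phi a x).
Proof.
by move=> [p ap <-]; rewrite /local_mx !in_chartE//; exact: (pkn_sym pkn ap).
Qed.

Let invol (a : chart M) x : img a x -> local_mx phi a x *m local_mx phi a x = 1%:M.
Proof.
by move=> [p ap <-]; rewrite /local_mx in_chartE//; exact: (pkn_involutive pkn ap).
Qed.

Let local_section (b : chart M) (x : 'rV[R]_n) : 'rV[R]_(n + n) :=
  row_mx x (local_vf xi b x).

Lemma bitension_section_eq0 (b : chart M) p : dom b p ->
  bitension (local_mx g b) (local_mx G (b : chart (tangent_bundle M)))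
    (local_section b) (coord b p) = 0 <->
  first_expr (local_mx phi b) (local_mx g b) (local_vf xi b) (coord b p) = 0 /\
  second_expr (local_mx phi b) (local_mx g b) (local_vf xi b) (coord b p) = 0.
Proof.
move=> bp; have bU : img b (coord b p) by exists p.
exact: (bitension_eq0 (chart_image_open manM (a := b)) (@sg b) (@g_sym b)
  (@g_unit b) (@sphi b) (@parallel b) (@adj b) (@invol b)
  (local_sasaki_sym sasG b) (@local_sasakiE _ _ _ _ _ manM _ sasG b) (@sxi b) bU).
Qed.

(** The target chart stays b; only the source chart changes, through the transition map on the
    overlap. It is an isometry there because the components of g obey the law of a bilinear
    field. *)
Lemma bitension_charts (a b : chart M) p : dom a p -> dom b p ->
  bitension (local_mx g a) (local_mx G (b : chart (tangent_bundle M)))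
    (in_chart a (fun q => coord (b : chart (tangent_bundle M)) (section_map xi q)))
    (coord a p) =
  bitension (local_mx g b) (local_mx G (b : chart (tangent_bundle M)))
    (local_section b) (coord b p).
Proof.
move=> ap bp; rewrite -(transitionE manM b ap).
have oB := chart_image_open manM (a := b).
have oA := overlap_open manM (a := a) (b := b).
have AU : coord a @` (dom a `&` dom b) `<=` img a by move=> _ [q [aq _] <-]; exists q.
have tB x : (coord a @` (dom a `&` dom b)) x -> img b (transition a b x).
  by move=> [q [aq bq] <-]; rewrite transitionE//; exists q.
have isom x u v : (coord a @` (dom a `&` dom b)) x -> inner (local_mx g a x) u v =
    inner (local_mx g b (transition a b x)) ('D_u (transition a b) x)
      ('D_v (transition a b) x).
  move=> [q [aq bq] <-].
  rewrite (derive_transition manM u aq bq) (derive_transition manM v aq bq).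
  rewrite transitionE// /local_mx !in_chartE// (Defs.metric_tensor rg aq bq).
  by rewrite /inner trmx_mul !mulmxA.
have psiE x : (coord a @` (dom a `&` dom b)) x ->
    in_chart a (fun q => coord (b : chart (tangent_bundle M)) (section_map xi q)) x =
    local_section b (transition a b x).
  move=> [q [aq bq] <-].
  by rewrite in_chartE// transitionE// /local_section /local_vf in_chartE.
apply: (bitension_pullback oA oB (@transition_smooth _ _ _ manM a b) tB
  (smooth_on_sub AU (@sg a)) (@g_sym a) (fun x Ax => g_unit (AU x Ax)) (@sg b)
  (@g_sym b) (@g_unit b) isom _ _ _ psiE); last by exists p.
- exact: (sasaki_connection oB (@sg b) (@g_sym b) (@g_unit b) (@sphi b) (@parallel b)
    (@adj b) (@invol b) (local_sasaki_sym sasG b)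
    (@local_sasakiE _ _ _ _ _ manM _ sasG b)).
- exact: (smooth_on_row_mx oB (smooth_on_id oB) (@sxi b)).
- by move=> y By; rewrite /TU /= row_mxKl.
exact: (smooth_tension_section oB (@sg b) (@g_sym b) (@g_unit b) (@sphi b)
  (@parallel b) (@adj b) (@invol b) (local_sasaki_sym sasG b)
  (@local_sasakiE _ _ _ _ _ manM _ sasG b) (@sxi b)).
Qed.

End BiharmonicManifold.

Theorem theorem4p2 (R : realType) (m : nat) (M : charted R (2 * m))
    (phi g : mx_field M) (G : mx_field (tangent_bundle M))
    (xi : vector_field M) :
  is_manifold M ->
  para_kahler_norden phi g ->
  is_phi_sasaki phi g G ->
  smooth_vf xi ->
  biharmonic g G (section_map xi) <->
  (vanishes (fun a : chart M =>
     first_expr (local_mx phi a) (local_mx g a) (local_vf xi a)) /\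
   vanishes (fun a : chart M =>
     second_expr (local_mx phi a) (local_mx g a) (local_vf xi a))).
Proof.
move=> manM pkn sasG sxi; split => [bih|[v1 v2] a b p ap bp].
  (* The same chart serves in the source and in the target; [bitension_charts] then only replaces
     the map read through [in_chart] by the pair (x, xi x). *)
  have eq0 a p : dom a p -> _ := fun ap =>
    (bitension_section_eq0 manM pkn sasG sxi ap).1
      (etrans (esym (bitension_charts manM pkn sasG sxi ap ap)) (bih a a p ap ap)).
  by split => a p ap; have [] := eq0 a p ap.
rewrite (bitension_charts manM pkn sasG sxi ap bp).
apply/(bitension_section_eq0 manM pkn sasG sxi bp); split; [exact: v1|exact: v2].
Qed.
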